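(* (i) For $z\in H^2(\mathcal T)$ the following equivalence holds: $$z\in H^2_0(\Omega)\quad\Longleftrightarrow\quad\langle\boldsymbol q,z\rangle_{\mathcal S}=0\quad\forall\boldsymbol q\in\mathbf H^{-3/2,-1/2}(\mathcal S).$$ (ii) For every $\boldsymbol v=(\boldsymbol v_T)_{T\in\mathcal T}\in\mathbf H^{3/2,1/2}_{00}(\mathcal S)$, $$\sum_{T\in\mathcal T}\|\boldsymbol v_T\|_{\mathrm{Ggrad},\partial T}^2=\|\boldsymbol v\|_{\mathrm{Ggrad},0,\mathcal S}^2 .$$
   Context: Let $d\in\{2,3\}$ and let $\Omega\subset\mathbb R^d$ be a bounded simply connected Lipschitz domain. $\mathcal T$ is a (finite) mesh of $\Omega$ consisting of pairwise non-intersecting open Lipschitz elements $T$ whose closures cover $\overline\Omega$; $\mathcal S=\{\partial T: T\in\mathcal T\}$. $\mathrm{div}$ is the divergence of vector fields, $\mathbf{div}$ the row-wise divergence of tensors, $\boldsymbol\varepsilon$ the symmetric gradient, so $\boldsymbol\varepsilon\nabla z$ is the Hessian of $z$. $(\cdot,\cdot)_T,\|\cdot\|_T$ are the $L_2(T)$ inner product and norm; without index they refer to $\Omega$. $H^2(T)$ is the closure of the smooth functions on $\overline T$ w.r.t. $\|z\|_{2,T}^2=\|z\|_T^2+\|\boldsymbol\varepsilon\nabla z\|_T^2$; $H(\mathrm{div}\,\mathbf{div},T)$ is the closure of the smooth symmetric tensors on $\overline T$ w.r.t. $\|\mathbf\Theta\|_{\mathrm{div}\,\mathbf{div},T}^2=\|\mathbf\Theta\|_T^2+\|\mathrm{div}\,\mathbf{div}\,\mathbf\Theta\|_T^2$.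 $H^2(\mathcal T)=\{z\in L_2(\Omega): z|_T\in H^2(T)\ \forall T\in\mathcal T\}$. $H^2_0(\Omega)$ is the closure of $C_c^\infty(\Omega)$ w.r.t. $\|z\|_2^2=\|z\|^2+\|\boldsymbol\varepsilon\nabla z\|^2$, and $H(\mathrm{div}\,\mathbf{div},\Omega)$ the closure of the smooth symmetric tensors on $\overline\Omega$ w.r.t. $\|\mathbf\Theta\|_{\mathrm{div}\,\mathbf{div}}^2=\|\mathbf\Theta\|^2+\|\mathrm{div}\,\mathbf{div}\,\mathbf\Theta\|^2$. Traces: $\mathrm{tr}^{\mathrm{dDiv}}_T:H(\mathrm{div}\,\mathbf{div},T)\to H^2(T)'$ and $\mathrm{tr}^{\mathrm{Ggrad}}_T:H^2(T)\to H(\mathrm{div}\,\mathbf{div},T)'$ are defined by $$\langle\mathrm{tr}^{\mathrm{dDiv}}_T(\mathbf\Theta),z\rangle_{\partial T}=\langle\mathrm{tr}^{\mathrm{Ggrad}}_T(z),\mathbf\Theta\rangle_{\partial T}=(\mathrm{div}\,\mathbf{div}\,\mathbf\Theta,z)_T-(\mathbf\Theta,\boldsymbol\varepsilon\nabla z)_T .$$ $\mathrm{tr}^{\mathrm{dDiv}}(\mathbf\Theta)=(\mathrm{tr}^{\mathrm{dDiv}}_T(\mathbf\Theta))_T$ for $\mathbf\Theta\in H(\mathrm{div}\,\mathbf{div},\Omega)$, with range $\mathbf H^{-3/2,-1/2}(\mathcal S)$; $\langle\boldsymbol q,z\rangle_{\mathcal S}=\sum_T\langle\boldsymbol q_T,z\rangle_{\partial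 T}$ for $\boldsymbol q=(\boldsymbol q_T)_T\in\mathbf H^{-3/2,-1/2}(\mathcal S)$ and $z\in H^2(\mathcal T)$. $\mathrm{tr}^{\mathrm{Ggrad}}(z)=(\mathrm{tr}^{\mathrm{Ggrad}}_T(z))_T$ for $z\in H^2_0(\Omega)$, with range $\mathbf H^{3/2,1/2}_{00}(\mathcal S)$. Norms: $$\|\boldsymbol v_T\|_{\mathrm{Ggrad},\partial T}=\inf\{\|v\|_{2,T}:v\in H^2(T),\ \mathrm{tr}^{\mathrm{Ggrad}}_T(v)=\boldsymbol v_T\},\quad \|\boldsymbol v\|_{\mathrm{Ggrad},0,\mathcal S}=\inf\{\|v\|_2:v\in H^2_0(\Omega),\ \mathrm{tr}^{\mathrm{Ggrad}}(v)=\boldsymbol v\}.$$ *)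

(* Defs.v *)
From HB Require Import structures.
From mathcomp Require Import all_boot all_order all_algebra.
From mathcomp Require Import all_classical all_reals all_analysis.

Set Implicit Arguments.
Unset Strict Implicit.
Unset Printing Implicit Defensive.

Import Order.TTheory GRing.Theory Num.Theory.
Import numFieldNormedType.Exports.

Local Open Scope classical_set_scope.
Local Open Scope ring_scope.

(** R^n is ['rV[R]_n].  The library equips it with a topology and with the max
    norm, but with no measure.  It gets here the sigma-algebra generated by the
    coordinates (the Borel one), and Lebesgue measure is the iterated product
    of the one-dimensional Lebesgue measure. *)

Definition rV_display : measure_display. Proof. exact. Qed.

Section measurable_rV.
Context {R : realType}.
Variable n : nat.

Let coors : 'I_n -> 'rV[R]_n -> measurableTypeR R := fun i x => x ord0 i.

Let rV_set0 : g_sigma_preimage coors set0.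
Proof. exact: sigma_algebra0. Qed.

Let rV_setC A : g_sigma_preimage coors A -> g_sigma_preimage coors (~` A).
Proof. exact: sigma_algebraC. Qed.

Let rV_bigcup (F : _^nat) : (forall i, g_sigma_preimage coors (F i)) ->
  g_sigma_preimage coors (\bigcup_i (F i)).
Proof. exact: sigma_algebra_bigcup. Qed.

HB.instance Definition _ := @isMeasurable.Build rV_display
  'rV[R]_n (g_sigma_preimage coors) rV_set0 rV_setC rV_bigcup.

End measurable_rV.

Lemma measurable_coord (R : realType) n (i : 'I_n) :
  measurable_fun [set: 'rV[R]_n]
    (fun x => x ord0 i : measurableTypeR R).
Proof.
move=> _ Y mY; rewrite setTI; apply: sub_sigma_algebra => /=.
rewrite -bigcup_seq/=; exists i => /=; first by rewrite mem_index_enum.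
by exists Y => //; rewrite setTI.
Qed.

Lemma measurable_fun_rV (R : realType) d (T : measurableType d) n
    (f : T -> 'rV[R]_n) :
  (forall i, measurable_fun [set: T]
     (fun x => f x ord0 i : measurableTypeR R)) ->
  measurable_fun [set: T] f.
Proof.
move=> mf.
suff : g_sigma_preimage
    (fun i => (fun x : 'rV[R]_n => x ord0 i : measurableTypeR R) \o f)
    `<=` measurable.
  rewrite g_sigma_preimage_comp => prefS.
  by move=> _ A mA; apply: prefS; exists A.
apply: smallest_sub; first exact: sigma_algebra_measurable.
case: n => [|n] in f mf *; first by rewrite big_ord0.
rewrite -bigcup_mkord_ord; apply: bigcup_sub => i Ii.
by move=> A [B mB <-]; exact: mf.
Qed.

Definition rV_cons {R : realType} {n} (p : measurableTypeR R * 'rV[R]_n) :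
  'rV[R]_n.+1 := row_mx (p.1 : R)%:M p.2 : 'rV[R]_(1 + n).

Definition rV_uncons {R : realType} {n} (x : 'rV[R]_n.+1) :
    measurableTypeR R * 'rV[R]_n :=
  ((lsubmx (x : 'rV[R]_(1 + n)) ord0 ord0 : measurableTypeR R),
   rsubmx (x : 'rV[R]_(1 + n))).

Lemma rV_consK (R : realType) n : cancel (@rV_cons R n) (@rV_uncons R n).
Proof.
case=> a x; rewrite /rV_uncons /rV_cons row_mxKl row_mxKr /=.
by rewrite mxE eqxx mulr1n.
Qed.

Lemma measurable_rV_cons (R : realType) n :
  measurable_fun setT (@rV_cons R n).
Proof.
apply: measurable_fun_rV => i; rewrite /rV_cons.
have [j ->|j ->] := split_ordP (i : 'I_(1 + n)).
  rewrite (_ : (fun _ => _) = fst); first exact: measurable_fst.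
  by apply/funext => -[a x] /=; rewrite (@row_mxEl R 1 1 n) mxE !ord1 eqxx mulr1n.
rewrite (_ : (fun _ => _) =
  (fun x : 'rV[R]_n => x ord0 j : measurableTypeR R) \o snd).
  by apply: measurableT_comp; [exact: measurable_coord|exact: measurable_snd].
by apply/funext => -[a x] /=; rewrite (@row_mxEr R 1 1 n).
Qed.

Lemma measurable_rV_uncons (R : realType) n :
  measurable_fun setT (@rV_uncons R n).
Proof.
apply/measurable_fun_pairP; split; rewrite /comp /rV_uncons /=.
  rewrite (_ : (fun _ => _) = fun x : 'rV[R]_n.+1 =>
     x ord0 (@lshift 1 n ord0) : measurableTypeR R).
    exact: measurable_coord.
  by apply/funext => x; rewrite mxE.
apply: measurable_fun_rV => i.
rewrite (_ : (fun _ => _) = fun x : 'rV[R]_n.+1 =>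
   x ord0 (@rshift 1 n i) : measurableTypeR R).
  exact: measurable_coord.
by apply/funext => x; rewrite mxE.
Qed.

Section lebesgue_rVS.
Context {R : realType} {n : nat}.
Variable mu : {sigma_finite_measure set 'rV[R]_n -> \bar R}.
Local Open Scope ereal_scope.

Let lambda : {sigma_finite_measure set (measurableTypeR R) -> \bar R} :=
  @lebesgue_measure R.

Definition lebesgue_rVS : set 'rV[R]_n.+1 -> \bar R :=
  pushforward (lambda \x mu) rV_cons.

Let lebesgue_rVS0 : lebesgue_rVS set0 = 0.
Proof. by rewrite /lebesgue_rVS /pushforward preimage_set0 measure0. Qed.

Let lebesgue_rVS_ge0 A : 0 <= lebesgue_rVS A.
Proof. exact: (measure_ge0 (lambda \x mu)). Qed.

Let lebesgue_rVS_sigma_additive : semi_sigma_additive lebesgue_rVS.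
Proof.
move=> F mF tF mUF.
have := @measure_semi_sigma_additive _ _ _
  (measure_function_pushforward__canonical__measure_function_Measure
     (lambda \x mu) (@measurable_rV_cons R n)).
exact.
Qed.

HB.instance Definition _ := isMeasure.Build _ _ _ lebesgue_rVS
  lebesgue_rVS0 lebesgue_rVS_ge0 lebesgue_rVS_sigma_additive.

Let lebesgue_rVS_sigma_finite : sigma_finite setT lebesgue_rVS.
Proof.
have /sigma_finiteP[F [TF ndF Foo]] := sigma_finiteT lambda.
have /sigma_finiteP[G [TG ndG Goo]] := sigma_finiteT mu.
exists (fun k => rV_uncons @^-1` (F k `*` G k)).
  rewrite -preimage_bigcup -(preimage_setT rV_uncons); congr (_ @^-1` _).
  rewrite -setXTT TF TG predeqE => -[x y]; split.
    move=> [/= [k _ Fkx] [l _ Gly]]; exists (maxn k l) => //; split.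
    - by move: x Fkx; exact/subsetPset/ndF/leq_maxl.
    - by move: y Gly; exact/subsetPset/ndG/leq_maxr.
  by move=> [k _ []/= ? ?]; split; exists k.
move=> k; have [mF Fkoo] := Foo k; have [mG Gkoo] := Goo k; split.
  rewrite -[X in measurable X]setTI; apply: measurable_rV_uncons => //.
  exact: measurableX.
rewrite /lebesgue_rVS /pushforward (_ : _ @^-1` _ = F k `*` G k).
  by rewrite product_measure1E// lte_mul_pinfty// ge0_fin_numE.
by apply/funext => p; rewrite /preimage /mkset rV_consK.
Qed.

HB.instance Definition _ := Measure_isSigmaFinite.Build _ _ _ lebesgue_rVS
  lebesgue_rVS_sigma_finite.

End lebesgue_rVS.

Fixpoint lebesgue_rV (R : realType) (n : nat) :
    {sigma_finite_measure set 'rV[R]_n -> \bar R} :=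
  match n with
  | 0 => \d_(0 : 'rV[R]_0)
  | n'.+1 => lebesgue_rVS (lebesgue_rV R n')
  end.

Section domains.
Context {R : realType} {d : nat}.
Implicit Types A : set 'rV[R]_d.

(** For an open set: near each boundary point, in suitable orthonormal coordinates
    (y', y_d) = (y P, y e), the set is the strict epigraph of a Lipschitz
    function of the d-1 variables y'. *)
Definition lipschitz_boundary A :=
  forall x : 'rV[R]_d, (closure A `\` A°) x ->
    exists (r k : R) (P : 'M[R]_(d, d.-1)) (e : 'cV[R]_d)
        (g : 'rV[R]_d.-1 -> R),
      [/\ 0 < r,
          [/\ P^T *m P = 1%:M, e^T *m e = 1%:M & P^T *m e = 0],
          k.-lipschitz g &
          A `&` ball x r = [set y | g (y *m P) < (y *m e) ord0 ord0] `&` ball x r].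

(** Meant for open sets, where connected and path connected coincide: every
    loop is contractible with a fixed base point. *)
Definition simply_connected A :=
  connected A /\
  forall c : R -> 'rV[R]_d,
    {within `[0, 1], continuous c} -> c 0 = c 1 ->
    (forall t : R, 0 <= t <= 1 -> A (c t)) ->
    exists h : R * R -> 'rV[R]_d,
      [/\ {within `[0, 1] `*` `[0, 1], continuous h},
          forall s t : R, 0 <= s <= 1 -> 0 <= t <= 1 -> A (h (s, t)),
          forall t : R, 0 <= t <= 1 -> h (0, t) = c t,
          forall t : R, 0 <= t <= 1 -> h (1, t) = c 0 &
          forall s : R, 0 <= s <= 1 -> h (s, 0) = c 0 /\ h (s, 1) = c 0].

Definition bounded_sc_lipschitz_domain A :=
  [/\ A !=set0, open A, bounded_set A, simply_connected A & lipschitz_boundary A].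

Definition mesh (N : nat) A (T : 'I_N -> set 'rV[R]_d) :=
  [/\ forall i, [/\ T i !=set0, open (T i), T i `<=` A & lipschitz_boundary (T i)],
      forall i j, i != j -> T i `&` T j = set0 &
      closure A = \bigcup_i closure (T i)].

End domains.

Section smooth.
Context {R : realType} {d : nat}.
Implicit Types (f : 'rV[R]_d -> R) (A : set 'rV[R]_d).

Definition partial (i : 'I_d) f : 'rV[R]_d -> R :=
  fun x => 'D_(delta_mx ord0 i) f x.

Definition smooth f :=
  forall s : seq 'I_d,
    continuous (foldr partial f s) /\
    forall (x : 'rV[R]_d) i, derivable (foldr partial f s) x (delta_mx ord0 i).

Definition test_function A f :=
  smooth f /\ compact (closure [set x | f x != 0]) /\
  closure [set x | f x != 0] `<=` A.

Definition smooth_sym_tensor (Th : 'rV[R]_d -> 'M[R]_d) :=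
  (forall i j, smooth (fun x => Th x i j)) /\ forall x, (Th x)^T = Th x.

End smooth.

(** Elements of L2(A) are represented by functions on R^d of which only the
    values on A matter. *)

Section L2.
Context {R : realType} {d : nat}.
Implicit Types (A : set 'rV[R]_d) (z f : 'rV[R]_d -> R)
  (Th G : 'rV[R]_d -> 'M[R]_d).

Definition L2 A : set ('rV[R]_d -> R) :=
  [set z | (patch (cst 0) A z : 'rV[R]_d -> R) \in Lfun (lebesgue_rV R d) 2%:E].

Definition L2mx A : set ('rV[R]_d -> 'M[R]_d) :=
  [set Th | forall i j, L2 A (fun x => Th x i j)].

Definition inner A z f : R := \int[lebesgue_rV R d]_(x in A) (z x * f x).

Definition innermx A Th G : R :=
  \sum_i \sum_j inner A (fun x => Th x i j) (fun x => G x i j).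

(** eps(grad z) is the Hessian of [z], taken in the distributional sense. *)
Definition weak_hessian A z G :=
  L2mx A G /\
  forall (phi : 'rV[R]_d -> R) i j, test_function A phi ->
    inner A (fun x => G x i j) phi = inner A z (partial i (partial j phi)).

(** div (Div Th) = sum_ij d_i d_j Th_ij, in the distributional sense, where
    [Div] is the row-wise divergence. *)
Definition weak_divdiv A Th f :=
  L2 A f /\
  forall phi, test_function A phi ->
    inner A f phi =
    \sum_i \sum_j inner A (fun x => Th x i j) (partial i (partial j phi)).

(** The derivatives [weak_hessian] and [weak_divdiv] determine are unique
    almost everywhere on [A]; an arbitrary representative is selected. *)
Definition hess A z : 'rV[R]_d -> 'M[R]_d := xget (cst 0) (weak_hessian A z).

Definition divdiv A Th : 'rV[R]_d -> R := xget (cst 0) (weak_divdiv A Th).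

End L2.

(** The completions for the graph norms are realized inside L2: an element is
    an L2 function whose distributional derivative is in L2 and which smooth
    functions approximate in the graph norm.  Functions smooth on the closure
    of [A] are the restrictions of smooth functions on R^d. *)

Section spaces.
Context {R : realType} {d : nat}.
Implicit Types (A : set 'rV[R]_d) (z : 'rV[R]_d -> R) (Th : 'rV[R]_d -> 'M[R]_d).

Definition norm2 A z : R :=
  Num.sqrt (inner A z z + innermx A (hess A z) (hess A z)).

Definition norm_divdiv A Th : R :=
  Num.sqrt (innermx A Th Th + inner A (divdiv A Th) (divdiv A Th)).

Definition closure2 A (D : set ('rV[R]_d -> R)) : set ('rV[R]_d -> R) :=
  [set z | [/\ L2 A z, exists G, weak_hessian A z G &
    forall eps, 0 < eps -> exists2 phi, D phi & norm2 A (z \- phi) < eps]].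

Definition H2 A : set ('rV[R]_d -> R) := closure2 A smooth.

Definition H20 A : set ('rV[R]_d -> R) := closure2 A (test_function A).

Definition Hdivdiv A : set ('rV[R]_d -> 'M[R]_d) :=
  [set Th | [/\ L2mx A Th, exists f, weak_divdiv A Th f &
    forall eps, 0 < eps ->
      exists2 Psi, smooth_sym_tensor Psi & norm_divdiv A (Th \- Psi) < eps]].

Definition H2mesh N A (T : 'I_N -> set 'rV[R]_d) : set ('rV[R]_d -> R) :=
  [set z | L2 A z /\ forall i, H2 (T i) z].

End spaces.

(** A functional on [H2 A] or [Hdivdiv A] is represented by its extension by
    [0] outside the space, so that Leibniz equality of representatives is
    equality of functionals. *)

Section traces.
Context {R : realType} {d : nat}.
Implicit Types (A : set 'rV[R]_d) (z : 'rV[R]_d -> R) (Th : 'rV[R]_d -> 'M[R]_d).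

Definition bdual A Th z : R := inner A (divdiv A Th) z - innermx A Th (hess A z).

Definition tr_dDiv A Th : ('rV[R]_d -> R) -> R :=
  patch (cst 0) (H2 A) (bdual A Th).

Definition tr_Ggrad A z : ('rV[R]_d -> 'M[R]_d) -> R :=
  patch (cst 0) (Hdivdiv A) ((bdual A)^~ z).

Section skeleton.
Variables (N : nat) (Omega : set 'rV[R]_d) (T : 'I_N -> set 'rV[R]_d).

(** H^(-3/2,-1/2)(S) *)
Definition trace_space_dDiv : set ('I_N -> ('rV[R]_d -> R) -> R) :=
  [set (fun i => tr_dDiv (T i) Th) | Th in Hdivdiv Omega].

(** H^(3/2,1/2)_00(S) *)
Definition trace_space_Ggrad0 : set ('I_N -> ('rV[R]_d -> 'M[R]_d) -> R) :=
  [set (fun i => tr_Ggrad (T i) z) | z in H20 Omega].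

Definition pairing_S (q : 'I_N -> ('rV[R]_d -> R) -> R) z : R := \sum_i q i z.

Definition norm_Ggrad A (vT : ('rV[R]_d -> 'M[R]_d) -> R) : R :=
  inf [set norm2 A v | v in [set v | H2 A v /\ tr_Ggrad A v = vT]].

Definition norm_Ggrad0 (v : 'I_N -> ('rV[R]_d -> 'M[R]_d) -> R) : R :=
  inf [set norm2 Omega w | w in
        [set w | H20 Omega w /\ (fun i => tr_Ggrad (T i) w) = v]].

End skeleton.
End traces.

(* Main.v *)
Require Import Defs.
From mathcomp Require Import all_boot all_order all_algebra.
From mathcomp Require Import all_classical all_reals all_analysis.
From mathcomp Require Import measurable_realfun.
From mathcomp Require finmap.
From mathcomp Require Import ring lra.

Set Implicit Arguments.
Unset Strict Implicit.
Unset Printing Implicit Defensive.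

Import Order.TTheory GRing.Theory Num.Theory.
Import numFieldNormedType.Exports.

Local Open Scope classical_set_scope.
Local Open Scope ring_scope.

(** Everything rests on integration by parts on the elements. The skeleton is a
    null set ([mesh_cover]), so integrals over the domain are sums of integrals
    over the elements, and weak derivatives restrict to elements.

    The easy half of (i). For Th in H(div div) and z in H^2_0, the sum of the
    element pairings is therefore (div Div Th, z) - (Th, hess z) on the whole
    domain. It vanishes when z is a test function, by the definition of the weak
    divergence, and it is continuous in z for the H^2 norm ([H20_green]).

    The other half of (i). Take Th = phi (E_ij + E_ji) with phi smooth on R^d. The
    vanishing of the pairing says that the piecewise Hessian G of z, once
    symmetrized, satisfies (z, d_i d_j phi) = (G_ij, phi) for all smooth phi,
    including those that do not vanish near the boundary ([pairing0_H20]). In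
    other words the extension of z by zero has a weak Hessian in L2(R^d), namely
    the extension of G by zero. Such a function is a limit of test functions
    ([weak_hessian_smooth_H20]). Its mollifications are smooth on R^d and their
    Hessians are the mollifications of G, but their support exceeds the domain by
    the mollification radius. So they are cut into pieces by a partition of unity,
    and each piece is translated along the axis of a chart by a length t much
    larger than the mollification radius: by the Lipschitz property this brings
    the support inside the domain ([lipschitz_inward]). The error tends to zero
    because translations are continuous in L2; the first derivatives that the
    partition of unity produces are controlled by the function and its second
    derivatives ([nrm_partial_le]).

    Part (ii). The square of the H^2 norm is additive over the mesh
    ([norm2_mesh]). Restricting a global extension of the trace v to the elements
    gives local extensions. Conversely, local extensions glue to a function whose
    pairing with any Th only depends on v; that pairing is the one of a function
    in H^2_0, hence zero, and by (i) the glued function is in H^2_0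
    ([H20_of_tr_Ggrad]). So the global extensions are exactly the families of
    local ones, and the infimum of a sum of independent terms is the sum of the
    infima.

    The analysis on R^d is built from the translation invariance of Lebesgue
    measure ([lebesgue_shift]): it gives integration by parts
    ([Rintegral_partial]) and, starting from open sets, the continuity of
    translations in L2 ([L2_translation_continuous]), from which the convergence of
    mollifications follows ([mollification]) and then the uniqueness of weak
    derivatives ([du_bois_reymond]). *)

(** * Square-integrable functions *)

Section square_integrable.
Context d (T : measurableType d) (R : realType) (mu : {measure set T -> \bar R}).
Implicit Types f g h : T -> R.

Definition sqint f := measurable_fun setT f /\
  mu.-integrable setT (EFin \o (fun x => f x ^+ 2)).

Definition ip f g : R := \int[mu]_x (f x * g x).

Definition nrm f : R := Num.sqrt (ip f f).

Lemma integrable_le f g : measurable_fun setT f ->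
  mu.-integrable setT (EFin \o g) -> (forall x, `|f x| <= g x) ->
  mu.-integrable setT (EFin \o f).
Proof.
move=> mf ig fg; apply: le_integrable ig => //.
  exact/measurable_EFinP.
move=> x _ /=; rewrite lee_fin (le_trans (fg x))//; exact: ler_norm.
Qed.

Lemma le_Rint f g : mu.-integrable setT (EFin \o f) ->
  mu.-integrable setT (EFin \o g) -> (forall x, f x <= g x) ->
  \int[mu]_x f x <= \int[mu]_x g x.
Proof. by move=> If Ig fg; apply: le_Rintegral => // x _; exact: fg. Qed.

Lemma sqint_meas f : sqint f -> measurable_fun setT f. Proof. by case. Qed.

Lemma sqintM f g : sqint f -> sqint g -> mu.-integrable setT (EFin \o (fun x => f x * g x)).
Proof.
move=> [mf If] [mg Ig].
apply: (@integrable_le _ (fun x => f x ^+ 2 + g x ^+ 2)).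
- exact: measurable_funM.
- by apply: (integrableD _ If Ig).
- move=> x; rewrite normrM -(real_normK (num_real (f x))) -(real_normK (num_real (g x))).
  by move: (normr_ge0 (f x)) (normr_ge0 (g x)); set a := `|f x|; set b := `|g x|; nra.
Qed.

Lemma sqint_le f g : measurable_fun setT f -> sqint g ->
  (forall x, `|f x| <= `|g x|) -> sqint f.
Proof.
move=> mf [mg Ig] fg; split => //; apply: integrable_le Ig _.
  exact: measurable_funX.
move=> x; rewrite ger0_norm ?sqr_ge0// -(real_normK (num_real (f x))).
by rewrite -(real_normK (num_real (g x))) ler_pXn2r// nnegrE.
Qed.

Lemma sqintZ (c : R) f : sqint f -> sqint (fun x => c * f x).
Proof.
move=> [mf If]; split; first exact: measurable_funM.
have := integrableZl (measurableT) (c ^+ 2) If.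
by apply: eq_integrable => // x _ /=; rewrite exprMn EFinM.
Qed.

Lemma sqintD f g : sqint f -> sqint g -> sqint (fun x => f x + g x).
Proof.
move=> [mf If] [mg Ig]; split; first exact: measurable_funD.
apply: (@integrable_le _ (fun x => 2 * f x ^+ 2 + 2 * g x ^+ 2)).
- by apply: measurable_funX; exact: measurable_funD.
- have If2 := integrableZl measurableT 2 If.
  have Ig2 := integrableZl measurableT 2 Ig.
  by apply: (integrableD _ If2 Ig2).
- by move=> x; rewrite ger0_norm ?sqr_ge0//; have := sqr_ge0 (f x - g x); nra.
Qed.

Lemma sqintN f : sqint f -> sqint (fun x => - f x).
Proof.
move=> /(sqintZ (-1)); congr (sqint _).
by apply/funext => x; rewrite mulN1r.
Qed.

Lemma sqintB f g : sqint f -> sqint g -> sqint (fun x => f x - g x).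
Proof. by move=> sf sg; apply: sqintD => //; exact: sqintN. Qed.

Lemma sqint0 : sqint (fun=> 0).
Proof.
split; first exact: measurable_cst.
rewrite (_ : _ \o _ = cst 0%E); first exact: integrable0.
by apply/funext => x /=; rewrite expr0n.
Qed.

Lemma sqint_sum I (r : seq I) (F : I -> T -> R) :
  (forall i, sqint (F i)) -> sqint (fun x => \sum_(i <- r) F i x).
Proof.
move=> sF; elim: r => [|i r IH].
  by under eq_fun do rewrite big_nil; exact: sqint0.
by under eq_fun do rewrite big_cons; exact: sqintD.
Qed.

Lemma ipC f g : ip f g = ip g f.
Proof. by apply: eq_Rintegral => x _; rewrite mulrC. Qed.

Lemma ipDl f g h : sqint f -> sqint g -> sqint h ->
  ip (fun x => f x + g x) h = ip f h + ip g h.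
Proof.
move=> sf sg sh; rewrite /ip -RintegralD//; [|exact: sqintM|exact: sqintM].
by apply: eq_Rintegral => x _; rewrite mulrDl.
Qed.

Lemma ipZl c f h : sqint f -> sqint h ->
  ip (fun x => c * f x) h = c * ip f h.
Proof.
move=> sf sh; rewrite /ip -RintegralZl//; last exact: sqintM.
by apply: eq_Rintegral => x _; rewrite mulrA.
Qed.

Lemma ipNl f h : sqint f -> sqint h -> ip (fun x => - f x) h = - ip f h.
Proof.
move=> sf sh; rewrite -mulN1r -ipZl//; congr (ip _ _).
by apply/funext => x; rewrite mulN1r.
Qed.

Lemma ipBl f g h : sqint f -> sqint g -> sqint h ->
  ip (fun x => f x - g x) h = ip f h - ip g h.
Proof. by move=> sf sg sh; rewrite ipDl ?ipNl//; exact: sqintN. Qed.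

Lemma ipDr f g h : sqint f -> sqint g -> sqint h ->
  ip h (fun x => f x + g x) = ip h f + ip h g.
Proof. by move=> sf sg sh; rewrite ipC ipDl// (ipC f) (ipC g). Qed.

Lemma ipZr c f h : sqint f -> sqint h -> ip h (fun x => c * f x) = c * ip h f.
Proof. by move=> sf sh; rewrite ipC ipZl// (ipC f). Qed.

Lemma ipBr f g h : sqint f -> sqint g -> sqint h ->
  ip h (fun x => f x - g x) = ip h f - ip h g.
Proof. by move=> sf sg sh; rewrite ipC ipBl// (ipC f) (ipC g). Qed.

Lemma ip_ge0 f : 0 <= ip f f.
Proof. by apply: Rintegral_ge0 => x _; rewrite -expr2 sqr_ge0. Qed.

Lemma nrm_ge0 f : 0 <= nrm f. Proof. exact: sqrtr_ge0. Qed.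

Lemma nrm_sqr f : nrm f ^+ 2 = ip f f.
Proof. by rewrite sqr_sqrtr// ip_ge0. Qed.

(** The quadratic form (a, b) |-> ip (a f - b g) (a f - b g) is nonnegative. *)
Lemma ip_le_nrm f g : sqint f -> sqint g -> ip f g <= nrm f * nrm g.
Proof.
move=> sf sg.
have H (a b : R) : 0 <= a ^+ 2 * ip f f + b ^+ 2 * ip g g - 2 * a * b * ip f g.
  have saf := sqintZ a sf; have sbg := sqintZ b sg.
  have := ip_ge0 (fun x => a * f x - b * g x).
  rewrite ipBl ?ipBr//; last exact: sqintB.
  rewrite !ipZl ?ipZr// (ipC g f); lra.
(* These coefficients give the inequality times nrm f * nrm g. If this product is 0,
   one square is missing from the form, and a coefficient large enough to
   contradict ip f g > 0 is chosen instead. *)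
have := H (nrm g) (nrm f); rewrite -!nrm_sqr.
move: (nrm_ge0 f) (nrm_ge0 g); set a := nrm f; set b := nrm g => a0 b0 Hab.
have : 0 <= a * b * (a * b - ip f g) by move: Hab; nra.
have [ab0|] := ltP 0 (a * b); first by rewrite pmulr_rge0// subr_ge0.
move=> ab0 _; have {ab0}: a * b = 0 by apply/eqP; rewrite eq_le ab0 mulr_ge0.
move=> /eqP; rewrite mulf_eq0 => /orP[/eqP a00|/eqP b00].
- have ff0 : ip f f = 0 by rewrite -nrm_sqr -/a a00 expr0n.
  rewrite a00 mul0r; rewrite leNgt; apply/negP => fg0.
  have := H ((1 + ip g g) / ip f g) 1; rewrite ff0 mulr0 add0r expr1n mul1r mulr1.
  by rewrite -mulrA divfK ?gt_eqF//; move: (ip_ge0 g); lra.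
- have gg0 : ip g g = 0 by rewrite -nrm_sqr -/b b00 expr0n.
  rewrite b00 mulr0; rewrite leNgt; apply/negP => fg0.
  have := H 1 ((1 + ip f f) / ip f g); rewrite gg0 mulr0 addr0 expr1n mul1r mulr1.
  by rewrite -mulrA divfK ?gt_eqF//; move: (ip_ge0 f); lra.
Qed.

Lemma nrmZ c f : sqint f -> nrm (fun x => c * f x) = `|c| * nrm f.
Proof.
move=> sf; rewrite /nrm ipZl// ?ipZr//; last exact: sqintZ.
by rewrite mulrA -expr2 sqrtrM ?sqr_ge0// sqrtr_sqr.
Qed.

Lemma nrmN f : nrm (fun x => - f x) = nrm f.
Proof. by rewrite /nrm /ip; under eq_Rintegral do rewrite mulrNN. Qed.

Lemma normr_ip_le f g : sqint f -> sqint g -> `|ip f g| <= nrm f * nrm g.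
Proof.
move=> sf sg; rewrite ler_norml ip_le_nrm// andbT lerNl -ipNl//.
by rewrite -(nrmN f); apply: ip_le_nrm => //; exact: sqintN.
Qed.

Lemma nrmD f g : sqint f -> sqint g -> nrm (fun x => f x + g x) <= nrm f + nrm g.
Proof.
move=> sf sg; rewrite -(@ler_pXn2r _ 2)// ?nnegrE ?addr_ge0 ?nrm_ge0//.
rewrite nrm_sqr ipDl ?ipDr//; last exact: sqintD.
have := ip_le_nrm sf sg; rewrite (ipC g f) -!nrm_sqr; nra.
Qed.

Lemma nrmBC f g : nrm (fun x => f x - g x) = nrm (fun x => g x - f x).
Proof. by rewrite -nrmN; congr nrm; apply/funext => x; rewrite opprB. Qed.

Lemma nrm_dist f g h : sqint f -> sqint g -> sqint h ->
  nrm (fun x => f x - h x) <= nrm (fun x => f x - g x) + nrm (fun x => g x - h x).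
Proof.
move=> sf sg sh; apply: le_trans (nrmD (sqintB sf sg) (sqintB sg sh)).
by rewrite le_eqVlt; apply/orP; left; apply/eqP; congr nrm; apply/funext => x; ring.
Qed.

Lemma nrm0 : nrm (fun=> 0) = 0.
Proof.
rewrite /nrm /ip; under eq_Rintegral do rewrite mul0r.
by rewrite /Rintegral integral0 sqrtr0.
Qed.

Lemma nrm_sum I (r : seq I) (F : I -> T -> R) : (forall i, sqint (F i)) ->
  nrm (fun x => \sum_(i <- r) F i x) <= \sum_(i <- r) nrm (F i).
Proof.
move=> sF; elim: r => [|i r IH].
  by under eq_fun do rewrite big_nil; rewrite big_nil nrm0.
under eq_fun do rewrite big_cons; rewrite big_cons.
by apply: le_trans (nrmD (sF i) (sqint_sum _ sF)) _; rewrite lerD2l.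
Qed.

Lemma nrm_le f g : sqint f -> sqint g -> (forall x, `|f x| <= `|g x|) ->
  nrm f <= nrm g.
Proof.
move=> sf sg fg; rewrite ler_sqrt ?ip_ge0//.
apply: le_Rint; [exact: sqintM|exact: sqintM|move=> x].
rewrite -!expr2 -(real_normK (num_real (f x))) -(real_normK (num_real (g x))).
by rewrite ler_pXn2r// nnegrE.
Qed.

Lemma ip_eq0_ae f : sqint f -> ip f f = 0 -> {ae mu, forall x, f x = 0}.
Proof.
move=> sf ff0.
have mff : measurable_fun setT (EFin \o (fun x => f x * f x)).
  by apply/measurable_EFinP; apply: measurable_funM; apply: sqint_meas.
have /integrable_fin_num := sqintM sf sf => /(_ measurableT) fin.
have [h1 _] := ae_eq_integral_abs mu measurableT mff.
have {}/h1 : (\int[mu]_x `|(f x * f x)%:E| = 0)%E.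
  under eq_integral do rewrite gee0_abs ?lee_fin -?expr2 ?sqr_ge0//.
  under eq_integral do rewrite expr2.
  by rewrite -(fineK fin); congr (_%:E).
by apply: filterS => x /= /(_ I) [] /eqP; rewrite mulf_eq0 orbb => /eqP.
Qed.

Lemma ae_eq_ip f g h : sqint f -> sqint g -> sqint h ->
  {ae mu, forall x, f x = g x} -> ip f h = ip g h.
Proof.
move=> sf sg sh fg; rewrite /ip /Rintegral; congr fine.
apply: ae_eq_integral => //; last by apply: filterS fg => x /= -> _.
- exact: measurable_int (sqintM sf sh).
- exact: measurable_int (sqintM sg sh).
Qed.

End square_integrable.

(** * Lebesgue measure on R^n *)

Section borel_rV.
Context {R : realType} {n : nat}.
Implicit Types (x y h : 'rV[R]_n) (U : set 'rV[R]_n).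

Lemma ler_norm_coord x i : `|x ord0 i| <= `|x|.
Proof.
rewrite [leRHS]/Num.norm /= mx_normrE.
by apply: (le_bigmax _ (fun ij : 'I_1 * 'I_n => `|x ij.1 ij.2|) (ord0, i)).
Qed.

Lemma norm_rV_ltP x (e : R) : 0 < e -> (forall i, `|x ord0 i| < e) -> `|x| < e.
Proof.
move=> e0 xe; rewrite /Num.norm /= mx_normrE; apply/bigmax_ltP; split => //.
by move=> [i j] _ /=; rewrite ord1.
Qed.

Lemma norm_rV_leP x (e : R) : 0 <= e -> (forall i, `|x ord0 i| <= e) -> `|x| <= e.
Proof.
move=> e0 xe; rewrite /Num.norm /= mx_normrE; apply/bigmax_leP; split => //.
by move=> [i j] _ /=; rewrite ord1.
Qed.

Lemma ball_rVE x (e : R) y : ball x e y = (`|x - y| < e).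
Proof. by rewrite -ball_normE. Qed.

Lemma closed_norm_le (M : R) : closed [set x : 'rV[R]_n | `|x| <= M].
Proof.
have -> : [set x : 'rV[R]_n | `|x| <= M] = Num.norm @^-1` [set r : R | r <= M] by [].
by apply: preimage_closed => [x _|]; [exact: norm_continuous|exact: closed_le].
Qed.

Lemma rV_rat_approx x (e : R) : 0 < e ->
  exists q : 'rV[rat]_n, forall i, `|x ord0 i - ratr (q ord0 i)| < e.
Proof.
move=> e0.
have qP i : exists q : rat, `|x ord0 i - ratr q| < e.
  have : x ord0 i - e < x ord0 i + e by lra.
  move=> /rat_in_itvoo[q]; rewrite in_itv/= => /andP[q1 q2].
  by exists q; rewrite ltr_norml; lra.
exists (\row_i xchoose (qP i)) => i; rewrite mxE; exact: (xchooseP (qP i)).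
Qed.

(** The sigma-algebra is only known to contain the preimages of Borel sets by the
    coordinates; an open set is a countable union of boxes with rational data. *)
Lemma open_rV_measurable U : open U -> measurable U.
Proof.
move=> oU.
pose box (p : 'rV[rat]_n * rat) : set 'rV[R]_n :=
  [set y | forall i, `|y ord0 i - ratr (p.1 ord0 i)| < ratr p.2].
pose F (p : 'rV[rat]_n * rat) := if `[< box p `<=` U >] then box p else set0.
have -> : U = \bigcup_p F p.
  apply/seteqP; split => [x Ux|x [p _]]; last first.
    by rewrite /F; case: ifPn => // /asboolP; exact.
  move: oU; rewrite openE => /(_ _ Ux) /nbhs_ballP[e /= e0 xeU].
  have : 0 < e / 2 by rewrite divr_gt0.
  move=> /rat_in_itvoo[r]; rewrite in_itv/= => /andP[r0 re].
  have [q qx] := rV_rat_approx x r0.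
  exists (q, r) => //; rewrite /F ifT//; apply/asboolP => y yq.
  apply: xeU; rewrite ball_rVE; apply: norm_rV_ltP => // i; rewrite !mxE.
  have := yq i; have := qx i => /=.
  by rewrite !ltr_norml; lra.
apply: countable_bigcupT_measurable; first exact: countableP.
move=> p; rewrite /F; case: ifP => // _.
rewrite (_ : box p = \bigcap_(i in [set: 'I_n])
   ((fun x => x ord0 i : measurableTypeR R) @^-1` ball (ratr (p.1 ord0 i) : R) (ratr p.2))).
  apply: fin_bigcap_measurable => // i _.
  rewrite -[X in measurable X]setTI; apply: measurable_coord => //.
  exact: measurable_ball.
apply/seteqP; split => [y yp i _|y yp i].
  by rewrite /ball/= distrC; exact: yp.
by rewrite distrC; exact: (yp i I).
Qed.

Lemma closed_rV_measurable U : closed U -> measurable U.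
Proof.
move=> cU; rewrite -[U]setCK; apply: measurableC; apply: open_rV_measurable.
exact: closed_openC.
Qed.

Lemma continuous_rV_measurable (f : 'rV[R]_n -> R) :
  continuous f -> measurable_fun setT f.
Proof.
move=> cf; apply: (measurability _ (RGenOInfty.measurableE R)) => // _ [_ [x ->] <-].
rewrite setTI; apply: open_rV_measurable; apply: open_comp => //.
Qed.

Lemma measurable_shift h : measurable_fun setT (fun x => x + h).
Proof.
apply: measurable_fun_rV => i; under eq_fun do rewrite mxE.
by apply: measurable_funD => //; exact: measurable_coord.
Qed.

Lemma measurable_add_rV :
  measurable_fun setT (fun p : 'rV[R]_n * 'rV[R]_n => p.1 + p.2).
Proof.
apply: measurable_fun_rV => i; under eq_fun do rewrite mxE.
apply: measurable_funD.
- by apply: (measurableT_comp (measurable_coord i)); exact: measurable_fst.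
- by apply: (measurableT_comp (measurable_coord i)); exact: measurable_snd.
Qed.

End borel_rV.

Section lebesgue_translation.
Context {R : realType}.

(** Lebesgue measure on the line is determined by its values on half-open
    intervals, and these are invariant. *)
(** The measure of a set is the integral of the measures of its sections by the
    first coordinate: a translation permutes the sections, which is invisible by
    [lebesgue_shift1], and translates each of them in one dimension less. *)
Lemma lebesgue_shift1 (h : R) (A : set (measurableTypeR R)) : measurable A ->
  lebesgue_measure [set x : R | A (x + h)] = lebesgue_measure A.
Proof.
move=> mA.
have mh : measurable_fun setT (fun x : measurableTypeR R => (x + h : measurableTypeR R)).
  by apply: measurable_funD => //; exact: measurable_id.
pose m := measure_function_pushforward__canonical__measure_function_Measure
  (@lebesgue_measure R) mh.
apply/esym; apply: (lebesgue_measure_unique (mu := m)) => //.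
move=> X /ocitvP[->|[[a b] /= ab ->]]; first by rewrite !measure0.
rewrite /m/= /pushforward.
rewrite (_ : _ @^-1` _ = `](a - h), (b - h)]%classic); last first.
  apply/seteqP; split => x /=; rewrite !in_itv/=; lra.
by rewrite !lebesgue_measure_itv/= !lte_fin ltrD2r ab -!EFinB; congr (_%:E); ring.
Qed.

Lemma lebesgue_rVSE n (A : set 'rV[R]_n.+1) : measurable A ->
  lebesgue_rV R n.+1 A =
  (\int[lebesgue_measure]_(a in [set: measurableTypeR R])
     lebesgue_rV R n [set x | A (rV_cons (a, x))])%E.
Proof.
move=> mA; rewrite /= /lebesgue_rVS /pushforward /product_measure1.
apply: eq_integral => a _ /=; congr (lebesgue_rV R n _).
by apply/seteqP; split => x; rewrite /xsection/= inE.
Qed.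

Lemma measurable_rV_cons_section n (A : set 'rV[R]_n.+1) : measurable A ->
  measurable_fun [set: measurableTypeR R]
    (fun a : measurableTypeR R => lebesgue_rV R n [set x | A (rV_cons (a, x))]).
Proof.
move=> mA.
have mA' : measurable (rV_cons @^-1` A).
  by rewrite -[X in measurable X]setTI; exact: measurable_rV_cons.
have := measurable_fun_xsection (lebesgue_rV R n) mA'.
rewrite (_ : _ \o _ = (fun a : measurableTypeR R =>
  lebesgue_rV R n [set x | A (rV_cons (a, x))]))//.
apply/funext => a /=; congr (lebesgue_rV R n _).
by apply/seteqP; split => x; rewrite /xsection/= inE.
Qed.

Lemma lebesgue_shift n (h : 'rV[R]_n) (A : set 'rV[R]_n) : measurable A ->
  lebesgue_rV R n [set x | A (x + h)] = lebesgue_rV R n A.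
Proof.
have mS k (u : 'rV[R]_k) (B : set 'rV[R]_k) : measurable B -> measurable [set x | B (x + u)].
  by move=> mB; rewrite -[X in measurable X]setTI; exact: measurable_shift.
elim: n => [|n IH] in h A * => mA.
  congr (lebesgue_rV R 0 _); apply/seteqP.
  by split => x /=; rewrite (_ : x + h = x)//; apply/rowP => -[].
rewrite !lebesgue_rVSE//; last exact: mS.
pose h0 := (rV_uncons h).1; pose h' := (rV_uncons h).2.
have consD a x : rV_cons (a, x) + h = rV_cons (a + h0, x + h').
  apply/rowP => i; rewrite /rV_cons/=.
  have [j ->|j ->] := split_ordP (i : 'I_(1 + n)).
    by rewrite mxE !(@row_mxEl R 1 1 n) !mxE !ord1 eqxx !mulr1n /h0/= /rV_uncons/= mxE.
  by rewrite mxE !(@row_mxEr R 1 1 n) mxE /h' /rV_uncons/= !mxE.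
pose F a := lebesgue_rV R n [set x | A (rV_cons (a, x))].
transitivity (\int[lebesgue_measure]_(a in [set: measurableTypeR R]) F (a + h0)%R)%E.
  apply: eq_integral => a _; rewrite /F -[RHS](IH h'); last first.
    rewrite -[X in measurable X]setTI.
    rewrite (_ : [set x | _] = (fun x => rV_cons (a + h0, x)) @^-1` A)//.
    apply: measurableT_comp (mA) => //; first exact: measurable_rV_cons.
  by congr (lebesgue_rV R n _); apply/seteqP; split => x /=; rewrite consD.
have mh : measurable_fun setT (fun x : measurableTypeR R => (x + h0 : measurableTypeR R)).
  by apply: measurable_funD => //; exact: measurable_id.
have mF : measurable_fun setT F by exact: measurable_rV_cons_section.
have := @ge0_integral_pushforward _ _ _ _ _ _ mh lebesgue_measure setT F measurableT mF.
rewrite preimage_setT => <-//.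
by apply: eq_measure_integral => B mB _; exact: lebesgue_shift1.
Qed.

Lemma measurable_box n (M : R) : measurable [set x : 'rV[R]_n | forall i, - M <= x ord0 i <= M].
Proof.
rewrite (_ : [set x : 'rV[R]_n | _] = \bigcap_(i in [set: 'I_n])
   ((fun x : 'rV[R]_n => x ord0 i : measurableTypeR R) @^-1` `[-M, M])).
  apply: fin_bigcap_measurable => // i _.
  by rewrite -[X in measurable X]setTI; apply: measurable_coord.
apply/seteqP; split => [y yp i _|y yp i]; first by rewrite /= in_itv/=; exact: yp.
by have := yp i I; rewrite /= in_itv.
Qed.

Lemma lebesgue_box n (M : R) : 0 < M ->
  lebesgue_rV R n [set x | forall i, (-M <= x ord0 i <= M)%R] = ((2 * M) ^+ n)%:E.
Proof.
move=> M0; elim: n => [|n IH].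
  by rewrite /= diracE mem_set// => -[].
rewrite /= /lebesgue_rVS /pushforward.
rewrite (_ : _ @^-1` _ = `[-M, M]%classic `*` [set x : 'rV[R]_n | forall i, (-M <= x ord0 i <= M)%R]).
  rewrite product_measure1E//; last exact: measurable_box.
  rewrite exprS EFinM -IH; congr (_ * _)%E.
  have := lebesgue_measure_itv `[-M, M]; rewrite /= lte_fin => ->.
  by rewrite ifT -?EFinB; [congr (_%:E); ring|lra].
apply/seteqP; split => -[a x] /=; rewrite in_itv/=.
  move=> H; split.
    by have := H (@lshift 1 n ord0); rewrite /rV_cons (@row_mxEl R 1 1 n) !mxE eqxx mulr1n.
  by move=> i; have := H (@rshift 1 n i); rewrite /rV_cons (@row_mxEr R 1 1 n).
move=> [Ha Hx] i; rewrite /rV_cons/=.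
have [j ->|j ->] := split_ordP (i : 'I_(1 + n)).
  by rewrite (@row_mxEl R 1 1 n) !mxE !ord1 eqxx mulr1n.
by rewrite (@row_mxEr R 1 1 n).
Qed.

End lebesgue_translation.

Section lebesgue_integral_translation.
Context {R : realType} {n : nat}.
Local Notation mu := (lebesgue_rV R n).
Implicit Types (f g : 'rV[R]_n -> R) (h : 'rV[R]_n) (A : set 'rV[R]_n).

Lemma ge0_integral_shift (f : 'rV[R]_n -> \bar R) h : measurable_fun setT f ->
  (forall x, 0 <= f x)%E -> (\int[mu]_x f (x + h)%R = \int[mu]_x f x)%E.
Proof.
move=> mf f0.
have := @ge0_integral_pushforward _ _ _ _ _ _ (measurable_shift h) mu setT f
  measurableT mf.
rewrite preimage_setT => <-//.
apply: eq_measure_integral; first exact: measurable_shift.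
by move=> mh B mB _; exact: (lebesgue_shift h mB).
Qed.

Lemma measurable_comp_shift f h : measurable_fun setT f ->
  measurable_fun setT (fun x : 'rV[R]_n => f (x + h)).
Proof. by move=> mf; exact: (measurableT_comp mf (measurable_shift h)). Qed.

Lemma integrable_shift f h : mu.-integrable setT (EFin \o f) ->
  mu.-integrable setT (EFin \o (fun x : 'rV[R]_n => f (x + h))).
Proof.
move=> /integrableP[/measurable_EFinP mf If]; apply/integrableP; split.
  by apply/measurable_EFinP; exact: measurable_comp_shift.
rewrite [ltLHS](ge0_integral_shift h (f := fun x => `|(f x)%:E|%E))//.
by apply: measurableT_comp => //; exact/measurable_EFinP.
Qed.

Lemma Rintegral_shift f h : mu.-integrable setT (EFin \o f) ->
  \int[mu]_x f (x + h) = \int[mu]_x f x.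
Proof.
move=> If; congr fine.
have mf := measurable_int _ If.
have := @integral_pushforward _ _ _ _ _ _ (measurable_shift h) mu setT
  (EFin \o f) mf.
rewrite preimage_setT => <-//; last exact: integrable_shift.
by apply: eq_measure_integral; [exact: measurable_shift|move=> mh B mB _; exact: (lebesgue_shift h mB)].
Qed.

Lemma sqint_shift f h : sqint mu f -> sqint mu (fun x : 'rV[R]_n => f (x + h)).
Proof.
move=> [mf If]; split; first exact: measurable_comp_shift.
exact: (integrable_shift h If).
Qed.

Lemma ip_shift f g h : sqint mu f -> sqint mu g ->
  ip mu (fun x : 'rV[R]_n => f (x + h)) (fun x : 'rV[R]_n => g (x + h)) = ip mu f g.
Proof. by move=> sf sg; rewrite /ip (Rintegral_shift h (sqintM sf sg)). Qed.

Lemma nrm_shift f h : sqint mu f -> nrm mu (fun x : 'rV[R]_n => f (x + h)) = nrm mu f.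
Proof. by move=> sf; rewrite /nrm ip_shift. Qed.

(** * Functions with bounded support *)

Definition bounded_support f := exists M : R, forall x, M < `|x| -> f x = 0.

Lemma bounded_support_le f g : bounded_support g ->
  (forall x, g x = 0 -> f x = 0) -> bounded_support f.
Proof. by move=> [M gM] fg; exists M => x /gM /fg. Qed.

Lemma bounded_support2 f g k : bounded_support f -> bounded_support g ->
  (forall x, f x = 0 -> g x = 0 -> k x = 0) -> bounded_support k.
Proof.
move=> [M fM] [N gN] fgk; exists (Num.max M N) => x; rewrite gt_max => /andP[Mx Nx].
by apply: fgk; [exact: fM|exact: gN].
Qed.

Lemma bounded_support_shift f h : bounded_support f ->
  bounded_support (fun x : 'rV[R]_n => f (x + h)).
Proof.
move=> [M fM]; exists (M + `|h|) => x Mx; apply: fM.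
have := ler_normB (x + h) h; rewrite addrK; lra.
Qed.

Lemma measurable_le_ball (M : R) : measurable [set x : 'rV[R]_n | `|x| <= M].
Proof. by apply: closed_rV_measurable; exact: closed_norm_le. Qed.

Lemma lebesgue_bounded_lty A (M : R) : (forall x, A x -> `|x| <= M) ->
  measurable A -> (mu A < +oo)%E.
Proof.
move=> AM mA; pose N := Num.max M 1.
have N0 : 0 < N by rewrite lt_max ltr01 orbT.
have := ltry ((2 * N) ^+ n); rewrite -(lebesgue_box n N0); apply: le_lt_trans.
apply: le_measure; rewrite ?inE//; first exact: measurable_box.
move=> x /AM xM i; rewrite -ler_norml; apply: le_trans (ler_norm_coord x i) _.
by rewrite le_max xM.
Qed.

Lemma integrable_indic_bounded A (M : R) : (forall x, A x -> `|x| <= M) ->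
  measurable A -> mu.-integrable setT (EFin \o \1_A).
Proof.
move=> AM mA; apply/integrableP; split; first exact/measurable_EFinP.
rewrite (eq_integral (fun x => (\1_A x)%:E)); last first.
  by move=> x _ /=; rewrite ger0_norm// indicE.
by rewrite integral_indic// setIT; exact: lebesgue_bounded_lty AM mA.
Qed.

Lemma Rintegral_indic A : measurable A -> \int[mu]_x \1_A x = fine (mu A).
Proof. by move=> mA; rewrite /Rintegral integral_indic// setIT. Qed.

Lemma integrable_bounded f (C : R) : measurable_fun setT f -> bounded_support f ->
  (forall x, `|f x| <= C) -> mu.-integrable setT (EFin \o f).
Proof.
move=> mf [M fM] fC.
have I1 := integrable_indic_bounded (fun x (xM : [set x | `|x| <= M] x) => xM)
  (measurable_le_ball M).
apply: integrable_le (mf) (integrableZl measurableT C I1) _ => x /=.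
rewrite indicE; have [xM|xM] := leP `|x| M.
  by rewrite mem_set// mulr1.
by rewrite fM// normr0 memNset ?mulr0//=; apply/negP; rewrite -ltNge.
Qed.

Lemma sqint_bounded f (C : R) : measurable_fun setT f -> bounded_support f ->
  (forall x, `|f x| <= C) -> sqint mu f.
Proof.
move=> mf bf fC; split => //; apply: (@integrable_bounded _ (C ^+ 2)).
- exact: measurable_funX.
- by apply: bounded_support_le bf _ => x ->; rewrite expr0n.
- by move=> x; rewrite normrX ler_pXn2r// ?nnegrE//; exact: le_trans (fC x).
Qed.

Lemma sqint_indic A (M : R) : measurable A -> (forall x, A x -> `|x| <= M) ->
  sqint mu \1_A.
Proof.
move=> mA AM; apply: (@sqint_bounded _ 1) => //.
- by exists M => x Mx; rewrite indicE memNset// => /AM; rewrite leNgt Mx.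
- by move=> x; rewrite indicE; case: (_ \in _); rewrite ?normr0 ?normr1.
Qed.

(** Turns uniform estimates on difference quotients into L2 estimates. *)
Lemma nrm_bounded f (C M : R) : measurable_fun setT f -> 0 <= M ->
  (forall x, M < `|x| -> f x = 0) -> (forall x, `|f x| <= C) ->
  nrm mu f <= C * nrm mu \1_[set x : 'rV[R]_n | `|x| <= M].
Proof.
move=> mf M0 fM fC.
have C0 : 0 <= C by exact: le_trans (fC 0).
have s1 := sqint_indic (measurable_le_ball M) (fun x xM => xM).
rewrite -[C]ger0_norm// -nrmZ//; apply: nrm_le.
- by apply: sqint_bounded mf _ fC; exists M.
- exact: sqintZ.
- move=> x; rewrite indicE; have [xM|xM] := leP `|x| M.
    by rewrite mem_set// mulr1 (ger0_norm C0).
  by rewrite fM// normr0.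
Qed.

Lemma measure_bigcup_approx (F : (set 'rV[R]_n)^nat) A :
  (forall k, measurable (F k)) -> (forall i j, (i <= j)%N -> F i `<=` F j) ->
  \bigcup_k F k = A -> (mu A < +oo)%E ->
  forall e : R, 0 < e -> exists k, fine (mu A) - fine (mu (F k)) <= e.
Proof.
move=> mF ndF FA Aoo e e0.
have fA : mu A \is a fin_num by rewrite ge0_fin_numE.
have : mu \o F @ \oo --> (fine (mu A))%:E.
  rewrite fineK// -FA; apply: nondecreasing_cvg_mu => //.
    exact: bigcupT_measurable.
  by move=> i j ij; apply/subsetPset; exact: ndF.
move=> /fine_cvg/cvgrPdist_le/(_ e e0) [k _ /(_ k (leqnn k)) /=].
by exists k; apply: le_trans (ler_norm _) _.
Qed.

End lebesgue_integral_translation.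

(** * Translations are continuous in L2 *)

Section translation_continuity.
Context {R : realType} {n : nat}.
Local Notation mu := (lebesgue_rV R n).
Local Notation integrable f := (mu.-integrable setT (EFin \o f)).
Implicit Types (f g : 'rV[R]_n -> R) (h : 'rV[R]_n) (A U : set 'rV[R]_n).

Definition L1_translation_continuous f := forall e : R, 0 < e ->
  exists2 r : R, 0 < r &
  forall h, `|h| < r -> \int[mu]_x `|f (x + h) - f x| <= e.

Lemma integrable_normB f g : integrable f -> integrable g ->
  integrable (fun x : 'rV[R]_n => `|f x - g x|).
Proof. by move=> If Ig; apply: (integrable_norm (integrableB measurableT If Ig)). Qed.

Lemma integrableD_EFin f g : integrable f -> integrable g ->
  integrable (fun x : 'rV[R]_n => f x + g x).
Proof. by move=> If Ig; apply: (integrableD measurableT If Ig). Qed.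

Lemma integrableB_EFin f g : integrable f -> integrable g ->
  integrable (fun x : 'rV[R]_n => f x - g x).
Proof. by move=> If Ig; apply: (integrableB measurableT If Ig). Qed.

Lemma integrableZ_EFin (c : R) f : integrable f ->
  integrable (fun x : 'rV[R]_n => c * f x).
Proof. by move=> If; apply: (integrableZl measurableT c If). Qed.

Lemma tc_add f g : integrable f -> integrable g ->
  L1_translation_continuous f -> L1_translation_continuous g ->
  L1_translation_continuous (fun x => f x + g x).
Proof.
move=> If Ig cf cg e e0.
have e20 : 0 < e / 2 by rewrite divr_gt0.
have [r r0 Hf] := cf _ e20; have [s s0 Hg] := cg _ e20.
exists (Num.min r s); first by rewrite lt_min r0.
move=> h; rewrite lt_min => /andP[hr hs].
rewrite [e]splitr; apply: le_trans (lerD (Hf h hr) (Hg h hs)).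
have Ifh := integrable_normB (integrable_shift h If) If.
have Igh := integrable_normB (integrable_shift h Ig) Ig.
rewrite -RintegralD//; apply: le_Rint.
- apply: integrable_normB; last exact: integrableD_EFin.
  by apply: integrableD_EFin; exact: integrable_shift.
- exact: integrableD_EFin.
- move=> x; apply: le_trans (ler_normD _ _).
  by rewrite le_eqVlt; apply/orP; left; apply/eqP; congr (`| _ |); ring.
Qed.

Lemma tc_scale (c : R) f : integrable f ->
  L1_translation_continuous f -> L1_translation_continuous (fun x => c * f x).
Proof.
move=> If cf e e0.
have c0 : 0 < `|c| + 1 by rewrite ltr_wpDl.
have [r r0 Hf] := cf (e / (`|c| + 1)) (divr_gt0 e0 c0).
exists r => // h hr.
have -> : \int[mu]_x `|c * f (x + h) - c * f x| = `|c| * \int[mu]_x `|f (x + h) - f x|.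
  rewrite -RintegralZl//; last by exact: integrable_normB (integrable_shift h If) If.
  by apply: eq_Rintegral => x _; rewrite -mulrBr normrM.
have := Hf h hr; rewrite ler_pdivlMr// => H; apply: le_trans H.
by rewrite mulrC ler_wpM2l ?lerDl//; apply: Rintegral_ge0.
Qed.

Lemma tc_lim f : integrable f ->
  (forall e : R, 0 < e -> exists g, [/\ integrable g, L1_translation_continuous g &
    \int[mu]_x `|f x - g x| <= e]) -> L1_translation_continuous f.
Proof.
move=> If H e e0.
have e30 : 0 < e / 3 by rewrite divr_gt0.
have [g [Ig cg fg]] := H _ e30; have [r r0 Hg] := cg _ e30.
exists r => // h hr.
have I1 := integrable_normB (integrable_shift h If) (integrable_shift h Ig).
have I2 := integrable_normB (integrable_shift h Ig) Ig.
have I3 := integrable_normB If Ig.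
have fgh : \int[mu]_x `|f (x + h) - g (x + h)| <= e / 3.
  by rewrite (Rintegral_shift h I3).
have : \int[mu]_x (`|f (x + h) - g (x + h)| + `|g (x + h) - g x| + `|f x - g x|) <= e.
  rewrite RintegralD//; last exact: integrableD_EFin.
  rewrite RintegralD//; have := Hg h hr; lra.
apply: le_trans; apply: le_Rint.
- by apply: integrable_normB => //; exact: integrable_shift.
- by apply: integrableD_EFin => //; exact: integrableD_EFin.
- move=> x; rewrite (distrC (f x)).
  apply: le_trans (lerD (ler_normD _ _) (lexx _)); apply: le_trans (ler_normD _ _).
  by rewrite le_eqVlt; apply/orP; left; apply/eqP; congr (`| _ |); ring.
Qed.

Definition erosion U (r : R) := [set x | ball x r `<=` U].

Lemma erosion_closed U r : closed (erosion U r).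
Proof.
rewrite -openC (_ : ~` erosion U r = \bigcup_(y in ~` U) ball y r).
  by apply: bigcup_open => y _; exact: ball_open.
apply/seteqP; split => [x /= /existsNP[y /not_implyP[xy Uy]]|x [y Uy yx] xU].
  by exists y => //; exact: ball_sym.
by apply: Uy; apply: xU; exact: ball_sym.
Qed.

Lemma erosion_sub U r : 0 < r -> erosion U r `<=` U.
Proof. by move=> r0 x; apply; exact: ballxx. Qed.

Lemma bigcup_erosion U : open U -> \bigcup_k erosion U k.+1%:R^-1 = U.
Proof.
move=> oU; apply/seteqP; split => [x [k _]|x Ux]; first exact: erosion_sub.
move: oU; rewrite openE => /(_ _ Ux)/nbhs_ballP[e /= e0 xeU].
have [k ke] : exists k : nat, k.+1%:R^-1 < e.
  have := near_infty_natSinv_lt (PosNum e0) => -[k _ /(_ k (leqnn k))].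
  by exists k.
by exists k => // y xy; apply: xeU; apply: le_ball xy; exact: ltW.
Qed.

Lemma lebesgue_erosion U (M : R) : open U -> (forall x, U x -> `|x| <= M) ->
  forall e : R, 0 < e -> exists2 r : R, 0 < r & fine (mu U) - fine (mu (erosion U r)) <= e.
Proof.
move=> oU UM e e0.
have mE r : measurable (erosion U r) by apply: closed_rV_measurable; exact: erosion_closed.
have mU := open_rV_measurable oU.
have [i j ij||k Hk] := measure_bigcup_approx (F := fun k => erosion U k.+1%:R^-1)
    (fun k => mE _) _ (bigcup_erosion oU) _ e0.
- move=> x xi y xy; apply: xi; apply: le_ball xy.
  by rewrite lef_pV2 ?posrE// ler_nat.
- exact: lebesgue_bounded_lty UM mU.
by exists k.+1%:R^-1.
Qed.

(** For |h| < r the indicators of U and of its translate agree on the erosion of U,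
    which has almost the measure of U. Outside it, the absolute value of their
    difference exceeds the difference itself, of integral zero, by at most 2. *)
Lemma tc_open U (M : R) : open U -> (forall x, U x -> `|x| <= M) ->
  L1_translation_continuous \1_U.
Proof.
move=> oU UM e e0.
have [r r0 Hr] := lebesgue_erosion oU UM (divr_gt0 e0 (ltr0n _ 2)).
exists r => // h hr.
have mE : measurable (erosion U r) by apply: closed_rV_measurable; exact: erosion_closed.
have mU := open_rV_measurable oU.
have IU := integrable_indic_bounded UM mU.
have IE : integrable (\1_(erosion U r)).
  by apply: (@integrable_indic_bounded _ _ _ M) => // x /(erosion_sub r0)/UM.
have IUh := integrable_shift h IU.
have I1 := integrableB_EFin IUh IU.
have I2 := integrableZ_EFin 2 (integrableB_EFin IU IE).
have : \int[mu]_x ((\1_U (x + h) - \1_U x) + 2 * (\1_U x - \1_(erosion U r) x)) <= e.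
  rewrite RintegralD// RintegralB// (Rintegral_shift h IU) subrr add0r.
  rewrite RintegralZl//; last exact: integrableB_EFin.
  rewrite RintegralB// !Rintegral_indic//; lra.
apply: le_trans; apply: le_Rint.
- exact: integrable_normB.
- exact: integrableD_EFin.
- move=> x; rewrite !indicE.
  have [xE|xE] := boolP (x \in erosion U r).
    have xU : x \in U by move: xE; rewrite !inE; exact: erosion_sub.
    have xhU : x + h \in U.
      by rewrite inE; move: xE; rewrite inE; apply; rewrite ball_rVE opprD addNKr normrN.
    by rewrite xU xhU subrr normr0; lra.
  case: (x \in U); case: (x + h \in U) => /=; rewrite ?subrr ?normr0 ?subr0 ?sub0r ?normrN ?normr1; lra.
Qed.

End translation_continuity.

Import HBSimple.

Section translation_continuity2.
Context {R : realType} {n : nat}.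
Local Notation mu := (lebesgue_rV R n).
Local Notation integrable f := (mu.-integrable setT (EFin \o f)).
Implicit Types (f g : 'rV[R]_n -> R) (h : 'rV[R]_n) (A U : set 'rV[R]_n).

(** Truncation by a ball makes complements integrable, so that the sets with this
    property form a sigma-algebra. *)
Definition tc_set (M : R) A := measurable A /\
  L1_translation_continuous (\1_(A `&` [set x : 'rV[R]_n | `|x| < M])).

Lemma open_lt_ball (M : R) : open [set x : 'rV[R]_n | `|x| < M].
Proof.
have -> : [set x : 'rV[R]_n | `|x| < M] = Num.norm @^-1` [set r : R | r < M] by [].
apply: open_comp => [x _|]; first exact: norm_continuous.
exact: open_lt.
Qed.

Let B M := [set x : 'rV[R]_n | `|x| < M].
Let mB M : measurable (B M). Proof. rewrite /B; apply: open_rV_measurable; exact: open_lt_ball. Qed.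
Let IB A M : measurable A -> integrable \1_(A `&` B M).
Proof.
move=> mA; apply: (@integrable_indic_bounded _ _ _ M); last exact: measurableI.
by move=> x [_ /ltW].
Qed.

Lemma tc_set_open M U : open U -> tc_set M U.
Proof.
move=> oU; split; first exact: open_rV_measurable.
apply: (@tc_open _ _ _ M) => [|x [_ /ltW]//].
by apply: openI => //; exact: open_lt_ball.
Qed.

Lemma tc_setC M A : tc_set M A -> tc_set M (~` A).
Proof.
move=> [mA cA]; split; first exact: measurableC.
rewrite (_ : \1_(_) = fun x => \1_(setT `&` B M) x + (-1) * \1_(A `&` B M) x :> R).
  apply: tc_add; [exact: IB|exact/integrableZ_EFin/IB| |].
  - by have [] := tc_set_open M (@openT _).
  - by apply: tc_scale => //; exact: IB.
apply/funext => x; rewrite !indicE !in_setI in_setC in_setT/=.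
by case: (x \in A); case: (x \in B M) => /=; lra.
Qed.

Lemma tc_setU M A A' : tc_set M A -> tc_set M A' -> tc_set M (A `|` A').
Proof.
move=> [mA cA] [mA' cA']; split; first exact: measurableU.
move=> e e0; have e20 : 0 < e / 2 by rewrite divr_gt0.
have [r r0 Hf] := cA _ e20; have [s s0 Hg] := cA' _ e20.
exists (Num.min r s); first by rewrite lt_min r0.
move=> h; rewrite lt_min => /andP[hr hs].
rewrite [e]splitr; apply: le_trans (lerD (Hf h hr) (Hg h hs)).
have I1 := integrable_normB (integrable_shift h (IB M mA)) (IB M mA).
have I2 := integrable_normB (integrable_shift h (IB M mA')) (IB M mA').
have I3 := IB M (measurableU _ _ mA mA').
rewrite -RintegralD//; apply: le_Rint.
- by apply: integrable_normB => //; exact: integrable_shift.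
- exact: integrableD_EFin.
- move=> x; rewrite !indicE !in_setI !in_setU.
  case: (x \in A); case: (x \in A'); case: (x \in B M);
  case: (x + h \in A); case: (x + h \in A'); case: (x + h \in B M) => /=;
  rewrite ?subrr ?sub0r ?subr0 ?normrN ?normr0 ?normr1 ?addr0 ?add0r//; lra.
Qed.

Lemma tc_set_bigcup M (F : (set 'rV[R]_n)^nat) : (forall k, tc_set M (F k)) ->
  tc_set M (\bigcup_k F k).
Proof.
move=> tF; have mF : measurable (\bigcup_k F k) by apply: bigcupT_measurable => k; case: (tF k).
split => //; apply: tc_lim; first exact: IB.
pose D k := \big[setU/set0]_(i < k) F i.
have tD k : tc_set M (D k).
  rewrite /D; elim: k => [|k IH]; first by rewrite big_ord0; apply: tc_set_open; exact: open0.
  by rewrite big_ord_recr; exact: tc_setU.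
have DF k : D k `<=` \bigcup_k F k.
  by move=> x; rewrite /D -bigcup_mkord => -[i _ Fi]; exists i.
move=> e e0.
have mI k : measurable (D k `&` B M) by apply: measurableI => //; case: (tD k).
have bD : \bigcup_k (D k `&` B M) = \bigcup_k F k `&` B M.
  rewrite -setI_bigcupl; congr (_ `&` _).
  apply/seteqP; split => [x [k _ /DF]//|x [k _ Fx]].
  by exists k.+1 => //; rewrite /D -bigcup_mkord; exists k => /=.
have [i j ij||k Hk] := measure_bigcup_approx mI _ bD _ e0.
- apply: setSI => x; rewrite /D -!bigcup_mkord.
  by move=> [k /= ki Fk]; exists k => //=; exact: leq_trans ij.
- apply: (@lebesgue_bounded_lty _ _ _ M); last exact: measurableI.
  by move=> x [_ /ltW].
exists \1_(D k `&` B M); have [mD cD] := tD k; split => //; first exact: IB.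
apply: le_trans Hk.
rewrite -!Rintegral_indic//; last exact: measurableI.
rewrite -RintegralB//; [|exact: IB|exact: IB].
apply: le_Rint; [by apply: integrable_normB; exact: IB|by apply: integrableB_EFin; exact: IB|].
move=> x; rewrite ger0_norm// subr_ge0 !indicE ler_nat !in_setI.
by have [/set_mem/DF/mem_set ->|] := boolP (x \in D k).
Qed.

(** The preimages of open half-lines by the coordinates are open and generate the
    sigma-algebra. *)
Lemma tc_set_measurable M A : measurable A -> tc_set M A.
Proof.
suff : (measurable : set (set 'rV[R]_n)) `<=` tc_set M by exact.
apply: smallest_sub.
  split; [by apply: tc_set_open; exact: open0|by move=> X; rewrite setTD; exact: tc_setC|].
  exact: tc_set_bigcup.
rewrite -bigcup_seq/= => X [i _ [Y mY <-]]; rewrite setTI.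
pose C : set (set R) := [set Y | tc_set M ((fun x : 'rV[R]_n => x ord0 i) @^-1` Y)].
suff : (@RGenOInfty.G R).-sigma.-measurable `<=` C.
  by apply; rewrite -RGenOInfty.measurableE.
apply: smallest_sub.
  split.
  - by rewrite /C/= preimage_set0; apply: tc_set_open; exact: open0.
  - by move=> Z CZ; rewrite setTD /C/= preimage_setC; exact: tc_setC.
  - by move=> F CF; rewrite /C/= preimage_bigcup; exact: tc_set_bigcup.
move=> _ [x ->]; apply: tc_set_open; apply: open_comp => [y _|]; last exact: interval_open.
exact: coord_continuous.
Qed.

Lemma tc_sum m (F : nat -> 'rV[R]_n -> R) :
  (forall i, integrable (F i)) -> (forall i, L1_translation_continuous (F i)) ->
  integrable (fun x => \sum_(i < m) F i x) /\
  L1_translation_continuous (fun x => \sum_(i < m) F i x).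
Proof.
move=> IF cF; elim: m => [|m [IH1 IH2]].
  under [X in integrable X]eq_fun do rewrite big_ord0.
  under [X in L1_translation_continuous X]eq_fun do rewrite big_ord0.
  have I0 : integrable (fun=> 0) by exact: integrable0.
  split => // e e0; exists 1 => // h _.
  by rewrite (@eq_Rintegral _ _ _ _ _ (cst 0)) ?Rintegral_cst ?mul0r ?ltW// => x _; rewrite subrr normr0.
under [X in integrable X]eq_fun do rewrite big_ord_recr.
under [X in L1_translation_continuous X]eq_fun do rewrite big_ord_recr.
by split; [exact: integrableD_EFin|exact: tc_add].
Qed.

Lemma tc_integrable f : integrable f -> bounded_support f ->
  L1_translation_continuous f.
Proof.
move=> If [M fM]; apply: tc_lim => // e e0.
have [g_ [Ig _ gf]] := approximation_sfun_integrable measurableT If.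
move: gf => /fine_cvgP[[k1 _ H1] /cvgrPdist_le/(_ e e0) [k2 _ H2]].
pose k := maxn k1 k2; pose N := M + 1.
exists (fun x => g_ k x * \1_(setT `&` B N) x).
have fE x : f x * \1_(setT `&` B N) x = f x.
  rewrite indicE in_setI in_setT/=; have [xM|] := boolP (x \in B N); first by rewrite mulr1.
  by rewrite notin_setE /B/= => /negP; rewrite -leNgt => xN; rewrite fM ?mul0r//; move: xN; rewrite /N; lra.
have mg : measurable_fun setT (fun x => g_ k x * \1_(setT `&` B N) x).
  by apply: measurable_funM => //; apply: measurable_indic; exact: measurableI.
have I1 : integrable (fun x => g_ k x * \1_(setT `&` B N) x).
  apply: integrable_le mg (integrable_norm (Ig k)) _ => //.
  by move=> x; rewrite /= indicE; case: (_ \in _); rewrite ?mulr1// mulr0 normr0//.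
split => //.
- have [m [s gE]] : exists m (s : nat -> R), forall x,
      g_ k x = \sum_(i < m) (s i * \1_(g_ k @^-1` [set s i]) x).
    by eexists; exists (nth 0 (finmap.enum_fset (fset_set (g_ k @` setT)))); exact: fimfunEord.
  have -> : (fun x => g_ k x * \1_(setT `&` B N) x) = (fun x => \sum_(i < m)
     (s i * \1_((g_ k @^-1` [set s i]) `&` B N) x)).
    apply/funext => x; rewrite gE mulr_suml; apply: eq_bigr => i _.
    by rewrite -mulrA !indicE !in_setI in_setT/= -natrM mulnb.
  have mP i : measurable (g_ k @^-1` [set s i]) by [].
  have [i|i|//] := @tc_sum m (fun i x => s i * \1_((g_ k @^-1` [set s i]) `&` B N) x).
    by apply: integrableZ_EFin; exact: IB.
  apply: tc_scale; first exact: IB.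
  by have [] := tc_set_measurable N (mP i).
- have k2k : (k2 <= k)%N by exact: leq_maxr.
  apply: le_trans (H2 k k2k); rewrite /= sub0r normrN.
  apply: le_trans (ler_norm _); rewrite /Rintegral.
  change (\int[mu]_x `|f x - g_ k x * \1_(setT `&` B N) x| <= \int[mu]_x `|f x - g_ k x|).
  apply: le_Rint; [exact: integrable_normB|exact: integrable_normB (Ig k)|].
  move=> x; rewrite -{1}fE -mulrBl normrM ler_piMr// indicE.
  by case: (_ \in _); rewrite ?normr1 ?normr0.
Qed.

(** The inequality (a - b)^2 <= 2 |a|a| - b|b|| reduces the claim to the continuity in
    L1 of the translations of f|f|. *)
Theorem L2_translation_continuous f : sqint mu f -> bounded_support f ->
  forall e : R, 0 < e -> exists2 r : R, 0 < r &
    forall h, `|h| < r -> nrm mu (fun x => f (x + h) - f x) <= e.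
Proof.
move=> sf bf e e0.
pose F x := f x * `|f x|; have mf := sqint_meas sf.
have sF : sqint mu (fun x => `|f x|).
  apply: sqint_le sf _ => [|x]; last by rewrite normr_id.
  exact: measurableT_comp.
have IF : integrable F by exact: sqintM.
have bF : bounded_support F by apply: bounded_support_le bf _ => x; rewrite /F => ->; rewrite mul0r.
have [r r0 Hr] := tc_integrable IF bF (divr_gt0 (exprn_gt0 2 e0) (ltr0n _ 2)).
exists r => // h hr.
have sfh := sqintB (sqint_shift h sf) sf.
rewrite -(@ler_pXn2r _ 2)// ?nnegrE ?nrm_ge0 ?(ltW e0)// nrm_sqr.
have IFh := integrable_normB (integrable_shift h IF) IF.
have : \int[mu]_x (2 * `|F (x + h) - F x|) <= e ^+ 2.
  by rewrite RintegralZl//; have := Hr h hr; lra.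
apply: le_trans; apply: le_Rint; [exact: sqintM|exact: integrableZ_EFin|].
move=> x; rewrite /F; set a := f (x + h); set b := f x.
have [a0|a0] := leP 0 a; have [b0|b0] := leP 0 b.
- rewrite (ger0_norm a0) (ger0_norm b0) -!expr2 subr_sqr normrM (ger0_norm (addr_ge0 a0 b0)).
  by case: (leP 0 (a - b)) => ab; rewrite ?(ger0_norm ab) ?(ltr0_norm ab); nra.
- by rewrite (ger0_norm a0) (ltr0_norm b0) ger0_norm; have := sqr_ge0 (a + b); nra.
- by rewrite (ltr0_norm a0) (ger0_norm b0) ler0_norm; have := sqr_ge0 (a + b); nra.
- rewrite (ltr0_norm a0) (ltr0_norm b0).
  by case: (leP 0 (a * - a - b * - b)) => ab; rewrite ?(ger0_norm ab) ?(ltr0_norm ab); nra.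
Qed.

End translation_continuity2.

(** * Calculus of smooth functions *)

Section smooth_calculus.
Context {R : realType} {d : nat}.
Implicit Types (f g : 'rV[R]_d -> R) (x y h : 'rV[R]_d) (i j : 'I_d).
Local Notation e_ i := (delta_mx ord0 i : 'rV[R]_d).

Lemma dist_le_half (e p q r : R) : `|p - r| <= e / 2 -> `|q - r| <= e / 2 -> `|q - p| <= e.
Proof. by move=> H1 H2; have := ler_distD r q p; rewrite (distrC r p); lra. Qed.

Lemma norm_basis i : `|e_ i| <= 1.
Proof.
by apply: norm_rV_leP => // j; rewrite mxE eqxx/=; case: (_ == _); rewrite ?normr1 ?normr0.
Qed.

(** The proof principle for smoothness: exhibit a class of differentiable functions
    that the partial derivatives preserve. *)
Lemma smooth_class (C : set ('rV[R]_d -> R)) :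
  (forall f, C f -> [/\ continuous f, forall x i, derivable f x (e_ i) &
    forall i, C (partial i f)]) -> forall f, C f -> smooth f.
Proof.
move=> HC f Cf s.
suff : C (foldr partial f s) by move=> /HC[].
by elim: s => //= i s /HC[_ _]; exact.
Qed.

Lemma smooth_continuous f : smooth f -> continuous f.
Proof. by move=> /(_ [::])[]. Qed.

Lemma smooth_derivable f x i : smooth f -> derivable f x (e_ i).
Proof. by move=> /(_ [::])[_]; exact. Qed.

Arguments smooth_derivable {f} x i _.

Lemma smooth_partial f i : smooth f -> smooth (partial i f).
Proof. by move=> sf s; have := sf (rcons s i); rewrite foldr_rcons. Qed.

Opaque smooth.

Lemma partialD f g i : smooth f -> smooth g ->
  partial i (fun x => f x + g x) = (fun x => partial i f x + partial i g x).
Proof.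
move=> sf sg; apply/funext => x.
exact: (deriveD (smooth_derivable x i sf) (smooth_derivable x i sg)).
Qed.

Lemma partialZ f i (c : R) : smooth f ->
  partial i (fun x => c * f x) = (fun x => c * partial i f x).
Proof.
move=> sf; apply/funext => x; exact: (deriveZ c (smooth_derivable x i sf)).
Qed.

Lemma partialM f g i : smooth f -> smooth g ->
  partial i (fun x => f x * g x) = (fun x => partial i f x * g x + f x * partial i g x).
Proof.
move=> sf sg; apply/funext => x.
have := deriveM (smooth_derivable x i sf) (smooth_derivable x i sg).
rewrite /partial => ->; rewrite addrC /GRing.scale/= (mulrC (g x)).
reflexivity.
Qed.

Opaque partial.

(** Derivatives of products leave most natural classes of functions, but not their
    closure under sums and products. *)
Inductive alg_closure (B : set ('rV[R]_d -> R)) : ('rV[R]_d -> R) -> Prop :=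
| alg_base f : B f -> alg_closure B f
| alg_add f g : alg_closure B f -> alg_closure B g -> alg_closure B (fun x => f x + g x)
| alg_mul f g : alg_closure B f -> alg_closure B g -> alg_closure B (fun x => f x * g x).

Lemma alg_closure_smooth (B : set ('rV[R]_d -> R)) :
  (forall f, B f -> [/\ continuous f, forall x i, derivable f x (e_ i) &
    forall i, alg_closure B (partial i f)]) -> forall f, alg_closure B f -> smooth f.
Proof.
move=> HB; apply: (@smooth_class [set f | alg_closure B f]) => f /=.
elim => {f} [f /HB//|f g _ [cf df pf] _ [cg dg pg]|f g sf [cf df pf] sg [cg dg pg]].
- split; [by move=> x; exact: (cvgD (cf x) (cg x))| |].
  + by move=> x i; exact: (derivableD (df x i) (dg x i)).
  + move=> i; rewrite (_ : partial i _ = fun x => partial i f x + partial i g x).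
      by apply: alg_add; [exact: pf|exact: pg].
    by apply/funext => x; exact: (deriveD (df x i) (dg x i)).
- split; [by move=> x; exact: (cvgM (cf x) (cg x))| |].
  + by move=> x i; exact: (derivableM (df x i) (dg x i)).
  + move=> i; rewrite (_ : partial i _ = fun x => f x * partial i g x + g x * partial i f x).
      by apply: alg_add; apply: alg_mul.
    by apply/funext => x; exact: (deriveM (df x i) (dg x i)).
Qed.

Lemma smooth_alg_closure f : alg_closure smooth f -> smooth f.
Proof.
apply: alg_closure_smooth => {}f sf.
split; [exact: smooth_continuous|by move=> x i; exact: smooth_derivable|].
by move=> i; apply: alg_base; exact: smooth_partial.
Qed.

Lemma smoothD f g : smooth f -> smooth g -> smooth (fun x => f x + g x).
Proof. by move=> sf sg; apply: smooth_alg_closure; apply: alg_add; apply: alg_base. Qed.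

Lemma smoothM f g : smooth f -> smooth g -> smooth (fun x => f x * g x).
Proof. by move=> sf sg; apply: smooth_alg_closure; apply: alg_mul; apply: alg_base. Qed.

Lemma partial_cst i (c : R) : partial i (fun _ : 'rV[R]_d => c) = fun=> 0.
Proof. by apply/funext => x; exact: derive_cst. Qed.

Lemma smooth_cst (c : R) : smooth (fun _ : 'rV[R]_d => c).
Proof.
apply: (@smooth_class [set f | exists c : R, f = fun=> c]); last by exists c.
move=> _ [a ->]; split; [by move=> x; exact: cst_continuous|by move=> x i; exact: derivable_cst|].
by move=> i; exists 0; rewrite partial_cst.
Qed.

Lemma smoothZ (c : R) f : smooth f -> smooth (fun x => c * f x).
Proof. by move=> sf; exact: (smoothM (smooth_cst c) sf). Qed.

Lemma smoothN f : smooth f -> smooth (fun x => - f x).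
Proof.
move=> /(smoothZ (-1)); congr smooth.
by apply/funext => x; rewrite mulN1r.
Qed.

Lemma smoothB f g : smooth f -> smooth g -> smooth (fun x => f x - g x).
Proof. by move=> sf /smoothN; exact: smoothD. Qed.

Lemma smooth_sum I (r : seq I) (F : I -> 'rV[R]_d -> R) : (forall k, smooth (F k)) ->
  smooth (fun x => \sum_(k <- r) F k x).
Proof.
move=> sF; elim: r => [|k r IH].
  by under eq_fun do rewrite big_nil; exact: smooth_cst.
by under eq_fun do rewrite big_cons; exact: smoothD.
Qed.

Lemma partialN f i : smooth f -> partial i (fun x => - f x) = (fun x => - partial i f x).
Proof.
move=> sf; rewrite (_ : (fun x => - f x) = fun x => (-1) * f x).
  by rewrite (partialZ i (-1) sf); apply/funext => x; rewrite mulN1r.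
by apply/funext => x; rewrite mulN1r.
Qed.

Lemma partialB f g i : smooth f -> smooth g ->
  partial i (fun x => f x - g x) = (fun x => partial i f x - partial i g x).
Proof. by move=> sf sg; rewrite (partialD i sf (smoothN sg)) (partialN i sg). Qed.

Lemma partial_sum I (r : seq I) (F : I -> 'rV[R]_d -> R) i : (forall k, smooth (F k)) ->
  partial i (fun x => \sum_(k <- r) F k x) = fun x => \sum_(k <- r) partial i (F k) x.
Proof.
move=> sF; elim: r => [|k r IH].
  under [in LHS]eq_fun do rewrite big_nil; under [in RHS]eq_fun do rewrite big_nil.
  exact: partial_cst.
under [in LHS]eq_fun do rewrite big_cons; under [in RHS]eq_fun do rewrite big_cons.
by rewrite (partialD i (sF k) (smooth_sum r sF)) IH.
Qed.

Lemma partial2_sum I (r : seq I) (F : I -> 'rV[R]_d -> R) i j : (forall k, smooth (F k)) ->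
  partial i (partial j (fun x => \sum_(k <- r) F k x)) =
  fun x => \sum_(k <- r) partial i (partial j (F k)) x.
Proof.
move=> sF; rewrite (partial_sum r j sF) (partial_sum r i)// => k.
exact: smooth_partial.
Qed.

Lemma partial2B f g i j : smooth f -> smooth g ->
  partial i (partial j (fun x => f x - g x)) =
  (fun x => partial i (partial j f) x - partial i (partial j g) x).
Proof. move=> sf sg; rewrite (partialB j sf sg).
by rewrite (partialB i (smooth_partial j sf) (smooth_partial j sg)). Qed.

Lemma partial2M f g i j : smooth f -> smooth g ->
  partial i (partial j (fun x => f x * g x)) =
  (fun x => f x * partial i (partial j g) x + partial i f x * partial j g x +
    (partial j f x * partial i g x + g x * partial i (partial j f) x)).
Proof.
move=> sf sg; have [si sj] := (smooth_partial j sf, smooth_partial j sg).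
rewrite (partialM j sf sg) (partialD i (smoothM si sg) (smoothM sf sj)).
rewrite (partialM i si sg) (partialM i sf sj); apply/funext => x.
have aux (a b p q r s u v : R) : a * b + p * q + (r * s + u * v)
    = u * v + r * s + (p * q + b * a) by ring.
exact: aux.
Qed.

Lemma partial_shift f i h : partial i (fun x => f (x + h)) = (fun x => partial i f (x + h)).
Proof.
Transparent partial.
apply/funext => x; rewrite /partial /derive; congr (lim (_ @ 0^')).
by apply/funext => t /=; rewrite addrA.
Qed.

Opaque partial.

Lemma smooth_shift f h : smooth f -> smooth (fun x => f (x + h)).
Proof.
move=> sf; apply: (@smooth_class [set g | exists2 f, smooth f & g = fun x => f (x + h)]); last by exists f.
move=> _ [{sf}f sf ->]; split.
- move=> x; apply: (@continuous_comp _ _ _ (fun x => x + h) f).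
    by apply: (@continuousD _ _ _ id (cst h)); [by move=> ?|exact: cst_continuous].
  exact: smooth_continuous.
- move=> x i; have := smooth_derivable (x + h) i sf.
  have E : (fun t : R => t^-1 *: (((fun y => f (y + h)) \o shift x) (t *: e_ i) - f (x + h)))
      = (fun t : R => t^-1 *: ((f \o shift (x + h)) (t *: e_ i) - f (x + h))).
    by apply/funext => t /=; rewrite addrA.
  by rewrite /derivable E.
- by move=> i; exists (partial i f); [exact: smooth_partial|exact: partial_shift].
Qed.

Lemma is_derive_line f i x (t : R) : derivable f (x + t *: e_ i) (e_ i) ->
  is_derive t (1 : R) (fun s : R => f (x + s *: e_ i)) (partial i f (x + t *: e_ i)).
Proof.
move=> df.
have E : (fun k : R => k^-1 *: (((fun s : R => f (x + s *: e_ i)) \o shift t) (k *: 1) - f (x + t *: e_ i))) =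
   (fun k : R => k^-1 *: ((f \o shift (x + t *: e_ i)) (k *: e_ i) - f (x + t *: e_ i))).
  apply/funext => k /=; congr (_ *: (f _ - _)).
  by rewrite [k *: 1]mulr1 scalerDl addrCA.
by apply: DeriveDef; [rewrite /derivable E|rewrite /derive E].
Qed.

Lemma partial_MVT f i x (t : R) : (forall y, derivable f y (e_ i)) ->
  exists2 c : R, `|c| <= `|t| & f (x + t *: e_ i) - f x = t * partial i f (x + c *: e_ i).
Proof.
move=> df; pose F (s : R) := f (x + s *: e_ i).
have dF (s : R) : is_derive s (1 : R) F (partial i f (x + s *: e_ i)) by exact: is_derive_line.
have cF : continuous F.
  move=> s; apply: differentiable_continuous; apply/derivable1_diffP.
  by have [] := dF s.
have F0 : F 0 = f x by rewrite /F scale0r addr0.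
have cW (a b : R) : {within `[a, b], continuous F} by exact: continuous_subspaceT.
have [t0|t0] := leP 0 t.
- have [c] := MVT_segment t0 (fun s _ => dF s) (cW _ _).
  rewrite in_itv/= => /andP[c0 ct] E; exists c; first by rewrite !ger0_norm.
  by rewrite -F0 -/(F t) E subr0 mulrC.
- have [c] := MVT_segment (ltW t0) (fun s _ => dF s) (cW _ _).
  rewrite in_itv/= => /andP[ct c0] E; exists c.
    by rewrite !ler0_norm ?(ltW t0)// lerN2.
  by rewrite -F0 -/(F t) -[LHS]opprB E sub0r mulrN mulrC opprK.
Qed.

Lemma partial_taylor f i (C : R) x (t : R) : smooth f ->
  (forall y, `|partial i (partial i f) y| <= C) ->
  `|f (x + t *: e_ i) - f x - t * partial i f x| <= C * t ^+ 2.
Proof.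
move=> sf fC.
have [c ct ->] := partial_MVT x t (fun y => smooth_derivable y i sf).
have [c' _ E] := partial_MVT x c (fun y => smooth_derivable y i (smooth_partial i sf)).
rewrite -mulrBr E !normrM -(real_normK (num_real t)).
have := fC (x + c' *: e_ i); move: (normr_ge0 (partial i (partial i f) (x + c' *: e_ i))) (normr_ge0 c).
move: ct; set a := `|c|; set b := `|t|; set k := `|partial _ _ _| => ab k0 a0 kC.
have : a * k <= b * C by apply: ler_pM.
have : 0 <= b by exact: le_trans ab.
by move=> b0 H; rewrite expr2 (mulrC C) -mulrA ler_wpM2l.
Qed.

(** The second difference of f in the directions i and j is symmetric, and the mean
    value theorem, applied in either order, makes it t^2 times either mixed
    derivative at points that tend to x with t. *)
Lemma partialC f i j : smooth f -> partial i (partial j f) = partial j (partial i f).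
Proof.
move=> sf; apply/funext => x.
have key k l (t : R) : exists2 y, `|y - x| <= 2 * `|t| &
    f (x + t *: e_ k + t *: e_ l) - f (x + t *: e_ k) - f (x + t *: e_ l) + f x
      = t * (t * partial l (partial k f) y).
  pose g y := f (y + t *: e_ l) - f y.
  have sfl := smooth_shift (t *: e_ l) sf; have sg : smooth g := smoothB sfl sf.
  have [c ct E] := partial_MVT x t (fun y => smooth_derivable y k sg).
  have [c' c't E'] := partial_MVT (x + c *: e_ k) t
    (fun y => smooth_derivable y l (smooth_partial k sf)).
  exists (x + c *: e_ k + c' *: e_ l).
    rewrite [X in `|X|](_ : _ = c *: e_ k + c' *: e_ l); last by rewrite -[x + _ + _]addrA addrAC subrr add0r.
    apply: le_trans (ler_normD _ _) _; rewrite !normrZ mulr2n mulrDl mul1r.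
    apply: lerD; [apply: le_trans ct|apply: le_trans c't];
      by rewrite ler_piMr// norm_basis.
  rewrite -E'.
  have -> : partial k f (x + c *: e_ k + t *: e_ l) - partial k f (x + c *: e_ k)
      = partial k g (x + c *: e_ k).
    by rewrite /g (partialB k sfl sf) partial_shift.
  by rewrite -E /g; ring.
apply/eqP; rewrite -subr_eq0 -normr_le0; apply/ler_addgt0Pl => e e0; rewrite addr0.
have e20 : 0 < e / 2 by rewrite divr_gt0.
have /cvgrPdist_le /(_ _ e20)/nbhs_ballP[r /= r0 Hr] : partial i (partial j f) y @[y --> x] --> partial i (partial j f) x.
  by apply: smooth_continuous; do 2 apply: smooth_partial.
have /cvgrPdist_le /(_ _ e20)/nbhs_ballP[s /= s0 Hs] : partial j (partial i f) y @[y --> x] --> partial j (partial i f) x.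
  by apply: smooth_continuous; do 2 apply: smooth_partial.
have [t [t0 tr ts]] : exists t : R, [/\ 0 < t, 2 * `|t| < r & 2 * `|t| < s].
  exists (Num.min r s / 3); have t0 : 0 < Num.min r s / 3 by rewrite divr_gt0// lt_min r0.
  by rewrite (gtr0_norm t0) t0; split => //; move: r0 s0; clear; case: (leP r s); lra.
have [y yx Ey] := key j i t; have [z zx Ez] := key i j t.
have : partial i (partial j f) y = partial j (partial i f) z.
  apply: (@mulfI _ t); first by rewrite gt_eqF.
  apply: (@mulfI _ t); first by rewrite gt_eqF.
  have aux (p q r' s' : R) : p - q - r' + s' = p - r' - q + s' by ring.
  have Exy : x + t *: e_ j + t *: e_ i = x + t *: e_ i + t *: e_ j by rewrite addrAC.
  by apply: etrans (esym Ey) _; apply: etrans _ Ez; rewrite Exy; exact: aux.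
have := Hr y; rewrite ball_rVE distrC => /(_ (le_lt_trans yx tr)).
have := Hs z; rewrite ball_rVE distrC => /(_ (le_lt_trans zx ts)).
by move=> H1 H2 E; rewrite E in H2; exact: dist_le_half H1 H2.
Qed.

Lemma partial_near f g i x : (\near x, f x = g x) -> partial i f x = partial i g x.
Proof. exact: near_eq_derive. Qed.

End smooth_calculus.

Section compactly_supported.
Context {R : realType} {d : nat}.
Local Notation mu := (lebesgue_rV R d).
Local Notation integrable f := (mu.-integrable setT (EFin \o f)).
Implicit Types (f g : 'rV[R]_d -> R) (x y h : 'rV[R]_d) (i j : 'I_d).
Local Notation e_ i := (delta_mx ord0 i : 'rV[R]_d).

Definition csmooth f := smooth f /\ bounded_support f.

Lemma bounded_support_partial f i : bounded_support f -> bounded_support (partial i f).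
Proof.
move=> [M fM]; exists M => x Mx.
rewrite (@partial_near _ _ f (fun=> 0) i x) ?partial_cst//.
have : nbhs x [set y : 'rV[R]_d | M < `|y|].
  apply: open_nbhs_nbhs; split => //.
  have -> : [set y : 'rV[R]_d | M < `|y|] = Num.norm @^-1` [set r : R | M < r] by [].
  apply: open_comp => [y _|]; [exact: norm_continuous|exact: open_gt].
by apply: filterS => y; exact: fM.
Qed.

Lemma csmooth_partial f i : csmooth f -> csmooth (partial i f).
Proof. by move=> [sf bf]; split; [exact: smooth_partial|exact: bounded_support_partial]. Qed.

Lemma csmoothMl f g : smooth f -> csmooth g -> csmooth (fun x => f x * g x).
Proof.
move=> sf [sg bg]; split; first exact: smoothM.
by apply: bounded_support_le bg _ => x ->; rewrite mulr0.
Qed.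

Lemma csmoothMr f g : csmooth f -> smooth g -> csmooth (fun x => f x * g x).
Proof.
move=> [sf bf] sg; split; first exact: smoothM.
by apply: bounded_support_le bf _ => x ->; rewrite mul0r.
Qed.

Lemma csmoothD f g : csmooth f -> csmooth g -> csmooth (fun x => f x + g x).
Proof.
move=> [sf bf] [sg bg]; split; first exact: smoothD.
by apply: bounded_support2 bf bg _ => x -> ->; rewrite addr0.
Qed.

Lemma csmoothB f g : csmooth f -> csmooth g -> csmooth (fun x => f x - g x).
Proof.
move=> [sf bf] [sg bg]; split; first exact: smoothB.
by apply: bounded_support2 bf bg _ => x -> ->; rewrite subrr.
Qed.

Lemma csmooth_shift f h : csmooth f -> csmooth (fun x => f (x + h)).
Proof. by move=> [sf bf]; split; [exact: smooth_shift|exact: bounded_support_shift]. Qed.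

Lemma csmooth0 : csmooth (fun=> 0).
Proof. by split; [exact: smooth_cst|exists 0]. Qed.

Lemma csmooth_sum I (r : seq I) (F : I -> 'rV[R]_d -> R) : (forall k, csmooth (F k)) ->
  csmooth (fun x => \sum_(k <- r) F k x).
Proof.
move=> sF; elim: r => [|k r IH].
  by under eq_fun do rewrite big_nil; exact: csmooth0.
by under eq_fun do rewrite big_cons; exact: csmoothD.
Qed.

Lemma continuous_bounded_ball (M : R) f : continuous f ->
  exists2 C : R, 0 <= C & forall x, `|x| <= M -> `|f x| <= C.
Proof.
move=> cf; pose N := Num.max M 0.
have cB : compact [set x : 'rV[R]_d | `|x| <= N].
  apply: bounded_closed_compact; last exact: closed_norm_le.
  by exists N; split; [exact: num_real|move=> r Nr x /= xN; exact: le_trans xN (ltW Nr)].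
have cn : continuous (fun x => `|f x|).
  move=> x; apply: (@continuous_comp _ _ _ f Num.norm); first exact: cf.
  exact: norm_continuous.
have [||c _ fc] := @EVT_max_rV R d (fun x => `|f x|) _ _ cB.
- by exists 0 => /=; rewrite normr0 le_max lexx orbT.
- exact: continuous_subspaceT.
by exists `|f c| => // x xM; apply: fc; rewrite inE /= le_max xM.
Qed.

Lemma continuous_bounded f : continuous f -> bounded_support f ->
  exists2 C : R, 0 <= C & forall x, `|f x| <= C.
Proof.
move=> cf [M fM]; have [C C0 fC] := continuous_bounded_ball M cf; exists C => // x.
by have [xM|xM] := leP `|x| M; [exact: fC|rewrite fM ?normr0].
Qed.

Lemma integrable_sum_fin I (r : seq I) (F : I -> 'rV[R]_d -> R) :
  (forall k, integrable (F k)) -> integrable (fun x => \sum_(k <- r) F k x).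
Proof.
move=> IF; elim: r => [|k r IH].
  by under [X in integrable X]eq_fun do rewrite big_nil; exact: integrable0.
by under [X in integrable X]eq_fun do rewrite big_cons; exact: integrableD_EFin.
Qed.

Lemma Rintegral_sum_fin I (r : seq I) (F : I -> 'rV[R]_d -> R) :
  (forall k, integrable (F k)) ->
  \int[mu]_x (\sum_(k <- r) F k x) = \sum_(k <- r) \int[mu]_x F k x.
Proof.
move=> IF; elim: r => [|k r IH].
  rewrite big_nil (@eq_Rintegral _ _ _ _ _ (fun=> 0)) => [|x _]; last by rewrite big_nil.
  by rewrite /Rintegral integral0.
rewrite big_cons -IH (@eq_Rintegral _ _ _ _ _ (fun x => F k x + \sum_(k <- r) F k x)) => [|x _].
  by rewrite RintegralD//; exact: integrable_sum_fin.
by rewrite big_cons.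
Qed.

Lemma csmooth_bounded f : csmooth f -> exists2 C : R, 0 <= C & forall x, `|f x| <= C.
Proof. by move=> [sf bf]; apply: continuous_bounded => //; exact: smooth_continuous. Qed.

Lemma smooth_measurable f : smooth f -> measurable_fun setT f.
Proof. by move=> /smooth_continuous; exact: continuous_rV_measurable. Qed.

Lemma csmooth_integrable f : csmooth f -> integrable f.
Proof.
move=> cf; have [C _ fC] := csmooth_bounded cf; have [sf bf] := cf.
exact: integrable_bounded (smooth_measurable sf) bf fC.
Qed.

Lemma csmooth_sqint f : csmooth f -> sqint mu f.
Proof.
move=> cf; have [C _ fC] := csmooth_bounded cf; have [sf bf] := cf.
exact: sqint_bounded (smooth_measurable sf) bf fC.
Qed.

(** The Taylor remainder is uniformly quadratic, so that the difference quotients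
    converge uniformly, within a fixed ball. *)
Lemma csmooth_taylor f i : csmooth f -> exists C M : R, [/\ 0 <= C, 0 <= M &
  forall (t : R) x, `|t| <= 1 ->
    `|f (x + t *: e_ i) - f x - t * partial i f x| <= C * t ^+ 2 /\
    (M < `|x| -> f (x + t *: e_ i) - f x - t * partial i f x = 0)].
Proof.
move=> cf; have [sf [M fM]] := cf.
have [C C0 fC] := csmooth_bounded (csmooth_partial i (csmooth_partial i cf)).
have [N pN] := bounded_support_partial i (proj2 cf).
exists C, (Num.max N (Num.max M 0 + 1)); split => //.
  by rewrite le_max; apply/orP; right; case: (leP M 0); lra.
move=> t x t1; split; first exact: partial_taylor.
rewrite gt_max => /andP[Nx Mx].
have Mx' : M < `|x| by move: Mx; case: (leP M 0); lra.
rewrite (pN _ Nx) mulr0 subr0 (fM _ Mx') subr0; apply: fM.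
have te : `|t *: e_ i| <= 1.
  by rewrite normrZ -[1]mulr1 ler_pM// norm_basis.
have := ler_normB (x + t *: e_ i) (t *: e_ i); rewrite addrK.
by move: Mx te; case: (leP M 0); lra.
Qed.

Lemma small_mulr_eq0 (a b : R) : (forall t, 0 < t -> t <= 1 -> `|a| <= b * t) -> a = 0.
Proof.
move=> H; apply/eqP; rewrite -normr_le0; apply/ler_addgt0Pl => e e0; rewrite addr0.
have b0 : 0 <= b by have := H 1 ltr01 (lexx _); rewrite mulr1; exact: le_trans.
have b10 : 0 < b + 1 by lra.
pose t := Num.min 1 (e / (b + 1)).
have t0 : 0 < t by rewrite lt_min ltr01 divr_gt0.
have t1 : t <= 1 by rewrite ge_min lexx.
apply: le_trans (H t t0 t1) _.
have : t <= e / (b + 1) by rewrite ge_min lexx orbT.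
rewrite ler_pdivlMr//; nra.
Qed.

(** Difference quotients have integral zero by translation invariance, and they
    converge uniformly, with supports in a fixed ball. *)
Lemma Rintegral_partial f i : csmooth f -> \int[mu]_x partial i f x = 0.
Proof.
move=> cf; have [C [M [C0 M0 H]]] := csmooth_taylor i cf.
have If := csmooth_integrable cf.
have Ip := csmooth_integrable (csmooth_partial i cf).
pose B := [set x : 'rV[R]_d | `|x| <= M].
have IB : integrable \1_B.
  by apply: (@integrable_indic_bounded _ _ _ M) => //; exact: measurable_le_ball.
apply: (@small_mulr_eq0 _ (C * \int[mu]_x \1_B x)) => t t0 t1.
have Ift := integrable_shift (t *: e_ i) If.
have Itp := integrableZ_EFin t Ip.
pose r x := f (x + t *: e_ i) - f x - t * partial i f x.
have Ir : integrable r := integrableB_EFin (integrableB_EFin Ift If) Itp.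
have rE : \int[mu]_x r x = - (t * \int[mu]_x partial i f x).
  rewrite /r RintegralB//; last exact: integrableB_EFin.
  by rewrite RintegralB// (Rintegral_shift _ If) subrr sub0r RintegralZl.
rewrite -(ler_pM2l t0) -{1}(gtr0_norm t0) -normrM -normrN -rE.
apply: le_trans (le_normr_Rintegral measurableT Ir) _.
have -> : t * (C * \int[mu]_x \1_B x * t) = \int[mu]_x (C * t ^+ 2 * \1_B x).
  by rewrite RintegralZl//; ring.
apply: le_Rint; [exact: integrable_norm|exact: integrableZ_EFin|move=> x].
have [|H1 H2] := H t x; first by rewrite gtr0_norm.
rewrite indicE; have [xM|xM] := leP `|x| M; first by rewrite mem_set// mulr1.
by rewrite /r H2// normr0 mulr_ge0// mulr_ge0// sqr_ge0.
Qed.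

Lemma ip_partial f g i : csmooth f -> smooth g ->
  ip mu (partial i f) g = - ip mu f (partial i g).
Proof.
move=> cf sg; apply/eqP; rewrite -addr_eq0; apply/eqP; have [sf _] := cf.
have := Rintegral_partial i (csmoothMr cf sg); rewrite (partialM i sf sg).
have I1 := csmooth_integrable (csmoothMr (csmooth_partial i cf) sg).
have I2 := csmooth_integrable (csmoothMr cf (smooth_partial i sg)).
by rewrite (RintegralD measurableT I1 I2).
Qed.

Lemma ip_partial2 f g i j : csmooth f -> smooth g ->
  ip mu (partial i (partial j f)) g = ip mu f (partial i (partial j g)).
Proof.
move=> cf sg; rewrite (ip_partial i (csmooth_partial j cf) sg).
by rewrite (ip_partial j cf (smooth_partial i sg)) opprK partialC.
Qed.

Lemma ip_partial2r f g i j : smooth f -> csmooth g ->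
  ip mu (partial i (partial j f)) g = ip mu f (partial i (partial j g)).
Proof. by move=> sf cg; rewrite ipC -(ip_partial2 i j cg sf) ipC. Qed.

(** Integrating by parts, the square of the left-hand side is at most the product
    of the two terms on the right. *)
Lemma nrm_partial_le f i : csmooth f ->
  nrm mu (partial i f) <= nrm mu f + nrm mu (partial i (partial i f)).
Proof.
move=> cf; have cfi := csmooth_partial i cf; have cfii := csmooth_partial i cfi.
have := ip_partial i cf (proj1 cfi); rewrite -nrm_sqr => E.
have := normr_ip_le (csmooth_sqint cf) (csmooth_sqint cfii).
rewrite -normrN -E ger0_norm ?sqr_ge0//.
move: (nrm_ge0 mu f) (nrm_ge0 mu (partial i f)) (nrm_ge0 mu (partial i (partial i f))).
move: (nrm mu f) (nrm mu _) (nrm mu _) => a b c a0 b0 c0 H.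
by rewrite leNgt; apply/negP => bac; move: a0 b0 c0 H bac; clear; nra.
Qed.

End compactly_supported.

(** * Mollifiers *)

Section flat_function.
Context {R : realType}.
Implicit Types (t : R) (k : nat).

(** For k = 0 this is the usual smooth function that is flat at 0; the other
    powers are what its derivatives are made of. *)
Definition flat k t : R := if 0 < t then t^-1 ^+ k * expR (- t^-1) else 0.

Lemma flat_ge0 k t : 0 <= flat k t.
Proof.
rewrite /flat; case: ifPn => // t0.
by rewrite mulr_ge0 ?expR_ge0// exprn_ge0// invr_ge0 ltW.
Qed.

(** The exponential dominates its Taylor polynomials. This makes [flat] and its
    difference quotients tend to 0 at 0. *)
Lemma flat_le k t : `|flat k t| <= k.+1`!%:R * `|t|.
Proof.
rewrite ger0_norm ?flat_ge0// /flat; case: ifPn => [t0|_]; last by rewrite mulr_ge0.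
rewrite gtr0_norm// expRN.
have ti0 : 0 < t^-1 by rewrite invr_gt0.
have H : t^-1 ^+ k.+1 / k.+1`!%:R <= expR t^-1.
  by apply: le_trans (expR_ge1Dxn k (ltW ti0)); rewrite lerDr.
have f0 : 0 < k.+1`!%:R :> R by rewrite ltr0n fact_gt0.
rewrite ler_pdivrMr ?expR_gt0//.
move: H; rewrite ler_pdivrMr// => H.
have -> : t^-1 ^+ k = t * t^-1 ^+ k.+1 by rewrite exprS mulVKf// gt_eqF.
by rewrite (mulrC _ t) -mulrA ler_pM2l// mulrC.
Qed.

Lemma flat_derive k t :
  is_derive t (1 : R) (flat k) (- k%:R * flat k.+1 t + flat k.+2 t).
Proof.
have [t0|t0|t0] := ltgtP 0 t; last subst t.
- have nz : t != 0 by rewrite gt_eqF.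
  have dV : is_derive t (1 : R) (fun y : R => y^-1) (- t ^- 2 *: 1).
    by apply: (@is_deriveV _ id).
  have dE : is_derive t (1 : R) (fun y : R => expR (- y^-1)) (expR (- t^-1) * (- (- t ^- 2 *: 1))).
    by apply: (@is_derive1_comp _ expR (fun y => - y^-1)).
  have dX : is_derive t (1 : R) ((fun y : R => y^-1) ^+ k) ((k%:R * t^-1 ^+ k.-1) *: (- t ^- 2 *: 1)).
    exact: is_deriveX.
  have dM := is_deriveM dX dE.
  apply: near_eq_is_derive (_ : is_derive t 1 (((fun y : R => y^-1) ^+ k) * (fun y : R => expR (- y^-1))) _).
    have : \near t, 0 < t by exact: lt_nbhsr.
    by apply: filterS => y y0; rewrite /flat y0 /GRing.mul/= exprfctE.
  apply: is_derive_eq dM _.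
  rewrite /flat t0 /GRing.scale/= !mulr1 !exprfctE.
  rewrite -exprVn; case: k dX => [|k] dX.
    by rewrite !mul0r oppr0 !mul0r expr0 mul1r mulr0 addr0 add0r opprK mulrC.
  by rewrite succnK opprK !exprS; move: (expR _) => E; ring.
- apply: near_eq_is_derive (_ : is_derive t 1 (fun=> 0) _).
    have : \near t, t < 0 by exact: lt_nbhsl.
    by apply: filterS => y y0; rewrite /flat ltNge (ltW y0).
  apply: is_derive_eq.
  by rewrite /flat ltNge (ltW t0)/= mulr0 addr0.
- have flat0 m : flat m 0 = 0 by rewrite /flat ltxx.
  rewrite !flat0 mulr0 addr0.
  have cv : h^-1 *: ((flat k \o shift 0) (h *: 1) - flat k 0) @[h --> 0^'] --> (0 : R).
    apply/cvgrPdist_le => e e0; near=> h.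
    rewrite sub0r normrN flat0 subr0 /= addr0 [h *: 1]mulr1.
    have -> : h^-1 *: flat k h = flat k.+1 h.
      rewrite /flat; case: ifPn => h0; last by rewrite scaler0.
      by rewrite exprS -mulrA.
    apply: le_trans (flat_le k.+1 h) _.
    have f0 : 0 < k.+2`!%:R :> R by rewrite ltr0n fact_gt0.
    rewrite mulrC -ler_pdivlMr//.
    by near: h; apply: dnbhs0_le; rewrite divr_gt0.
  by apply: DeriveDef; [apply/cvg_ex; exists 0|exact/cvg_lim].
Unshelve. all: by end_near. Qed.

Lemma flat_continuous k : continuous (flat k).
Proof.
move=> t; apply: differentiable_continuous; apply/derivable1_diffP.
by have [] := flat_derive k t.
Qed.

Lemma flat0_mono (s t : R) : 0 < s -> s <= t -> flat 0 s <= flat 0 t.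
Proof.
move=> s0 st; have t0 := lt_le_trans s0 st.
rewrite /flat s0 t0 !expr0 !mul1r ler_expR lerN2 lef_pV2//.
Qed.

Lemma flat0_gt0 t : 0 < t -> 0 < flat 0 t.
Proof. by move=> t0; rewrite /flat t0 expr0 mul1r expR_gt0. Qed.

End flat_function.

Section mollifier.
Context {R : realType} {d : nat}.
Local Notation mu := (lebesgue_rV R d).
Local Notation e_ i := (delta_mx ord0 i : 'rV[R]_d).
Implicit Types (x y h : 'rV[R]_d) (i j : 'I_d).

Lemma smooth_flat_coord k (a s : R) j : smooth (fun x => flat k (a + s * x ord0 j)).
Proof.
pose B : set ('rV[R]_d -> R) := [set f | (exists c : R, f = fun=> c) \/
  (exists k (a s : R) j, f = fun x => flat k (a + s * x ord0 j))].
apply: (@alg_closure_smooth _ _ B); last by apply: alg_base; right; exists k, a, s, j.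
move=> _ [[c ->]|[{k a s j}k [a [s [j ->]]]]].
  split; [by move=> x; exact: cst_continuous|by move=> x i; exact: derivable_cst|].
  by move=> i; apply: alg_base; left; exists 0; rewrite partial_cst.
have D x i : is_derive x (e_ i) (fun x => flat k (a + s * x ord0 j))
    ((- k%:R * flat k.+1 (a + s * x ord0 j) + flat k.+2 (a + s * x ord0 j)) * (s * (j == i)%:R)).
  have E : (fun h : R => h^-1 *: (((fun x => flat k (a + s * x ord0 j)) \o shift x) (h *: e_ i) - flat k (a + s * x ord0 j)))
    = (fun h : R => h^-1 *: (((flat k \o (fun u : R => a + s * (u * (j == i)%:R + x ord0 j))) \o shift 0) (h *: (1 : R)) - (flat k \o (fun u : R => a + s * (u * (j == i)%:R + x ord0 j))) 0)).
    by apply/funext => h /=; rewrite !mxE eqxx/= addr0 [h *: 1]mulr1 mul0r add0r.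
  have dl : is_derive (0 : R) (1 : R) (fun h : R => a + s * (h * (j == i)%:R + x ord0 j)) (s * (j == i)%:R).
    apply: is_derive_eq; rewrite /GRing.scale/=; ring.
  have df : is_derive (a + s * (0 * (j == i)%:R + x ord0 j)) (1 : R) (flat k) _ := flat_derive _ _.
  have [H1 H2] := @is_derive1_comp _ (flat k)
    (fun u : R => a + s * (u * (j == i)%:R + x ord0 j)) _ _ _ df dl.
  apply: DeriveDef; first by rewrite /derivable E; exact: H1.
  by rewrite /derive E; apply: etrans H2 _; rewrite mul0r add0r.
split.
- move=> x; apply: (@continuous_comp _ _ _ (fun x : 'rV[R]_d => a + s * x ord0 j) (flat k)).
    apply: (@continuousD _ _ _ (cst a) (fun x : 'rV[R]_d => s * x ord0 j)); first exact: cst_continuous.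
    apply: (@continuousM _ _ (cst s) (fun x : 'rV[R]_d => x ord0 j)); first exact: cst_continuous.
    exact: coord_continuous.
  exact: flat_continuous.
- by move=> x i; have [] := D x i.
- move=> i.
  rewrite (_ : partial i _ = fun x => ((fun=> - k%:R) x * flat k.+1 (a + s * x ord0 j) + flat k.+2 (a + s * x ord0 j)) * (fun=> (s * (j == i)%:R)) x).
    have BF m : B (fun x => flat m (a + s * x ord0 j)) by right; exists m, a, s, j.
    have BC (c : R) : B (fun=> c) by left; exists c.
    by apply: alg_mul; [apply: alg_add; [apply: alg_mul|]|]; apply: alg_base => //.
  by apply/funext => x; have [_ H] := D x i; exact: H.
Qed.

(** A product over the coordinates because the norm of row vectors is the maximum
    norm, whose balls are cubes. *)
Definition bump (r : R) x : R := \prod_(j < d) (flat 0 (r + 1 * x ord0 j) * flat 0 (r + (-1) * x ord0 j)).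

Lemma smooth_prod I (s : seq I) (F : I -> 'rV[R]_d -> R) : (forall k, smooth (F k)) ->
  smooth (fun x => \prod_(k <- s) F k x).
Proof.
move=> sF; elim: s => [|k s IH].
  by under eq_fun do rewrite big_nil; exact: smooth_cst.
by under eq_fun do rewrite big_cons; exact: (smoothM (sF k) IH).
Qed.

Lemma smooth_bump r : smooth (bump r).
Proof.
by apply: smooth_prod => j; apply: smoothM; exact: smooth_flat_coord.
Qed.

Lemma bump_ge0 r x : 0 <= bump r x.
Proof. by apply: prodr_ge0 => j _; rewrite mulr_ge0 ?flat_ge0. Qed.

Lemma bump_supp r x : 0 < r -> r < `|x| -> bump r x = 0.
Proof.
move=> r0 rx; have [j xj] : exists j, r < `|x ord0 j|.
  apply: contrapT => /forallNP H; move: rx; rewrite ltNge => /negP; apply.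
  by apply: norm_rV_leP => [|j]; [exact: ltW|rewrite leNgt; exact/negP].
rewrite /bump (bigD1 j)//= /flat; case: ifPn => h1; last by rewrite !mul0r.
case: ifPn => h2; last by rewrite mulr0 mul0r.
exfalso; move: xj; rewrite ltNge ler_norml => /negP; apply.
by move: h1 h2; clear; lra.
Qed.

Lemma csmooth_bump r : 0 < r -> csmooth (bump r).
Proof. by move=> r0; split; [exact: smooth_bump|exists r => x; exact: bump_supp]. Qed.

Lemma Rintegral_bump_gt0 r : 0 < r -> 0 < \int[mu]_x bump r x.
Proof.
move=> r0; have r20 : 0 < r / 2 by rewrite divr_gt0.
pose B := [set x : 'rV[R]_d | forall i, - (r / 2) <= x ord0 i <= r / 2].
have mB : measurable B by exact: measurable_box.
pose c := (flat 0 (r / 2) * flat 0 (r / 2)) ^+ d.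
have c0 : 0 < c by rewrite exprn_gt0// mulr_gt0// flat0_gt0.
have IB : mu.-integrable setT (EFin \o \1_B).
  apply: (@integrable_indic_bounded _ _ _ (r / 2)) => // x xB.
  by apply: norm_rV_leP => [|i]; [exact: ltW|rewrite ler_norml; exact: xB].
have : 0 < \int[mu]_x (c * \1_B x).
  rewrite RintegralZl// Rintegral_indic// lebesgue_box//= mulr_gt0// exprn_gt0//.
  by rewrite mulr_gt0.
move=> /lt_le_trans; apply; apply: le_Rint.
- exact: integrableZ_EFin.
- exact: csmooth_integrable (csmooth_bump r0).
move=> x; rewrite indicE; have [/set_mem xB|_] := boolP (x \in B); last by rewrite mulr0 bump_ge0.
rewrite mulr1 /c /bump -[X in _ ^+ X]card_ord -prodr_const; apply: ler_prod => j _.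
rewrite mulr_ge0 ?flat_ge0//= ler_pM ?flat_ge0//; apply: flat0_mono => //; have := xB j; lra.
Qed.

Definition mollifier (r : R) (rho : 'rV[R]_d -> R) :=
  [/\ csmooth rho, forall x, 0 <= rho x, \int[mu]_x rho x = 1 &
      forall x, r < `|x| -> rho x = 0].

Lemma mollifier_exists r : 0 < r -> exists rho, mollifier r rho.
Proof.
move=> r0; have I0 := Rintegral_bump_gt0 r0; have cb := csmooth_bump r0.
exists (fun x => (\int[mu]_x bump r x)^-1 * bump r x); split.
- exact: (csmoothMl (smooth_cst _) cb).
- by move=> x; rewrite mulr_ge0 ?bump_ge0// invr_ge0 ltW.
- by rewrite RintegralZl ?mulVf ?gt_eqF//; exact: csmooth_integrable.
- by move=> x xr; rewrite bump_supp// mulr0.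
Qed.

End mollifier.

(** * Convolution *)

Section convolution.
Context {R : realType} {d : nat}.
Local Notation mu := (lebesgue_rV R d).
Local Notation e_ i := (delta_mx ord0 i : 'rV[R]_d).
Implicit Types (f g rho : 'rV[R]_d -> R) (x y h : 'rV[R]_d) (i j : 'I_d).

(** The correlation of f with rho: convolution with the reflected kernel, which
    only asks Lebesgue measure to be invariant by translations. *)
Definition conv f rho x : R := ip mu f (fun y => rho (y - x)).

(** Difference quotients can be moved to the kernel, where they converge in L2; the
    reflection of the kernel changes the sign of the derivative. *)
Lemma conv_taylor f rho i : sqint mu f -> csmooth rho -> exists C : R,
  forall x (t : R), `|t| <= 1 ->
  `|conv f rho (x + t *: e_ i) - conv f rho x + t * conv f (partial i rho) x| <= C * t ^+ 2.
Proof.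
move=> sf cr; have [C [M [C0 M0 H]]] := csmooth_taylor i cr.
pose B := [set y : 'rV[R]_d | `|y| <= M].
exists (nrm mu f * (C * nrm mu \1_B)) => x t t1.
have s1 := csmooth_sqint (csmooth_shift (- (x + t *: e_ i)) cr).
have s2 := csmooth_sqint (csmooth_shift (- x) cr).
have s3 := csmooth_sqint (csmooth_shift (- x) (csmooth_partial i cr)).
have t1' : `|- t| <= 1 by rewrite normrN.
pose r y := rho (y + (- t) *: e_ i) - rho y - (- t) * partial i rho y.
have cr' : csmooth r.
  apply: csmoothB; last exact: (csmoothMl (smooth_cst _) (csmooth_partial i cr)).
  by apply: csmoothB => //; exact: csmooth_shift.
have -> : conv f rho (x + t *: e_ i) - conv f rho x + t * conv f (partial i rho) x
    = ip mu f (fun y => r (y - x)).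
  rewrite /conv -ipZr// -ipBr// -ipDr//; [|exact: sqintB|exact: sqintZ].
  congr ip; apply/funext => y; rewrite /r mulNr opprK scaleNr -addrA.
  by rewrite opprD !addrA.
have sr := csmooth_sqint cr'.
apply: le_trans (normr_ip_le sf (sqint_shift (- x) sr)) _.
rewrite (nrm_shift (- x) sr) -mulrA ler_wpM2l ?nrm_ge0//.
have mr := smooth_measurable (proj1 cr').
have -> : C * nrm mu \1_B * t ^+ 2 = (C * t ^+ 2) * nrm mu \1_B by ring.
apply: nrm_bounded => // y; first by move=> My; have [_ H2] := H (- t) y t1'; exact: H2.
by have [+ _] := H (- t) y t1'; rewrite sqrrN.
Qed.

(** The kernel is translated continuously in L2. *)
Lemma conv_continuous f rho : sqint mu f -> csmooth rho -> continuous (conv f rho).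
Proof.
move=> sf cr; suff H (x : 'rV[R]_d) : conv f rho y @[y --> x] --> conv f rho x by exact: H.
apply/(@cvgrPdist_le _ _ _ (nbhs x) (nbhs_filter x)) => e e0.
have n0 : 0 < nrm mu f + 1 by rewrite ltr_wpDl ?nrm_ge0.
have sr := csmooth_sqint cr.
have [r r0 H] := L2_translation_continuous sr (proj2 cr) (divr_gt0 e0 n0).
apply/nbhs_ballP; exists r => //= y; rewrite ball_rVE => xy.
have s1 := sqint_shift (- x) sr; have s2 := sqint_shift (- y) sr.
rewrite /conv -ipBr//; apply: le_trans (normr_ip_le sf (sqintB s1 s2)) _.
have hr : `|y - x| < r by rewrite distrC.
have := H _ hr; rewrite ler_pdivlMr// => Hn.
have -> : nrm mu (fun u => rho (u - x) - rho (u - y)) = nrm mu (fun u => rho (u + (y - x)) - rho u).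
  rewrite -[RHS](nrm_shift (- y)); last by apply: sqintB => //; exact: sqint_shift.
  congr nrm; apply/funext => u; congr (rho _ - rho _).
  by rewrite addrA subrK.
by apply: le_trans Hn; rewrite mulrC ler_wpM2l ?nrm_ge0// lerDl.
Qed.

Lemma conv_partial f rho i : sqint mu f -> csmooth rho ->
  (forall x, derivable (conv f rho) x (e_ i)) /\
  partial i (conv f rho) = fun x => - conv f (partial i rho) x.
Proof.
move=> sf cr; have [C HC] := conv_taylor i sf cr.
have cv x : h^-1 *: ((conv f rho \o shift x) (h *: e_ i) - conv f rho x) @[h --> (0 : R)^']
    --> - conv f (partial i rho) x.
  apply/cvgrPdist_le => e e0.
  have C0 : 0 < `|C| + 1 by rewrite ltr_wpDl.
  near=> h.
  have h0 : h != 0 by near: h; exact: nbhs_dnbhs_neq.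
  have h1 : `|h| <= 1 by near: h; exact: dnbhs0_le.
  have he : `|h| <= e / (`|C| + 1) by near: h; apply: dnbhs0_le; rewrite divr_gt0.
  have hn : 0 < `|h| by rewrite normr_gt0.
  have := HC x h h1; rewrite /= (addrC (h *: e_ i)).
  move: (conv f rho (x + h *: e_ i)) (conv f rho x) (conv f (partial i rho) x) => a b c Habc.
  rewrite -normrN opprB opprK /GRing.scale/=.
  rewrite -(ler_pM2l hn) -normrM mulrDr mulVKf// (le_trans Habc)//.
  apply: (@le_trans _ _ ((`|C| + 1) * `|h| ^+ 2)).
    rewrite real_normK ?num_real// ler_wpM2r ?sqr_ge0//.
    by apply: le_trans (ler_norm C) _; rewrite lerDl.
  rewrite expr2 mulrCA ler_pM2l// mulrC -ler_pdivlMr//.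
split => [x|]; first by apply/cvg_ex; exists (- conv f (partial i rho) x); exact: cv.
apply/funext => x; exact: cvg_lim (cv x).
Unshelve. all: by end_near. Qed.

Lemma conv_smooth f rho : sqint mu f -> csmooth rho -> smooth (conv f rho).
Proof.
move=> sf cr.
pose B : set ('rV[R]_d -> R) := [set g | (exists c : R, g = fun=> c) \/
  exists2 rho, csmooth rho & g = conv f rho].
apply: (@alg_closure_smooth _ _ B); last by apply: alg_base; right; exists rho.
move=> _ [[c ->]|[{cr}rho cr ->]].
  split; [by move=> x; exact: cst_continuous|by move=> x i; exact: derivable_cst|].
  by move=> i; apply: alg_base; left; exists 0; rewrite partial_cst.
split; [exact: conv_continuous|by move=> x i; have [H _] := conv_partial i sf cr; exact: H|].
move=> i; have [_ ->] := conv_partial i sf cr.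
rewrite (_ : (fun x => _) = fun x => (fun=> (-1)) x * conv f (partial i rho) x); last first.
  by apply/funext => x; rewrite mulN1r.
apply: alg_mul; apply: alg_base; first by left; exists (-1).
by right; exists (partial i rho) => //; exact: csmooth_partial.
Qed.

Lemma conv_partial2 f rho i j : sqint mu f -> csmooth rho ->
  partial i (partial j (conv f rho)) = conv f (partial i (partial j rho)).
Proof.
move=> sf cr; have [_ ->] := conv_partial j sf cr.
have cj := csmooth_partial j cr.
rewrite (partialN i (conv_smooth sf cj)).
have [_ ->] := conv_partial i sf cj.
by apply/funext => x; rewrite opprK.
Qed.

Lemma conv_eq0 f rho (r : R) x : (forall y, r < `|y| -> rho y = 0) ->
  (forall y, `|y - x| <= r -> f y = 0) -> conv f rho x = 0.
Proof.
move=> rr fx; rewrite /conv /ip (@eq_Rintegral _ _ _ _ _ (fun=> 0)) => [|y _].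
  by rewrite /Rintegral integral0.
have [yx|yx] := leP `|y - x| r; first by rewrite fx// mul0r.
by rewrite rr// mulr0.
Qed.

Lemma conv_bounded_support f rho : bounded_support f -> bounded_support rho ->
  bounded_support (conv f rho).
Proof.
move=> [M fM] [r rr]; exists (M + r) => x Mx; apply: (@conv_eq0 _ _ r) => // y yx.
apply: fM; have := ler_normB y (y - x); rewrite subKr; lra.
Qed.

End convolution.

Section mollification.
Context {R : realType} {d : nat}.
Local Notation mu := (lebesgue_rV R d).
Local Notation integrable f := (mu.-integrable setT (EFin \o f)).
Implicit Types (f g rho : 'rV[R]_d -> R) (x y h : 'rV[R]_d) (i j : 'I_d).

Lemma integrableMr_bounded f rho (C : R) : integrable f -> measurable_fun setT rho ->
  (forall x, `|rho x| <= C) -> integrable (fun x => rho x * f x).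
Proof.
move=> If mr rC.
have mf : measurable_fun setT f by apply/measurable_EFinP; exact: measurable_int If.
apply: integrable_le (measurable_funM mr mf) (integrableZ_EFin C (integrable_norm If)) _.
by move=> x; rewrite normrM ler_wpM2r.
Qed.

Lemma convE f rho x : sqint mu f -> csmooth rho ->
  conv f rho x = \int[mu]_h (rho h * f (h + x)).
Proof.
move=> sf cr; have sr := csmooth_sqint (csmooth_shift (- x) cr).
rewrite -(Rintegral_shift (- x)).
  by apply: eq_Rintegral => y _; rewrite subrK mulrC.
by apply: sqintM; [exact: csmooth_sqint|exact: sqint_shift].
Qed.

(** The mean of a random variable minimizes its mean square distance to a constant;
    rho is the density of the law. *)
Lemma conv_jensen f rho (r b : R) x : sqint mu f -> mollifier r rho ->
  integrable (fun h => rho h * (f (h + x) - b) ^+ 2) /\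
  (conv f rho x - b) ^+ 2 <= \int[mu]_h (rho h * (f (h + x) - b) ^+ 2).
Proof.
move=> sf [cr r0 r1 _]; have [C C0 rC] := csmooth_bounded cr.
have mr := smooth_measurable (proj1 cr).
have sfx := sqint_shift x sf.
have I0 := csmooth_integrable cr.
have I1 : integrable (fun h => rho h * f (h + x)) := sqintM (csmooth_sqint cr) sfx.
have I2 : integrable (fun h => rho h * f (h + x) ^+ 2).
  by apply: integrableMr_bounded mr rC; case: sfx.
set c := conv f rho x; have cE : c = \int[mu]_h (rho h * f (h + x)) by exact: convE.
have key (a : R) : integrable (fun h => rho h * (f (h + x) - a) ^+ 2) /\
   \int[mu]_h (rho h * (f (h + x) - a) ^+ 2) =
     \int[mu]_h (rho h * f (h + x) ^+ 2) - 2 * a * c + a ^+ 2.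
  have E : (fun h => rho h * (f (h + x) - a) ^+ 2) = (fun h =>
     rho h * f (h + x) ^+ 2 - (2 * a) * (rho h * f (h + x)) + a ^+ 2 * rho h).
    by apply/funext => h; move: (rho h) (f (h + x)) => p q; ring.
  have J1 := integrableZ_EFin (2 * a) I1; have J2 := integrableZ_EFin (a ^+ 2) I0.
  have J3 := integrableB_EFin I2 J1.
  rewrite E; split; first exact: integrableD_EFin.
  by rewrite RintegralD// RintegralB// !RintegralZl// -cE r1 mulr1.
have [Ib Eb] := key b; split => //; rewrite Eb.
have [_ Ec] := key c.
have : 0 <= \int[mu]_h (rho h * (f (h + x) - c) ^+ 2).
  by apply: Rintegral_ge0 => h _; rewrite mulr_ge0// sqr_ge0.
rewrite Ec; move: (\int[mu]_h (rho h * f (h + x) ^+ 2)) => I.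
by clear; lra.
Qed.

(** By [conv_jensen] and Tonelli, the squared error is at most the average over h,
    weighted by rho, of the squared L2 distance between f and its translate by h. *)
Lemma nrm_conv_le f rho (r e : R) : sqint mu f -> bounded_support f ->
  mollifier r rho -> 0 <= e ->
  (forall h, `|h| <= r -> nrm mu (fun x => f (x + h) - f x) <= e) ->
  nrm mu (fun x => conv f rho x - f x) <= e.
Proof.
move=> sf bf mrho e0 He; have [cr r0 r1 rr] := mrho.
have cc : csmooth (conv f rho).
  by split; [exact: conv_smooth|apply: conv_bounded_support => //; case: cr].
have sc := sqintB (csmooth_sqint cc) sf.
have mf := sqint_meas sf; have mr := smooth_measurable (proj1 cr).
pose G (p : 'rV[R]_d * 'rV[R]_d) : \bar R := (rho p.2 * (f (p.1 + p.2) - f p.1) ^+ 2)%:E.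
have mG : measurable_fun setT G.
  apply/measurable_EFinP; apply: measurable_funM.
    exact: (measurableT_comp mr measurable_snd).
  apply: measurable_funX; apply: measurable_funB.
    exact: (measurableT_comp mf measurable_add_rV).
  exact: (measurableT_comp mf measurable_fst).
have G0 p : (0 <= G p)%E by rewrite lee_fin mulr_ge0// sqr_ge0.
have T := @fubini_tonelli _ _ _ _ _ mu mu G mG G0.
have H1 : (\int[mu]_x ((conv f rho x - f x) ^+ 2)%:E <= \int[mu]_x \int[mu]_h G (x, h))%E.
  apply: ge0_le_integral; first exact: measurableT.
  - by move=> x _; rewrite lee_fin sqr_ge0.
  - by apply/measurable_EFinP; exact: (measurable_funX 2 (sqint_meas sc)).
  - exact: measurable_fun_fubini_tonelli_F.
  - move=> x _; have [Ix Jx] := conv_jensen (f x) x sf mrho.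
    rewrite (_ : (\int[mu]_h G (x, h))%E = (\int[mu]_h (rho h * (f (h + x) - f x) ^+ 2))%:E) ?lee_fin//.
    rewrite /Rintegral fineK; last exact: integrable_fin_num Ix.
    by apply: eq_integral => h _; rewrite /G/= (addrC x h).
have H2 : (\int[mu]_h \int[mu]_x G (x, h) <= \int[mu]_h (e ^+ 2 * rho h)%:E)%E.
  apply: ge0_le_integral; first exact: measurableT.
  - by move=> h _; apply: integral_ge0 => x _; exact: G0.
  - exact: measurable_fun_fubini_tonelli_G.
  - by apply/measurable_EFinP; exact: measurable_funM.
  - move=> h _; have sh := sqintB (sqint_shift h sf) sf.
    have Ih : integrable (fun x => (f (x + h) - f x) ^+ 2) by case: sh.
    rewrite (_ : (\int[mu]_x G (x, h))%E = (rho h * nrm mu (fun x => f (x + h) - f x) ^+ 2)%:E).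
      rewrite lee_fin mulrC; have [hr|hr] := leP `|h| r; last by rewrite rr// !mulr0.
      apply: ler_wpM2r; first exact: r0.
      by rewrite ler_pXn2r ?nnegrE ?nrm_ge0//; exact: He.
    have Iq := sqintM sh sh.
    rewrite nrm_sqr /ip -(RintegralZl _ measurableT Iq).
    rewrite /Rintegral fineK; last first.
      by apply: integrable_fin_num => //; exact: (integrableZ_EFin (rho h) Iq).
    by apply: eq_integral => x _; rewrite /G/= expr2.
have H3 : (\int[mu]_h (e ^+ 2 * rho h)%:E = (e ^+ 2)%:E)%E.
  have Ir := csmooth_integrable cr.
  have E : \int[mu]_h (e ^+ 2 * rho h) = e ^+ 2 by rewrite RintegralZl// r1 mulr1.
  rewrite -[in RHS]E /Rintegral fineK//.
  by apply: integrable_fin_num => //; exact: integrableZ_EFin.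
rewrite -(ler_pXn2r (isT : (0 < 2)%N)) ?nnegrE ?nrm_ge0// nrm_sqr -lee_fin.
rewrite /ip /Rintegral fineK; last by apply: integrable_fin_num => //; exact: sqintM.
apply: le_trans (le_trans H1 _); first by under eq_integral do rewrite -expr2.
by rewrite T (le_trans H2)// H3.
Qed.

Theorem mollification f : sqint mu f -> bounded_support f -> forall e : R, 0 < e ->
  exists2 r : R, 0 < r & forall s rho, s < r -> mollifier s rho ->
    nrm mu (fun x => conv f rho x - f x) <= e.
Proof.
move=> sf bf e e0; have [r r0 Hr] := L2_translation_continuous sf bf e0.
exists r => // s rho sr mrho; apply: nrm_conv_le mrho (ltW e0) _ => // h hs.
by apply: Hr; exact: le_lt_trans sr.
Qed.

End mollification.

(** * Weak derivatives on a domain *)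

Section zero_extension.
Context {R : realType} {d : nat}.
Local Notation mu := (lebesgue_rV R d).
Implicit Types (A B : set 'rV[R]_d) (z w f g : 'rV[R]_d -> R).

(** All functions on A are handled through their extensions by zero, so that only
    integrals over R^d occur. *)
Definition ext A z : 'rV[R]_d -> R := patch (cst 0) A z.

Lemma ext_in A z x : A x -> ext A z x = z x.
Proof. by move=> Ax; rewrite /ext patchE mem_set. Qed.

Lemma ext_out A z x : ~ A x -> ext A z x = 0.
Proof. by move=> Ax; rewrite /ext patchE memNset. Qed.

Lemma ext_eq A z w : (forall x, A x -> z x = w x) -> ext A z = ext A w.
Proof.
move=> zw; apply/funext => x; have [Ax|Ax] := pselect (A x).
  by rewrite !ext_in// zw.
by rewrite !ext_out.
Qed.

Lemma ext_id A z : (forall x, z x != 0 -> A x) -> ext A z = z.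
Proof.
move=> zA; apply/funext => x; have [Ax|Ax] := pselect (A x); first by rewrite ext_in.
by rewrite ext_out//; apply/esym/eqP; apply: contrapT => /negP/zA.
Qed.

Lemma extB A z w : ext A (fun x => z x - w x) = (fun x => ext A z x - ext A w x).
Proof.
apply/funext => x; have [Ax|Ax] := pselect (A x); first by rewrite !ext_in.
by rewrite !ext_out// subrr.
Qed.

Lemma ext_sub B A z : A `<=` B -> ext A z = ext A (ext B z).
Proof. by move=> AB; apply: ext_eq => x /AB Bx; rewrite ext_in. Qed.

Lemma L2_sqint A z : L2 A z <-> sqint mu (ext A z).
Proof.
rewrite /L2/=; split => [H|[mz Iz]].
  split; last exact: (Lfun2_integrable_sqr H).
  by move: H; rewrite inE => /andP[/[!inE]].
rewrite inE; apply/andP; split; rewrite inE//= /finite_norm.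
rewrite unlock.
apply: poweR_lty.
move/integrableP : Iz => [_]; apply: le_lt_trans.
rewrite le_eqVlt; apply/orP; left; apply/eqP; apply: eq_integral => x _ /=.
by rewrite -[2%R]/(2%:R) powR_mulrn// normrX.
Qed.

Lemma innerE A z w : inner A z w = ip mu (ext A z) (ext A w).
Proof.
rewrite /inner Rintegral_mkcond; apply: eq_Rintegral => x _.
rewrite patchE; case: ifPn => [/set_mem Ax|/negP Ax]; first by rewrite !ext_in.
by rewrite ext_out ?mul0r// => Ax'; apply: Ax; rewrite inE.
Qed.

Lemma bounded_setP A : bounded_set A -> exists2 M : R, 0 <= M & forall x, A x -> `|x| <= M.
Proof.
move=> [M [_ AM]]; exists (`|M| + 1); first by rewrite addr_ge0.
by move=> x Ax; apply: AM => //; apply: le_lt_trans (ler_norm M) _; rewrite ltrDl.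
Qed.

Lemma compact_closure_bounded A : bounded_set A -> compact (closure A).
Proof.
move=> /bounded_setP[M M0 AM]; apply: bounded_closed_compact; last exact: closed_closure.
exists M; split; first exact: num_real.
move=> r Mr x /(closure_subset (AM : A `<=` [set x : 'rV[R]_d | `|x| <= M])).
rewrite -((closure_id _).1 (@closed_norm_le _ _ M)) /= => xM.
exact: le_trans xM (ltW Mr).
Qed.

Lemma ext_bounded_support A z : bounded_set A -> bounded_support (ext A z).
Proof.
move=> /bounded_setP[M _ AM]; exists M => x Mx; rewrite ext_out// => /AM.
by rewrite leNgt Mx.
Qed.

Lemma measurable_ext A z : measurable A -> measurable_fun setT z ->
  measurable_fun setT (ext A z).
Proof.
move=> mA mz; rewrite (_ : ext A z = fun x => \1_A x * z x).
  by apply: measurable_funM.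
apply/funext => x; rewrite indicE; have [Ax|Ax] := pselect (A x).
  by rewrite ext_in// mem_set// mul1r.
by rewrite ext_out// memNset// mul0r.
Qed.

Lemma sqint_ext A z : measurable A -> sqint mu z -> sqint mu (ext A z).
Proof.
move=> mA sz; apply: sqint_le (sz) _; first exact: measurable_ext (sqint_meas sz).
move=> x; have [Ax|Ax] := pselect (A x); first by rewrite ext_in.
by rewrite ext_out// normr0.
Qed.

Lemma sqint_ext_sub A B z : measurable A -> A `<=` B -> sqint mu (ext B z) ->
  sqint mu (ext A z).
Proof. by move=> mA AB sz; rewrite (ext_sub _ AB); exact: sqint_ext. Qed.

Lemma sqint_ext_smooth A z : measurable A -> bounded_set A -> smooth z ->
  sqint mu (ext A z).
Proof.
move=> mA bA sz; have [M M0 AM] := bounded_setP bA.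
have [C C0 zC] := continuous_bounded_ball M (smooth_continuous sz).
apply: (@sqint_bounded _ _ _ C).
- by apply: measurable_ext => //; exact: smooth_measurable.
- exact: ext_bounded_support.
move=> x; have [Ax|Ax] := pselect (A x); first by rewrite ext_in// zC// AM.
by rewrite ext_out// normr0.
Qed.

Lemma test_function_csmooth A z : test_function A z -> csmooth z.
Proof.
move=> [sz [cz _]]; split => //.
have [M _ HM] := bounded_setP (compact_bounded cz).
exists M => x Mx; apply/eqP; apply: contrapT => /negP zx.
have : closure [set x | z x != 0] x by exact: subset_closure.
by move=> /HM; rewrite leNgt Mx.
Qed.

Lemma test_function_supp A z x : test_function A z -> z x != 0 -> A x.
Proof. by move=> [_ [_]] H zx; apply: H; exact: subset_closure. Qed.

Lemma ext_test A z : test_function A z -> ext A z = z.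
Proof. by move=> tz; apply: ext_id => x; exact: test_function_supp. Qed.

Lemma test_function_intro A z : csmooth z -> closure [set x | z x != 0] `<=` A ->
  test_function A z.
Proof.
move=> [sz [M zM]] H; split => //; split => //.
apply: compact_closure_bounded; exists M; split; first exact: num_real.
move=> r Mr x /= zx; apply: le_trans (ltW Mr); rewrite leNgt.
by apply: contraNN zx => /zM ->.
Qed.

Lemma test_function_ball A z a (s : R) : smooth z ->
  (forall x, s < `|x - a| -> z x = 0) -> (forall x, `|x - a| <= s -> A x) ->
  test_function A z.
Proof.
move=> sz zs sA; apply: test_function_intro.
  split => //; exists (s + `|a|) => x xs; apply: zs.
  by have := ler_normD (x - a) a; rewrite subrK; lra.
have cB : closed [set x : 'rV[R]_d | `|x - a| <= s].
  have -> : [set x : 'rV[R]_d | `|x - a| <= s] = (fun x => `|x - a|) @^-1` [set r : R | r <= s] by [].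
  apply: preimage_closed => [x _|]; last exact: closed_le.
  apply: (@continuous_comp _ _ _ (fun x : 'rV[R]_d => x - a) Num.norm).
    by apply: (@continuousD _ _ _ id (cst (- a))); [move=> ?|exact: cst_continuous].
  exact: norm_continuous.
apply: (@subset_trans _ [set x : 'rV[R]_d | `|x - a| <= s]) => //.
rewrite [X in _ `<=` X]((closure_id _).1 cB); apply: closure_subset => x /=.
by apply: contraNT; rewrite -ltNge => /zs ->.
Qed.

Lemma test_function_partial A z i : test_function A z -> test_function A (partial i z).
Proof.
move=> tz; have cz := test_function_csmooth tz; have [_ [_ zA]] := tz.
apply: test_function_intro; first exact: csmooth_partial.
apply: subset_trans zA => x /=; apply: contraPP => zx.
have /open_nbhs_nbhs : open_nbhs x (~` closure [set x | z x != 0]).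
  by split => //; exact/closed_openC/closed_closure.
move=> Hx /(_ _ Hx)[y [/= zy yx]].
move/negP : zy; apply; apply/eqP; rewrite (@partial_near _ _ z (fun=> 0)) ?partial_cst//.
have : nbhs y (~` closure [set x | z x != 0]).
  by apply: open_nbhs_nbhs; split => //; exact/closed_openC/closed_closure.
apply: filterS => u uz; apply/eqP; apply: contrapT => /negP zu; apply: uz.
exact: subset_closure.
Qed.

Lemma test_function_sub A B z : A `<=` B -> test_function A z -> test_function B z.
Proof. by move=> AB [sz [cz zA]]; split => //; split => //; exact: subset_trans AB. Qed.

(** At points away from the boundary, mollifications are integrals against test
    functions. *)
Lemma du_bois_reymond A f : open A -> bounded_set A -> sqint mu (ext A f) ->
  (forall phi, test_function A phi -> ip mu (ext A f) phi = 0) ->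
  {ae mu, forall x, ext A f x = 0}.
Proof.
move=> oA bA sf Hf; pose F := ext A f.
have bF : bounded_support F by exact: ext_bounded_support.
pose E k := erosion A k.+1%:R^-1.
have mE k : measurable (E k) by apply: closed_rV_measurable; exact: erosion_closed.
have sE k : sqint mu (ext (E k) F) by exact: sqint_ext.
have nE k : nrm mu (ext (E k) F) = 0.
  apply/eqP; rewrite eq_le nrm_ge0 andbT; apply/ler_addgt0Pl => e e0; rewrite addr0.
  have [r r0 Hr] := mollification sf bF e0.
  have k0 : 0 < k.+1%:R^-1 :> R by rewrite invr_gt0.
  pose s := Num.min r (k.+1%:R^-1) / 2.
  have m0 : 0 < Num.min r (k.+1%:R^-1) by rewrite lt_min r0.
  have s0 : 0 < s by rewrite divr_gt0.
  have [sr sk] : s < r /\ s < k.+1%:R^-1.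
    by rewrite /s; move: r0 k0; clear; move: (k.+1%:R^-1 : R) => q; case: (leP r q); lra.
  have [rho mrho] := mollifier_exists (d := d) s0.
  have [cr _ _ rs] := mrho.
  apply: le_trans (Hr s rho sr mrho).
  have cc : csmooth (conv F rho).
    by split; [exact: conv_smooth|apply: conv_bounded_support => //; case: cr].
  apply: nrm_le => //; first by apply: sqintB => //; exact: csmooth_sqint.
  move=> x; have [Ex|Ex] := pselect (E k x); last by rewrite ext_out// normr0.
  rewrite ext_in// (_ : conv F rho x = 0) ?sub0r ?normrN//.
  apply: Hf; apply: (@test_function_ball _ _ x s).
  - by have [] := csmooth_shift (- x) cr.
  - by move=> y; exact: rs.
  - by move=> y yx; apply: Ex; rewrite ball_rVE distrC; exact: le_lt_trans sk.
have aeE k : {ae mu, forall x, ext (E k) F x = 0}.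
  by apply: ip_eq0_ae => //; rewrite -nrm_sqr nE expr0n.
have : {ae mu, forall x k, ext (E k) F x = 0} by exact/ae_foralln.
apply: filterS => x Hx; have [Ax|Ax] := pselect (A x); last by rewrite ext_out.
have [k _ Ek] : (\bigcup_k E k) x by rewrite bigcup_erosion.
by have := Hx k; rewrite ext_in.
Qed.

End zero_extension.

Section weak_derivatives.
Context {R : realType} {d : nat}.
Local Notation mu := (lebesgue_rV R d).
Implicit Types (A B : set 'rV[R]_d) (z w f g : 'rV[R]_d -> R)
  (Th G H : 'rV[R]_d -> 'M[R]_d).

Lemma inner_test A f phi : test_function A phi -> inner A f phi = ip mu f phi.
Proof.
move=> tp; rewrite innerE (ext_test tp); apply: eq_Rintegral => x _.
have [Ax|Ax] := pselect (A x); first by rewrite ext_in.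
rewrite (_ : phi x = 0) ?mulr0//; apply/eqP; apply: contrapT => /negP.
by move=> /(test_function_supp tp).
Qed.

Lemma inner_eqr A f g w : (forall x, A x -> g x = w x) -> inner A f g = inner A f w.
Proof. by move=> gw; rewrite !innerE (ext_eq gw). Qed.

Lemma inner_eql A f g w : (forall x, A x -> g x = w x) -> inner A g f = inner A w f.
Proof. by move=> gw; rewrite !innerE (ext_eq gw). Qed.

Lemma weak_unique A f g : open A -> bounded_set A -> L2 A f -> L2 A g ->
  (forall phi, test_function A phi -> inner A f phi = inner A g phi) ->
  {ae mu, forall x, ext A f x = ext A g x}.
Proof.
move=> oA bA /L2_sqint sf /L2_sqint sg fg.
have sfg := sqintB sf sg.
have : {ae mu, forall x, ext A (fun x => f x - g x) x = 0}.
  apply: du_bois_reymond => //; first by rewrite extB.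
  move=> phi tp; have sp := csmooth_sqint (test_function_csmooth tp).
  by rewrite extB ipBl// -[in LHS](ext_test tp) -!innerE fg// subrr.
apply: filterS => x; rewrite extB => H.
by apply/eqP; rewrite -subr_eq0 H.
Qed.

Lemma weak_hessian_unique A z G H : open A -> bounded_set A ->
  weak_hessian A z G -> weak_hessian A z H -> forall i j,
  {ae mu, forall x, ext A (fun x => G x i j) x = ext A (fun x => H x i j) x}.
Proof.
move=> oA bA [LG HG] [LH HH] i j; apply: weak_unique => //.
by move=> phi tp; rewrite HG// HH.
Qed.

Lemma weak_divdiv_unique A Th f g : open A -> bounded_set A ->
  weak_divdiv A Th f -> weak_divdiv A Th g ->
  {ae mu, forall x, ext A f x = ext A g x}.
Proof.
move=> oA bA [Lf Hf] [Lg Hg]; apply: weak_unique => //.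
by move=> phi tp; rewrite Hf// Hg.
Qed.

Lemma hessP A z : (exists G, weak_hessian A z G) -> weak_hessian A z (hess A z).
Proof. by move=> /(xgetPex (cst 0)). Qed.

Lemma divdivP A Th : (exists f, weak_divdiv A Th f) -> weak_divdiv A Th (divdiv A Th).
Proof. by move=> /(xgetPex (cst 0)). Qed.

(** [hess] selects an arbitrary weak Hessian, but weak Hessians agree almost
    everywhere. *)
Lemma inner_hess A z G f i j : open A -> bounded_set A -> weak_hessian A z G -> L2 A f ->
  inner A f (fun x => hess A z x i j) = inner A f (fun x => G x i j).
Proof.
move=> oA bA wG Lf; have wh := hessP (ex_intro _ G wG).
rewrite !innerE ![ip _ (ext A f) _]ipC.
apply: ae_eq_ip; [exact/L2_sqint/wh.1|exact/L2_sqint/wG.1|exact/L2_sqint|].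
exact: (weak_hessian_unique oA bA wh wG).
Qed.

Lemma inner_divdiv A Th f g : open A -> bounded_set A -> weak_divdiv A Th f -> L2 A g ->
  inner A (divdiv A Th) g = inner A f g.
Proof.
move=> oA bA wf Lg; have wd := divdivP (ex_intro _ f wf).
rewrite !innerE.
apply: ae_eq_ip; [exact/L2_sqint/wd.1|exact/L2_sqint/wf.1|exact/L2_sqint|].
exact: (weak_divdiv_unique oA bA wd wf).
Qed.

Lemma innermx_hess A z G Th : open A -> bounded_set A -> weak_hessian A z G -> L2mx A Th ->
  innermx A Th (hess A z) = innermx A Th G.
Proof.
move=> oA bA wG LTh; apply: eq_bigr => i _; apply: eq_bigr => j _.
exact: inner_hess.
Qed.

Lemma innerC A f g : inner A f g = inner A g f.
Proof. by rewrite !innerE ipC. Qed.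

Lemma innermxC A G H : innermx A G H = innermx A H G.
Proof. by apply: eq_bigr => i _; apply: eq_bigr => j _; rewrite innerC. Qed.

Lemma inner_nrm A f : inner A f f = nrm mu (ext A f) ^+ 2.
Proof. by rewrite nrm_sqr innerE. Qed.

Lemma inner_ge0 A f : 0 <= inner A f f.
Proof. by rewrite inner_nrm sqr_ge0. Qed.

Lemma innermx_ge0 A G : 0 <= innermx A G G.
Proof. by apply: sumr_ge0 => i _; apply: sumr_ge0 => j _; exact: inner_ge0. Qed.

Lemma bdualE A Th z f G : open A -> bounded_set A -> L2 A z -> L2mx A Th ->
  weak_divdiv A Th f -> weak_hessian A z G ->
  bdual A Th z = inner A f z - innermx A Th G.
Proof.
by move=> oA bA Lz LTh wf wG; rewrite /bdual (inner_divdiv oA bA wf)// (innermx_hess oA bA wG).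
Qed.

Lemma norm2_sqr A z G : open A -> bounded_set A -> weak_hessian A z G ->
  norm2 A z ^+ 2 = inner A z z + innermx A G G.
Proof.
move=> oA bA wG; have wh := hessP (ex_intro _ G wG).
rewrite /norm2 sqr_sqrtr ?addr_ge0 ?inner_ge0 ?innermx_ge0//; congr (_ + _).
have [Lh _] := wh; have [LG _] := wG.
transitivity (innermx A (hess A z) G); first exact: (innermx_hess oA bA wG Lh).
by rewrite innermxC; exact: (innermx_hess oA bA wG LG).
Qed.

Lemma norm_divdiv_sqr A Th f : open A -> bounded_set A -> weak_divdiv A Th f ->
  norm_divdiv A Th ^+ 2 = innermx A Th Th + inner A f f.
Proof.
move=> oA bA wf; have wd := divdivP (ex_intro _ f wf).
rewrite /norm_divdiv sqr_sqrtr ?addr_ge0 ?inner_ge0 ?innermx_ge0//; congr (_ + _).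
have [Ld _] := wd; have [Lf _] := wf.
transitivity (inner A f (divdiv A Th)); first exact: (inner_divdiv oA bA wf Ld).
by rewrite innerC; exact: (inner_divdiv oA bA wf Lf).
Qed.

Lemma norm2_ge0 A z : 0 <= norm2 A z. Proof. exact: sqrtr_ge0. Qed.

Lemma weak_hessianB A z w G H : L2 A z -> L2 A w -> weak_hessian A z G ->
  weak_hessian A w H -> weak_hessian A (fun x => z x - w x) (fun x => G x - H x).
Proof.
move=> /L2_sqint sz /L2_sqint sw [LG HG] [LH HH].
have E i j : (fun x => (G x - H x) i j) = (fun x => G x i j - H x i j).
  by apply/funext => x; rewrite !mxE.
split => [i j|phi i j tp].
  by apply/L2_sqint; rewrite E extB; apply: sqintB; exact/L2_sqint.
have tpp := test_function_partial i (test_function_partial j tp).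
have sp := csmooth_sqint (test_function_csmooth tp).
have spp := csmooth_sqint (test_function_csmooth tpp).
have /L2_sqint sG := LG i j; have /L2_sqint sH := LH i j.
rewrite E !innerE !extB (ext_test tp) (ext_test tpp) !ipBl//.
by have := HG phi i j tp; have := HH phi i j tp; rewrite !innerE (ext_test tp) (ext_test tpp) => -> ->.
Qed.

Definition smooth_hess f x : 'M[R]_d := \matrix_(i, j) partial i (partial j f) x.

Lemma smooth_hessE f i j : (fun x => smooth_hess f x i j) = partial i (partial j f).
Proof. by apply/funext => x; rewrite mxE. Qed.

Lemma L2_smooth A f : open A -> bounded_set A -> smooth f -> L2 A f.
Proof.
move=> oA bA sf; apply/L2_sqint; apply: sqint_ext_smooth => //.
exact: open_rV_measurable.
Qed.

Lemma weak_hessian_smooth A f : open A -> bounded_set A -> smooth f ->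
  weak_hessian A f (smooth_hess f).
Proof.
move=> oA bA sf; split => [i j|phi i j tp].
  rewrite smooth_hessE; apply: (L2_smooth oA bA).
  by apply: smooth_partial; exact: smooth_partial.
rewrite smooth_hessE (inner_test _ tp) (inner_test _ (test_function_partial i (test_function_partial j tp))).
exact: ip_partial2r (test_function_csmooth tp).
Qed.

Lemma weak_divdiv_smooth A Th : open A -> bounded_set A -> smooth_sym_tensor Th ->
  weak_divdiv A Th (fun x => \sum_i \sum_j partial i (partial j (fun x => Th x i j)) x).
Proof.
move=> oA bA [sT _].
have sP i j : smooth (partial i (partial j (fun x => Th x i j))) by do 2 apply: smooth_partial.
have sS i : smooth (fun x => \sum_j partial i (partial j (fun x => Th x i j)) x).
  exact: smooth_sum.
split; first by apply: L2_smooth => //; exact: smooth_sum.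
move=> phi tp; have cp := test_function_csmooth tp.
rewrite (inner_test _ tp) /ip.
rewrite (@eq_Rintegral _ _ _ mu setT (fun x => \sum_i \sum_j (partial i (partial j (fun x => Th x i j)) x * phi x))); last first.
  by move=> x _; rewrite mulr_suml; apply: eq_bigr => i _; rewrite mulr_suml.
have I2 i j : mu.-integrable setT (EFin \o (fun x => partial i (partial j (fun x => Th x i j)) x * phi x)).
  by apply: csmooth_integrable; exact: csmoothMl.
rewrite Rintegral_sum_fin => [|i]; last first.
  under eq_fun do rewrite /=.
  exact: integrable_sum_fin.
apply: eq_bigr => i _; rewrite Rintegral_sum_fin//; apply: eq_bigr => j _.
rewrite (inner_test _ (test_function_partial i (test_function_partial j tp))).
exact: ip_partial2r.
Qed.

End weak_derivatives.

Section restriction.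
Context {R : realType} {d : nat}.
Local Notation mu := (lebesgue_rV R d).
Implicit Types (A B : set 'rV[R]_d) (z w f g : 'rV[R]_d -> R)
  (Th G H : 'rV[R]_d -> 'M[R]_d).

Lemma L2_sub A B z : measurable A -> A `<=` B -> L2 B z -> L2 A z.
Proof. by move=> mA AB /L2_sqint sz; apply/L2_sqint; exact: sqint_ext_sub sz. Qed.

Lemma weak_hessian_sub A B z G : measurable A -> A `<=` B ->
  weak_hessian B z G -> weak_hessian A z G.
Proof.
move=> mA AB [LG HG]; split => [i j|phi i j tp]; first exact: L2_sub (LG i j).
have tB := test_function_sub AB tp.
have := HG phi i j tB; rewrite !(inner_test _ tp) !(inner_test _ tB).
have t2 := test_function_partial i (test_function_partial j tp).
by rewrite (inner_test _ t2) (inner_test _ (test_function_sub AB t2)).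
Qed.

Lemma weak_divdiv_sub A B Th f : measurable A -> A `<=` B ->
  weak_divdiv B Th f -> weak_divdiv A Th f.
Proof.
move=> mA AB [Lf Hf]; split => [|phi tp]; first exact: L2_sub Lf.
have tB := test_function_sub AB tp.
have := Hf phi tB; rewrite !(inner_test _ tp) !(inner_test _ tB) => ->.
apply: eq_bigr => i _; apply: eq_bigr => j _.
have t2 := test_function_partial i (test_function_partial j tp).
by rewrite (inner_test _ t2) (inner_test _ (test_function_sub AB t2)).
Qed.

Lemma inner_sub_le A B f : measurable A -> A `<=` B -> L2 B f ->
  inner A f f <= inner B f f.
Proof.
move=> mA AB /L2_sqint sf; rewrite !inner_nrm ler_pXn2r// ?nnegrE ?nrm_ge0//.
apply: nrm_le => //; first exact: sqint_ext_sub sf.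
move=> x; have [Ax|Ax] := pselect (A x); last by rewrite ext_out// normr0.
by rewrite !ext_in//; exact: AB.
Qed.

Lemma innermx_sub_le A B G : measurable A -> A `<=` B -> L2mx B G ->
  innermx A G G <= innermx B G G.
Proof.
by move=> mA AB LG; apply: ler_sum => i _; apply: ler_sum => j _; exact: inner_sub_le.
Qed.

Lemma sub_bounded_set A B : A `<=` B -> bounded_set B -> bounded_set A.
Proof.
move=> AB [M [Mr HM]]; exists M; split => // r Mlt x Ax.
by apply: (HM r Mlt); exact: AB.
Qed.

Lemma norm2_sub_le A B z G : open A -> open B -> A `<=` B -> bounded_set B ->
  L2 B z -> weak_hessian B z G -> norm2 A z <= norm2 B z.
Proof.
move=> oA oB AB bB Lz wB; have bA := sub_bounded_set AB bB.
have mA := open_rV_measurable oA; have wA := weak_hessian_sub mA AB wB.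
rewrite -(ler_pXn2r (isT : (0 < 2)%N)) ?nnegrE ?norm2_ge0//.
rewrite (norm2_sqr oA bA wA) (norm2_sqr oB bB wB).
by apply: lerD; [exact: inner_sub_le|apply: innermx_sub_le => //; case: wB].
Qed.

Lemma L2B A z w : L2 A z -> L2 A w -> L2 A (fun x => z x - w x).
Proof.
move=> /L2_sqint sz /L2_sqint sw; apply/L2_sqint; rewrite extB.
exact: sqintB.
Qed.

Lemma L2mxB A G H : L2mx A G -> L2mx A H -> L2mx A (fun x => G x - H x).
Proof.
move=> LG LH i j; rewrite (_ : (fun x => _) = fun x => G x i j - H x i j).
  exact: L2B.
by apply/funext => x; rewrite !mxE.
Qed.

(** Test functions are in particular smooth, and the norms decrease by restriction. *)
Lemma H20_H2_sub A B z : open A -> open B -> A `<=` B -> bounded_set B ->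
  H20 B z -> H2 A z.
Proof.
move=> oA oB AB bB [Lz [G wG] Hz]; have mA := open_rV_measurable oA.
split; first exact: L2_sub Lz.
  by exists G; exact: weak_hessian_sub wG.
move=> e e0; have [phi tp He] := Hz e e0; have sp : smooth phi by case: tp.
exists phi; first exact: sp.
apply: le_lt_trans He.
have Lp := L2_smooth oB bB sp.
exact: (norm2_sub_le oA oB AB bB (L2B Lz Lp)
  (weak_hessianB Lz Lp wG (weak_hessian_smooth oB bB sp))).
Qed.

Lemma L2mx_smooth A Th : open A -> bounded_set A -> smooth_sym_tensor Th -> L2mx A Th.
Proof. by move=> oA bA [sT _] i j; exact: L2_smooth. Qed.

Lemma weak_divdivB A Th Th' f f' : L2mx A Th -> L2mx A Th' ->
  weak_divdiv A Th f -> weak_divdiv A Th' f' ->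
  weak_divdiv A (fun x => Th x - Th' x) (fun x => f x - f' x).
Proof.
move=> LT LT' [Lf Hf] [Lf' Hf']; split => [|phi tp]; first exact: L2B.
have sp := csmooth_sqint (test_function_csmooth tp).
move: Lf Lf' => /L2_sqint sf /L2_sqint sf'.
transitivity (inner A f phi - inner A f' phi).
  by rewrite !innerE extB (ext_test tp) ipBl.
rewrite Hf// Hf'// -sumrB; apply: eq_bigr => i _; rewrite -sumrB; apply: eq_bigr => j _.
have t2 := test_function_partial i (test_function_partial j tp).
have s2 := csmooth_sqint (test_function_csmooth t2).
rewrite (_ : (fun x => (Th x - Th' x) i j) = fun x => Th x i j - Th' x i j).
  by rewrite !innerE extB (ext_test t2) ipBl//; exact/L2_sqint.
by apply/funext => x; rewrite !mxE.
Qed.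

Lemma Hdivdiv_sub A B Th : open A -> open B -> A `<=` B -> bounded_set B ->
  Hdivdiv B Th -> Hdivdiv A Th.
Proof.
move=> oA oB AB bB [LT [f wf] HT]; have mA := open_rV_measurable oA.
have bA := sub_bounded_set AB bB.
split; first by move=> i j; exact: L2_sub (LT i j).
  by exists f; exact: weak_divdiv_sub wf.
move=> e e0; have [Psi sP He] := HT e e0; exists Psi => //; apply: le_lt_trans He.
have wB := weak_divdivB LT (L2mx_smooth oB bB sP) wf (weak_divdiv_smooth oB bB sP).
have wA := weak_divdiv_sub mA AB wB.
rewrite -(ler_pXn2r (isT : (0 < 2)%N)) ?nnegrE ?sqrtr_ge0//.
rewrite (norm_divdiv_sqr oA bA wA) (norm_divdiv_sqr oB bB wB).
apply: lerD; first by apply: innermx_sub_le => //; exact: (L2mxB LT (L2mx_smooth oB bB sP)).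
by apply: inner_sub_le => //; case: wB.
Qed.

(** A smooth tensor approximates itself. *)
Lemma Hdivdiv_smooth A Th : open A -> bounded_set A -> smooth_sym_tensor Th -> Hdivdiv A Th.
Proof.
move=> oA bA sT; have LT := L2mx_smooth oA bA sT.
have wT := weak_divdiv_smooth oA bA sT; split => //; first by eexists; exact: wT.
move=> e e0; exists Th => //.
rewrite -(ltr_pXn2r (isT : (0 < 2)%N)) ?nnegrE ?sqrtr_ge0 ?(ltW e0)//.
rewrite (norm_divdiv_sqr oA bA (weak_divdivB LT LT wT wT)).
have E0 : ext A (fun=> (0 : R)) = fun=> 0 by rewrite /ext; apply/funext => x; rewrite patchE; case: ifP.
have I0 : inner A (fun=> 0) (fun=> 0) = 0 by rewrite inner_nrm E0 nrm0 expr0n.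
have I0' h : inner A (fun x => h x - h x) (fun x => h x - h x) = 0.
  by rewrite (_ : (fun x => h x - h x) = fun=> 0)//; apply/funext => x; rewrite subrr.
rewrite I0' addr0 /innermx big1 ?exprn_gt0// => i _; rewrite big1// => j _.
rewrite (_ : (fun x => _) = fun=> 0) ?I0//.
by apply/funext => x; rewrite subrr mxE.
Qed.

Section partition.
Variables (N : nat) (Omega : set 'rV[R]_d) (T : 'I_N -> set 'rV[R]_d).
Hypotheses (mT : forall i, measurable (T i)) (TO : forall i, T i `<=` Omega)
  (dT : forall i j, i != j -> T i `&` T j = set0)
  (cT : {ae mu, forall x, Omega x -> exists i, T i x}).

Lemma disjoint_index i j x : T i x -> T j x -> i = j.
Proof.
move=> Ti Tj; apply/eqP; apply: contrapT => /negP/dT H.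
by have : (T i `&` T j) x by []; rewrite H.
Qed.

Lemma ext_partition f : {ae mu, forall x, ext Omega f x = \sum_i ext (T i) f x}.
Proof.
apply: filterS cT => x Hx; have [Ox|Ox] := pselect (Omega x); last first.
  by rewrite ext_out// big1// => i _; rewrite ext_out// => /TO.
have [i Ti] := Hx Ox; rewrite (bigD1 i)//= big1 ?addr0 => [|j ji].
  by rewrite !ext_in.
by rewrite ext_out// => Tj; move: ji; rewrite (disjoint_index Tj Ti) eqxx.
Qed.

Lemma inner_partition f g : L2 Omega f -> L2 Omega g ->
  inner Omega f g = \sum_i inner (T i) f g.
Proof.
move=> /L2_sqint sf /L2_sqint sg.
have sfi i : sqint mu (ext (T i) f) := sqint_ext_sub (mT i) (@TO i) sf.
have sgi i : sqint mu (ext (T i) g) := sqint_ext_sub (mT i) (@TO i) sg.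
rewrite innerE (ae_eq_ip sf (sqint_sum _ sfi) sg (ext_partition f)).
rewrite /ip (@eq_Rintegral _ _ _ _ _ (fun x => \sum_i (ext (T i) f x * ext (T i) g x))); last first.
  move=> x _; rewrite mulr_suml; apply: eq_bigr => i _.
  have [Ti|Ti] := pselect (T i x); last by rewrite !(@ext_out _ _ (T i))// !mul0r.
  by rewrite (ext_in g (TO Ti)) (ext_in g Ti).
rewrite Rintegral_sum_fin => [|i]; last exact: sqintM.
by apply: eq_bigr => i _; rewrite innerE.
Qed.

Lemma innermx_partition G H : L2mx Omega G -> L2mx Omega H ->
  innermx Omega G H = \sum_i innermx (T i) G H.
Proof.
move=> LG LH; rewrite [RHS]exchange_big; apply: eq_bigr => i _.
rewrite [RHS]exchange_big; apply: eq_bigr => j _.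
exact: inner_partition.
Qed.

End partition.

End restriction.

(** * Lipschitz boundaries *)

Section lipschitz_domains.
Context {R : realType} {d : nat}.
Local Notation mu := (lebesgue_rV R d).
Implicit Types (A K : set 'rV[R]_d) (x y b : 'rV[R]_d).

Lemma compact_ball_cover K (P : 'rV[R]_d -> R -> Prop) : compact K ->
  (forall x, K x -> exists2 r : R, 0 < r & P x r) ->
  exists s : seq ('rV[R]_d * R),
    (forall p, p \in s -> 0 < p.2 /\ P p.1 p.2) /\
    (forall y, K y -> exists2 p, p \in s & `|y - p.1| < p.2).
Proof.
move=> cK HP.
have /choice[r Hr] : forall x, exists r : R, K x -> 0 < r /\ P x r.
  move=> x; have [Kx|Kx] := pselect (K x); last by exists 0.
  by have [r r0 Pr] := HP x Kx; exists r.
move: cK; rewrite compact_cover => /(_ _ K (fun x => ball x (r x))) [].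
- by move=> x _; exact: ball_open.
- by move=> x Kx; exists x => //; apply: ballxx; have [] := Hr x Kx.
move=> D DK KD; exists [seq (x, r x) | x <- finmap.enum_fset D]; split.
  by move=> p /mapP[x xD ->] /=; apply: Hr; have := DK x xD; rewrite inE.
move=> y /KD[x /= xD]; rewrite ball_rVE distrC => xy.
by exists (x, r x) => //; apply/mapP; exists x.
Qed.

Lemma negligible_seq (I : eqType) (s : seq I) (F : I -> set 'rV[R]_d) :
  (forall p, p \in s -> mu.-negligible (F p)) ->
  mu.-negligible [set y | exists2 p, p \in s & F p y].
Proof.
elim: s => [|p s IH] HF.
  by rewrite (_ : mkset _ = set0); [exact: negligible_set0|apply/seteqP; split => // y []].
apply: (@negligibleS _ _ _ _ (F p `|` [set y | exists2 p, p \in s & F p y])).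
  by move=> y [q]; rewrite inE => /orP[/eqP -> ?|qs Fq]; [left|right; exists q].
apply: negligibleU; first by apply: HF; rewrite inE eqxx.
by apply: IH => q qs; apply: HF; rewrite inE qs orbT.
Qed.

Lemma mulmx_bound m (x : 'rV[R]_d) (M : 'M[R]_(d, m)) :
  `|x *m M| <= (\sum_i \sum_j `|M i j|) * `|x|.
Proof.
have S0 : 0 <= (\sum_i \sum_j `|M i j|) by apply: sumr_ge0 => i _; apply: sumr_ge0.
apply: norm_rV_leP => [|j]; first by rewrite mulr_ge0.
rewrite mxE; apply: le_trans (ler_norm_sum _ _ _) _.
rewrite mulr_suml; apply: ler_sum => i _; rewrite normrM mulrC ler_pM//.
  by rewrite (bigD1 j)//= lerDl; apply: sumr_ge0.
exact: ler_norm_coord.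
Qed.

Lemma mulmx_rV_continuous m (M : 'M[R]_(d, m)) : continuous (fun x : 'rV[R]_d => x *m M).
Proof.
move=> x; apply/(@cvgrPdist_lt _ _ _ (nbhs x) (nbhs_filter x)) => e e0.
pose S := \sum_i \sum_j `|M i j|.
have S0 : 0 <= S by apply: sumr_ge0 => i _; apply: sumr_ge0.
have S1 : 0 < S + 1 by rewrite ltr_wpDl.
apply/nbhs_ballP; exists (e / (S + 1)) => /=; first by rewrite divr_gt0.
move=> y; rewrite ball_rVE ltr_pdivlMr// -mulmxBl => H.
apply: le_lt_trans (mulmx_bound _ _) (le_lt_trans _ H).
by rewrite mulrC ler_wpM2l// lerDl.
Qed.

Section chart.
Variables (P : 'M[R]_(d, d.-1)) (e : 'cV[R]_d) (g : 'rV[R]_d.-1 -> R) (k : R).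
Hypotheses (ee : e^T *m e = 1%:M) (Pe : P^T *m e = 0) (gk : k.-lipschitz g).

Let v : 'rV[R]_d := e^T.

Lemma chart_shiftP y (t : R) : (y + t *: v) *m P = y *m P.
Proof.
by rewrite mulmxDl -scalemxAl /v -[e^T *m P]trmxK trmx_mul trmxK Pe trmx0 scaler0 addr0.
Qed.

Lemma chart_shifte y (t : R) : ((y + t *: v) *m e) ord0 ord0 = (y *m e) ord0 ord0 + t.
Proof. by rewrite mulmxDl -scalemxAl /v ee !mxE eqxx mulr1. Qed.

Lemma chart_lipschitz (x y : 'rV[R]_d.-1) : `|g x - g y| <= `|k| * `|x - y|.
Proof.
apply: (@le_trans _ _ (k * `|x - y|)); first by have /= := gk; move=> /(_ (x, y)); apply.
by rewrite ler_wpM2r// ler_norm.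
Qed.

Lemma chart_continuous : continuous g.
Proof.
move=> x; apply/(@cvgrPdist_lt _ _ _ (nbhs x) (nbhs_filter x)) => eps e0.
have S1 : 0 < `|k| + 1 by rewrite ltr_wpDl.
apply/nbhs_ballP; exists (eps / (`|k| + 1)) => /=; first by rewrite divr_gt0.
move=> y; rewrite ball_rVE ltr_pdivlMr// => H.
apply: le_lt_trans (chart_lipschitz _ _) (le_lt_trans _ H).
by rewrite mulrC ler_wpM2l// lerDl.
Qed.

Definition chart_height y : R := (y *m e) ord0 ord0 - g (y *m P).

Lemma chart_height_continuous : continuous chart_height.
Proof.
move=> x; apply: (@continuousB _ _ _ (fun y => (y *m e) ord0 ord0) (fun y => g (y *m P))).
  apply: (@continuous_comp _ _ _ (fun y : 'rV[R]_d => y *m e) (fun u : 'rV[R]_1 => u ord0 ord0)).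
    exact: mulmx_rV_continuous.
  exact: coord_continuous.
apply: (@continuous_comp _ _ _ (fun y : 'rV[R]_d => y *m P) g); first exact: mulmx_rV_continuous.
exact: chart_continuous.
Qed.

(** The translates of a graph along its vertical axis are disjoint and have equal
    measures, while infinitely many of them fit in a bounded set. *)
Lemma chart_graph_null x (r : R) :
  mu ([set y | chart_height y = 0] `&` ball x r) = 0.
Proof.
set S := _ `&` _.
have mS : measurable S.
  apply: measurableI; last by apply: open_rV_measurable; exact: ball_open.
  apply: closed_rV_measurable.
  have -> : [set y | chart_height y = 0] = chart_height @^-1` [set 0] by [].
  apply: preimage_closed => [y _|]; last exact: closed_eq.
  exact: chart_height_continuous.
pose M := `|x| + `|r| + `|v|.
have SM y : S y -> `|y| <= `|x| + `|r|.
  move=> [_]; rewrite ball_rVE => xy; have := ler_normB x (x - y); rewrite subKr.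
  have := ler_norm r; lra.
have fS : (mu S < +oo)%E by exact: lebesgue_bounded_lty SM mS.
pose t (i : nat) : R := i.+1%:R^-1.
have t01 i : 0 < t i <= 1 by rewrite /t invr_gt0 ltr0n /= invf_le1// ler1n.
pose F i y : R := \1_S (y + t i *: v).
have IS := integrable_indic_bounded SM mS.
have IF i : mu.-integrable setT (EFin \o F i) := integrable_shift _ IS.
pose B := [set y : 'rV[R]_d | `|y| <= M].
have mB : measurable B by exact: measurable_le_ball.
have IB : mu.-integrable setT (EFin \o \1_B) by apply: (@integrable_indic_bounded _ _ _ M).
have FB n y : \sum_(i < n) F i y <= \1_B y.
  have [yB|yB] := pselect (B y); last first.
    rewrite indicE memNset// big1// => i _; rewrite /F indicE memNset// => /SM ySM.
    apply: yB; rewrite /B/=; have := ler_normB (y + t i *: v) (t i *: v); rewrite addrK.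
    have : `|t i *: v| <= `|v|.
      by rewrite normrZ; have /andP[? ?] := t01 i; rewrite gtr0_norm// ler_piMl.
    by move: ySM; rewrite /M; lra.
  rewrite indicE mem_set//=.
  have [[i Si]|Hn] := pselect (exists i : 'I_n, S (y + t i *: v)); last first.
    rewrite big1 ?ler01// => i _; rewrite /F indicE memNset// => Si.
    by apply: Hn; exists i.
  rewrite (bigD1 i)//= big1 ?addr0 => [|j ji].
    by rewrite /F indicE; case: (_ \in _).
  rewrite /F indicE memNset// => Sj; move/eqP: ji; apply.
  have [+ _] := Si; have [+ _] := Sj; rewrite /= /chart_height !chart_shifte !chart_shiftP => E1 E2.
  have : t j = t i by lra.
  by move=> /invr_inj/eqP; rewrite eqr_nat eqSS => /eqP ?; exact: val_inj.
(* At most one of the translates F i contains a given point. *)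
have key n : n%:R * fine (mu S) <= fine (mu B).
  rewrite -!Rintegral_indic//.
  have : \int[mu]_y \sum_(i < n) F i y <= \int[mu]_y \1_B y.
    by apply: le_Rint => //; exact: integrable_sum_fin.
  rewrite Rintegral_sum_fin// (eq_bigr (fun=> \int[mu]_y \1_S y)) => [|i _].
    by rewrite sumr_const card_ord mulr_natl.
  exact: (Rintegral_shift _ IS).
have m0 : 0 <= fine (mu S) by exact: fine_ge0.
have : fine (mu S) = 0.
  apply/eqP; rewrite eq_le m0 andbT leNgt; apply/negP => mS0.
  have b0 : 0 <= fine (mu B) by exact: fine_ge0.
  have := archi_boundP (divr_ge0 b0 m0); rewrite ltr_pdivrMr// ltNge => /negP; apply.
  exact: key.
move=> H; have : mu S \is a fin_num by rewrite ge0_fin_numE.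
by move=> /fineK <-; rewrite H.
Qed.

End chart.

(** By compactness finitely many charts suffice, and in a chart the boundary lies on
    the graph: a point strictly above it is in the set, and a point strictly below
    it has a neighbourhood disjoint from the set. *)
Lemma lipschitz_boundary_null A : open A -> bounded_set A -> lipschitz_boundary A ->
  mu.-negligible (closure A `\` A).
Proof.
move=> oA bA HA.
have kA : compact (closure A `\` A).
  apply: subclosed_compact (compact_closure_bounded bA) _; last by move=> x [].
  by apply: closedI; [exact: closed_closure|exact: open_closedC].
pose Bd := closure A `\` A.
have [x Bx|s [sP sC]] := @compact_ball_cover Bd (fun x r => mu.-negligible (Bd `&` ball x r)) kA.
  have : (closure A `\` A°) x by rewrite ((interior_id _).1 oA).
  move=> /HA[r [k [P [e [g [r0 [_ ee Pe] gk E]]]]]].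
  exists r => //.
  apply: (@negligibleS _ _ _ _ ([set y | chart_height P e g y = 0] `&` ball x r)); last first.
    apply/negligibleP; last exact: chart_graph_null ee Pe gk x r.
    apply: measurableI; last by apply: open_rV_measurable; exact: ball_open.
    apply: closed_rV_measurable.
    have -> : [set y | chart_height P e g y = 0] = chart_height P e g @^-1` [set 0] by [].
    apply: preimage_closed => [y _|]; last exact: closed_eq.
    exact: (@chart_height_continuous P e g k gk y).
  move=> y [[cAy nAy] yr]; split => //=.
  apply/eqP; rewrite eq_le; apply/andP; split.
    rewrite leNgt; apply/negP => h0.
    have : (A `&` ball x r) y by rewrite E; split => //=; move: h0; rewrite /chart_height subr_gt0.
    by case.
  rewrite leNgt; apply/negP => h0.
  have : nbhs y ([set u | chart_height P e g u < 0] `&` ball x r).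
    apply: open_nbhs_nbhs; split; last by split.
    apply: openI; last exact: ball_open.
    apply: (@open_comp _ _ (chart_height P e g) [set u | u < 0]); last exact: open_lt.
    by move=> u _; exact: (@chart_height_continuous P e g k gk u).
  move=> /cAy[u [Au [/= hu ur]]].
  have : ([set y | g (y *m P) < (y *m e) ord0 ord0] `&` ball x r) u by rewrite -E; split.
  by move=> [/= gu _]; move: hu; rewrite /chart_height subr_lt0 ltNge (ltW gu).
apply: (@negligibleS _ _ _ _ [set y | exists2 p, p \in s & (Bd `&` ball p.1 p.2) y]).
  move=> y By; have [p ps yp] := sC y By; exists p => //; split => //.
  by rewrite ball_rVE distrC.
by apply: negligible_seq => p /sP[].
Qed.

(** In a chart the set lies above a Lipschitz graph, so that a vertical move by t
    ends above the graph in spite of a displacement b that is small compared to t. *)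
Lemma lipschitz_inward A x : open A -> lipschitz_boundary A -> closure A x ->
  exists2 r : R, 0 < r & exists (v : 'rV[R]_d) (C : R), 0 < C /\
    forall y b (t : R), A y -> `|y - x| < r -> 0 < t -> C * `|b| < t ->
      `|y + b + t *: v - x| < r -> A (y + b + t *: v).
Proof.
move=> oA HA cAx; have [Ax|Ax] := pselect (A x).
  move: (oA); rewrite openE => /(_ x Ax)/nbhs_ballP[r /= r0 xrA].
  exists r => //; exists 0, 1; split => // y b t _ _ _ _ ybr.
  by apply: xrA; rewrite ball_rVE distrC.
have : (closure A `\` A°) x by rewrite ((interior_id _).1 oA).
move=> /HA[r [k [P [e [g [r0 [_ ee Pe] gk E]]]]]].
exists r => //; exists e^T.
pose S m (M : 'M[R]_(d, m)) := \sum_i \sum_j `|M i j|.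
have S0 m (M : 'M[R]_(d, m)) : 0 <= S m M by apply: sumr_ge0 => i _; apply: sumr_ge0.
(* The displacement b changes the height y e by at most S e |b| and the value of g at y P
   by at most |k| S P |b|; the term 1 makes C positive. *)
exists (`|k| * S _ P + S _ e + 1); split.
  by rewrite ltr_wpDl// addr_ge0// mulr_ge0.
move=> y b t Ay yx t0 Cbt wr.
have : (A `&` ball x r) y by split => //; rewrite ball_rVE distrC.
rewrite E => -[/= gy _].
suff : ([set y | g (y *m P) < (y *m e) ord0 ord0] `&` ball x r) (y + b + t *: e^T).
  by rewrite -E => -[].
split => /=; last by rewrite ball_rVE distrC.
rewrite (chart_shiftP Pe) (chart_shifte ee) !mulmxDl [X in _ < X + t]mxE.
have H1 : `|(b *m e) ord0 ord0| <= S _ e * `|b|.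
  by apply: le_trans (ler_norm_coord _ _) _; exact: mulmx_bound.
have H2 : `|g (y *m P + b *m P) - g (y *m P)| <= `|k| * (S _ P * `|b|).
  have := chart_lipschitz gk (y *m P + b *m P) (y *m P); rewrite addrAC subrr add0r => H.
  apply: le_trans H _; apply: ler_wpM2l; first exact: normr_ge0.
  exact: mulmx_bound.
have b0 := normr_ge0 b.
move: H1 H2; rewrite !ler_norml => /andP[H1 _] /andP[_ H2].
move: Cbt; rewrite !mulrDl mul1r -mulrA; lra.
Qed.

End lipschitz_domains.

(** * Density of test functions in Lipschitz domains *)

Section partition_of_unity.
Context {R : realType} {d : nat}.
Local Notation mu := (lebesgue_rV R d).
Implicit Types (f g chi : 'rV[R]_d -> R) (x y h c : 'rV[R]_d).

Lemma finite_radius (I : finType) (P : I -> R -> Prop) :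
  (forall i r r', P i r -> r' <= r -> P i r') ->
  (forall i, exists2 r : R, 0 < r & P i r) -> exists2 r : R, 0 < r & forall i, P i r.
Proof.
move=> mP HP; have /choice[r Hr] : forall i, exists r : R, 0 < r /\ P i r.
  by move=> i; have [r r0 Pr] := HP i; exists r.
exists (\big[Order.min/1]_i r i).
  by apply: lt_bigmin => // i _; have [] := Hr i.
by move=> i; apply: mP (Hr i).2 _; exact: bigmin_le_cond.
Qed.

(** Mollifying the indicator of a ball of intermediate radius. *)
Lemma cutoff c (a b : R) : 0 < a -> a < b -> exists chi, [/\ csmooth chi,
  forall x, `|x - c| < a -> chi x = 1 & forall x, b < `|x - c| -> chi x = 0].
Proof.
move=> a0 ab; pose m := (a + b) / 2; pose h := (b - a) / 2.
have h0 : 0 < h by rewrite /h divr_gt0// subr_gt0.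
have [rho [cr r0 r1 rr]] := mollifier_exists (d := d) h0.
pose E := [set x : 'rV[R]_d | `|x - c| < m].
have EM x : E x -> `|x| <= m + `|c|.
  by rewrite /E /= => xm; have := ler_normD (x - c) c; rewrite subrK; lra.
have mE : measurable E.
  apply: open_rV_measurable; have -> : E = ball c m.
    by apply/funext => x; rewrite ball_rVE distrC.
  exact: ball_open.
have sE : sqint mu \1_E by exact: sqint_indic mE EM.
exists (conv \1_E rho); split.
- split; first exact: conv_smooth.
  apply: conv_bounded_support (proj2 cr); exists (m + `|c|) => x mx.
  by rewrite indicE memNset// => /EM; rewrite leNgt mx.
- move=> x xa; rewrite /conv /ip -r1 -(Rintegral_shift (- x) (csmooth_integrable cr)).
  apply: eq_Rintegral => y _; have [yx|yx] := leP `|y - x| h; last by rewrite rr// mulr0.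
  rewrite indicE mem_set ?mul1r// /E /=; have := ler_normD (y - x) (x - c).
  by rewrite addrA subrK; move: yx xa; rewrite /h /m; lra.
- move=> x bx; apply: conv_eq0 rr _ => y yx; rewrite indicE memNset// /E /= => yc.
  have := ler_normB (y - c) (y - x); rewrite opprB addrC addrA subrK.
  by move: yx yc bx; rewrite /h /m; lra.
Qed.

(** Balls of radii r, 2r, 3r around the same centers are used below: the first ones
    cover the closed domain, the second ones a neighbourhood of it, the third ones
    contain the supports. If f is a cutoff for the first ball, the functions of the
    other balls are multiplied by 1 - f, so that the sum is f + (1 - f) wherever the
    remaining ones sum to 1. *)
Lemma partition_of_unity (s : seq ('rV[R]_d * R)) : (forall p, p \in s -> 0 < p.2) ->
  exists chi : nat -> 'rV[R]_d -> R, [/\ forall k, csmooth (chi k),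
    forall k x, (k < size s)%N -> 3 * (nth (0, 0) s k).2 < `|x - (nth (0, 0) s k).1| ->
      chi k x = 0 &
    forall x, (exists2 p, p \in s & `|x - p.1| < 2 * p.2) ->
      \sum_(k < size s) chi k x = 1].
Proof.
elim: s => [|p s IH] sP.
  by exists (fun _ _ => 0); split => [k|//|x []//]; exact: csmooth0.
have [q qs|chi [cchi chi0 chi1]] := IH; first by apply: sP; rewrite inE qs orbT.
have p0 : 0 < p.2 by apply: sP; rewrite inE eqxx.
have [f [cf f1 f0]] := @cutoff p.1 (2 * p.2) (3 * p.2) ltac:(lra) ltac:(lra).
exists (fun k x => if k is k'.+1 then (1 - f x) * chi k' x else f x); split.
- case=> [//|k]; apply: csmoothMl (cchi k); apply: smoothB (proj1 cf); exact: smooth_cst.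
- case=> [|k] x /=; first by move=> _; exact: f0.
  by rewrite ltnS => ks /(chi0 k x ks) ->; rewrite mulr0.
- move=> x [q]; rewrite inE => qs xq; rewrite /= big_ord_recl/= -mulr_sumr.
  have [xp|xp] := ltP `|x - p.1| (2 * p.2); first by rewrite f1// subrr mul0r addr0.
  rewrite chi1 ?mulr1 ?subrKC//; exists q => //.
  by case/orP: qs => // /eqP qp; move: xq; rewrite qp ltNge xp.
Qed.

End partition_of_unity.

Section hessian_norm.
Context {R : realType} {d : nat}.
Local Notation mu := (lebesgue_rV R d).
Implicit Types (f g chi : 'rV[R]_d -> R) (x y h c : 'rV[R]_d) (i j : 'I_d).

Definition nrm_d2 i j f : R := nrm mu (partial i (partial j f)).

Lemma sqint_partial2 f i j : csmooth f -> sqint mu (partial i (partial j f)).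
Proof. by move=> cf; apply: (csmooth_sqint (csmooth_partial i (csmooth_partial j cf))). Qed.

Lemma nrm_d2_ge0 i j f : 0 <= nrm_d2 i j f.
Proof. exact: nrm_ge0. Qed.

Lemma nrm_d2_dist i j f g k : csmooth f -> csmooth g -> csmooth k ->
  nrm_d2 i j (fun x => f x - k x) <= nrm_d2 i j (fun x => f x - g x) + nrm_d2 i j (fun x => g x - k x).
Proof.
move=> cf cg ck; rewrite /nrm_d2 (partial2B i j (proj1 cf) (proj1 ck)).
rewrite (partial2B i j (proj1 cf) (proj1 cg)) (partial2B i j (proj1 cg) (proj1 ck)).
exact: (nrm_dist (sqint_partial2 i j cf) (sqint_partial2 i j cg) (sqint_partial2 i j ck)).
Qed.

Lemma nrm_d2BC i j f g : csmooth f -> csmooth g ->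
  nrm_d2 i j (fun x => f x - g x) = nrm_d2 i j (fun x => g x - f x).
Proof.
move=> cf cg; rewrite /nrm_d2 (partial2B i j (proj1 cf) (proj1 cg)).
rewrite (partial2B i j (proj1 cg) (proj1 cf)); exact: nrmBC.
Qed.

Lemma nrm_d2_sum i j n (F : 'I_n -> 'rV[R]_d -> R) : (forall k, csmooth (F k)) ->
  nrm_d2 i j (fun x => \sum_k F k x) <= \sum_k nrm_d2 i j (F k).
Proof.
move=> cF; rewrite /nrm_d2 partial2_sum; last by move=> k; exact: (proj1 (cF k)).
exact: (nrm_sum _ (fun k => sqint_partial2 i j (cF k))).
Qed.

Lemma nrm_d2_shift i j f h : csmooth f -> nrm_d2 i j (fun x => f (x + h)) = nrm_d2 i j f.
Proof.
move=> cf; rewrite /nrm_d2 (partial_shift f j h) (partial_shift (partial j f) i h).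
exact: (nrm_shift h (sqint_partial2 i j cf)).
Qed.

Lemma nrm_d2_translation i j f h : csmooth f ->
  nrm_d2 i j (fun x => f (x + h) - f x) =
  nrm mu (fun x => partial i (partial j f) (x + h) - partial i (partial j f) x).
Proof.
move=> cf; rewrite /nrm_d2 (partial2B i j (smooth_shift h (proj1 cf)) (proj1 cf)).
by rewrite (partial_shift f j h) (partial_shift (partial j f) i h).
Qed.

Lemma nrm_d2E i j f : nrm_d2 i j f = nrm mu (partial i (partial j f)).
Proof. by []. Qed.

Opaque nrm_d2.

Lemma eq_sum2 (I J : finType) (F G : I -> J -> R) : F =2 G ->
  \sum_i \sum_j F i j = \sum_i \sum_j G i j.
Proof. by move=> H; apply: eq_bigr => i _; apply: eq_bigr => j _; exact: H. Qed.

(** First derivatives are left out: [nrm_partial_le_sobolev2] recovers them. *)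
Definition sobolev2 f : R := nrm mu f + \sum_i \sum_j nrm_d2 i j f.

Lemma sum_nrm_d2_ge0 f : 0 <= \sum_i \sum_j nrm_d2 i j f.
Proof. by apply: sumr_ge0 => i _; apply: sumr_ge0 => j _; exact: nrm_d2_ge0. Qed.

Lemma nrm_le_sobolev2 f : nrm mu f <= sobolev2 f.
Proof. by rewrite lerDl sum_nrm_d2_ge0. Qed.

Lemma sobolev2_ge0 f : 0 <= sobolev2 f.
Proof. by apply: le_trans (nrm_ge0 _ _) (nrm_le_sobolev2 f). Qed.

Lemma le_sum2 (F : 'I_d -> 'I_d -> R) i j : (forall i j, 0 <= F i j) ->
  F i j <= \sum_i \sum_j F i j.
Proof.
move=> F0; rewrite (bigD1 i)//= (bigD1 j)//= -addrA lerDl addr_ge0//.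
  by apply: sumr_ge0 => j' _.
by apply: sumr_ge0 => i' _; apply: sumr_ge0 => j' _.
Qed.

Lemma nrm_add_d2_le_sobolev2 f i j : nrm mu f + nrm_d2 i j f <= sobolev2 f.
Proof. by rewrite /sobolev2 lerD2l; apply: (@le_sum2 (fun i j => nrm_d2 i j f)) => *; exact: nrm_d2_ge0. Qed.

Lemma nrm_d2_le_sobolev2 f i j : nrm_d2 i j f <= sobolev2 f.
Proof. by apply: le_trans (nrm_add_d2_le_sobolev2 f i j); rewrite lerDr nrm_ge0. Qed.

Lemma nrm_partial_le_sobolev2 f i : csmooth f -> nrm mu (partial i f) <= sobolev2 f.
Proof. by move=> cf; apply: le_trans (nrm_partial_le i cf) (nrm_add_d2_le_sobolev2 f i i). Qed.

Lemma sobolev2_dist f g k : csmooth f -> csmooth g -> csmooth k ->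
  sobolev2 (fun x => f x - k x) <= sobolev2 (fun x => f x - g x) + sobolev2 (fun x => g x - k x).
Proof.
move=> cf cg ck; rewrite /sobolev2 addrACA; apply: lerD.
  exact: (nrm_dist (csmooth_sqint cf) (csmooth_sqint cg) (csmooth_sqint ck)).
rewrite -big_split; apply: ler_sum => i _; rewrite -big_split; apply: ler_sum => j _ /=.
exact: nrm_d2_dist.
Qed.

Lemma sobolev2BC f g : csmooth f -> csmooth g ->
  sobolev2 (fun x => f x - g x) = sobolev2 (fun x => g x - f x).
Proof.
move=> cf cg; have H i j := nrm_d2BC i j cf cg.
exact: (congr2 +%R (nrmBC mu f g) (eq_sum2 H)).
Qed.

Lemma sobolev2_sum n (F : 'I_n -> 'rV[R]_d -> R) : (forall k, csmooth (F k)) ->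
  sobolev2 (fun x => \sum_k F k x) <= \sum_k sobolev2 (F k).
Proof.
move=> cF; rewrite /sobolev2 big_split; apply: lerD.
  exact: (nrm_sum _ (fun k => csmooth_sqint (cF k))).
rewrite [leRHS]exchange_big; apply: ler_sum => i _.
rewrite [leRHS]exchange_big; apply: ler_sum => j _ /=.
exact: nrm_d2_sum.
Qed.

Lemma sobolev2_shift f h : csmooth f -> sobolev2 (fun x => f (x + h)) = sobolev2 f.
Proof.
move=> cf; have H i j := nrm_d2_shift i j h cf.
exact: (congr2 +%R (nrm_shift h (csmooth_sqint cf)) (eq_sum2 H)).
Qed.

Lemma nrm_boundedM f g (C : R) : sqint mu g -> measurable_fun setT f ->
  (forall x, `|f x| <= C) -> nrm mu (fun x => f x * g x) <= C * nrm mu g.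
Proof.
move=> sg mf fC; have C0 : 0 <= C by apply: le_trans (fC 0).
have <- : nrm mu (fun x => C * g x) = C * nrm mu g by rewrite nrmZ// ger0_norm.
have H x : `|f x * g x| <= `|C * g x| by rewrite !normrM (ger0_norm C0) ler_wpM2r.
have sfg := sqint_le (measurable_funM mf (sqint_meas sg)) (sqintZ C sg) H.
exact: nrm_le sfg (sqintZ C sg) H.
Qed.

Lemma sobolev2M chi : csmooth chi -> exists2 K : R, 0 <= K &
  forall f, csmooth f -> sobolev2 (fun x => chi x * f x) <= K * sobolev2 f.
Proof.
move=> cc; have [C0 C00 HC0] := csmooth_bounded cc.
have /choice[C HC] : forall p : 'I_d * 'I_d, exists C : R, 0 <= C /\ forall f, csmooth f ->
    nrm_d2 p.1 p.2 (fun x => chi x * f x) <= C * sobolev2 f.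
  move=> [i j] /=; have [Ci Ci0 HCi] := csmooth_bounded (csmooth_partial i cc).
  have [Cj Cj0 HCj] := csmooth_bounded (csmooth_partial j cc).
  have [Cij Cij0 HCij] := csmooth_bounded (csmooth_partial i (csmooth_partial j cc)).
  exists (C0 + Ci + (Cj + Cij)); split; first by rewrite !addr_ge0.
  move=> f cf; rewrite nrm_d2E (partial2M i j (proj1 cc) (proj1 cf)).
  have sM g k : csmooth g -> csmooth k -> sqint mu (fun x => g x * k x).
    by move=> cg ck; apply: csmooth_sqint; apply: csmoothMr cg (proj1 ck).
  have mM g k (B : R) : csmooth g -> csmooth k -> 0 <= B -> (forall x, `|g x| <= B) ->
      nrm mu k <= sobolev2 f -> nrm mu (fun x => g x * k x) <= B * sobolev2 f.
    move=> cg ck B0 gB kf; apply: le_trans (nrm_boundedM _ (smooth_measurable (proj1 cg)) gB) _.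
      exact: csmooth_sqint.
    exact: ler_wpM2l.
  have ci := csmooth_partial i cc; have cj := csmooth_partial j cc.
  have cij := csmooth_partial i cj.
  have fi := csmooth_partial i cf; have fj := csmooth_partial j cf.
  have fij := csmooth_partial i fj.
  rewrite !mulrDl.
  apply: le_trans (nrmD (sqintD (sM _ _ cc fij) (sM _ _ ci fj))
    (sqintD (sM _ _ cj fi) (sM _ _ cf cij))) _.
  apply: lerD.
    apply: le_trans (nrmD (sM _ _ cc fij) (sM _ _ ci fj)) _; apply: lerD.
      by apply: mM cc fij C00 HC0 _; rewrite -nrm_d2E; exact: nrm_d2_le_sobolev2.
    exact: mM ci fj Ci0 HCi (nrm_partial_le_sobolev2 j cf).
  apply: le_trans (nrmD (sM _ _ cj fi) (sM _ _ cf cij)) _; apply: lerD.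
    exact: mM cj fi Cj0 HCj (nrm_partial_le_sobolev2 i cf).
  have -> : (fun x => f x * partial i (partial j chi) x) =
    (fun x => partial i (partial j chi) x * f x) by apply/funext => x; rewrite mulrC.
  exact: mM cij cf Cij0 HCij (nrm_le_sobolev2 f).
exists (C0 + \sum_i \sum_j C (i, j)).
  by rewrite addr_ge0//; apply: sumr_ge0 => i _; apply: sumr_ge0 => j _; case: (HC (i, j)).
move=> f cf; rewrite mulrDl; apply: lerD.
  apply: le_trans (nrm_boundedM (csmooth_sqint cf) (smooth_measurable (proj1 cc)) HC0) _.
  exact: (ler_wpM2l C00 (nrm_le_sobolev2 f)).
rewrite mulr_suml; apply: ler_sum => i _; rewrite mulr_suml; apply: ler_sum => j _.
exact: (HC (i, j)).2.
Qed.

Lemma sobolev2_le f (c : R) : nrm mu f <= c -> (forall i j, nrm_d2 i j f <= c) ->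
  sobolev2 f <= c * (1 + d%:R * d%:R).
Proof.
move=> fc hc; rewrite mulrDr mulr1; apply: lerD => //.
apply: (@le_trans _ _ (\sum_(i < d) \sum_(j < d) c)).
  by apply: ler_sum => i _; apply: ler_sum => j _; exact: hc.
by rewrite !sumr_const !card_ord -mulrnA -[_ *+ (d * d)]mulr_natr natrM.
Qed.

Lemma half_lt (r : R) : 0 < r -> r / 2 < r.
Proof. lra. Qed.

Lemma split3 (e : R) : e = e / 3 + (e / 3 + e / 3).
Proof. lra. Qed.

Lemma twice_quarter (a : R) : 2 * (a / 4) = a / 2.
Proof. lra. Qed.

Lemma dim_ge1 : 1 <= 1 + d%:R * d%:R :> R.
Proof. by rewrite lerDl mulr_ge0. Qed.

Lemma normalized_eps_sqr_lt (D eps : R) : 1 <= D -> 0 < eps -> (eps / (2 * D)) ^+ 2 * D < eps ^+ 2.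
Proof.
move=> D1 e0; have D0 : 0 < D by apply: lt_le_trans D1.
have -> : (eps / (2 * D)) ^+ 2 * D = eps ^+ 2 * (4 * D)^-1.
  by field; rewrite lt0r_neq0.
rewrite gtr_pMr ?exprn_gt0// invf_lt1 ?mulr_gt0//; lra.
Qed.

(** Distance bookkeeping, here and in the next two lemmas: ep is the radius of the
    mollification and r that of a ball of the cover. A support has radius at most 3r,
    translations have length at most r / 2, and everything stays in the ball of
    radius 4r where the chart is valid. *)
Lemma dist_center_source (ep r : R) (y w X : 'rV[R]_d) : 0 < ep -> 2 * ep <= r / 2 ->
  `|y - w| <= ep -> `|w - X| <= 3 * r -> `|y - X| < 4 * r.
Proof.
move=> e0 er yw wX; have := ler_normD (y - w) (w - X); rewrite addrA subrK; lra.
Qed.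

Lemma dist_center_target (ep r : R) (a b c : 'rV[R]_d) : 2 * ep <= r / 2 ->
  `|a| < ep -> `|b| <= r / 2 -> `|c| <= 3 * r -> `|a + b + c| < 4 * r.
Proof.
move=> er ha hb hc; have := ler_normD (a + b) c; have := ler_normD a b.
have := normr_ge0 a; lra.
Qed.

Lemma dist_center_cover (ep r : R) (y x p : 'rV[R]_d) : 0 < ep -> 2 * ep <= r / 2 ->
  `|y - x| <= ep -> `|y - p| < r -> `|x - p| < 2 * r.
Proof.
move=> e0 er yx yp; have := ler_normB (y - p) (y - x); rewrite opprB addrC addrA subrK; lra.
Qed.

Lemma dim_gt0 : 0 < 1 + d%:R * d%:R :> R.
Proof. by rewrite ltr_wpDr// mulr_ge0. Qed.

Lemma sobolev2_translation_continuous f : csmooth f -> forall e : R, 0 < e ->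
  exists2 r : R, 0 < r & forall h, `|h| < r -> sobolev2 (fun x => f (x + h) - f x) <= e.
Proof.
move=> cf e e0; pose c : R := e / (1 + d%:R * d%:R).
have c0 : 0 < c by rewrite divr_gt0// dim_gt0.
have [r1 r10 H1] := L2_translation_continuous (csmooth_sqint cf) (proj2 cf) c0.
pose P (p : 'I_d * 'I_d) (r : R) := forall h, `|h| < r ->
  nrm mu (fun x => partial p.1 (partial p.2 f) (x + h) - partial p.1 (partial p.2 f) x) <= c.
have [||r2 r20 H2] := @finite_radius R ('I_d * 'I_d)%type P.
- by move=> p r r' Pr r'r h hr; apply: Pr; exact: lt_le_trans r'r.
- move=> p; have cp := csmooth_partial p.1 (csmooth_partial p.2 cf).
  exact: (L2_translation_continuous (csmooth_sqint cp) (proj2 cp) c0).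
exists (Order.min r1 r2); first by rewrite lt_min r10.
move=> h; rewrite lt_min => /andP[h1 h2].
have -> : e = c * (1 + d%:R * d%:R) by rewrite divfK// lt0r_neq0// dim_gt0.
apply: sobolev2_le => [|i j]; first exact: (H1 h h1).
by rewrite (nrm_d2_translation i j h cf); exact: (H2 (i, j) h h2).
Qed.

End hessian_norm.

Section density.
Context {R : realType} {d : nat}.
Local Notation mu := (lebesgue_rV R d).
Variables (A : set 'rV[R]_d) (z : 'rV[R]_d -> R) (G : 'rV[R]_d -> 'M[R]_d).
Hypotheses (oA : open A) (bA : bounded_set A) (HA : lipschitz_boundary A)
  (Lz : L2 A z) (LG : L2mx A G)
  (HG : forall phi i j, smooth phi ->
    inner A z (partial i (partial j phi)) = inner A (fun x => G x i j) phi).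
Implicit Types (f g chi rho : 'rV[R]_d -> R) (x y h v : 'rV[R]_d) (i j : 'I_d).

Lemma ip_ext f g : ip mu (ext A f) g = inner A f g.
Proof.
rewrite innerE; apply: eq_Rintegral => x _.
by have [Ax|Ax] := pselect (A x); [rewrite (ext_in g Ax)|rewrite (ext_out f Ax) !mul0r].
Qed.

Let Z := ext A z.
Let Gx i j := ext A (fun x => G x i j).

Let sZ : sqint mu Z. Proof. exact/L2_sqint. Qed.
Let sG i j : sqint mu (Gx i j). Proof. by apply/L2_sqint; exact: LG. Qed.
Let bZ : bounded_support Z. Proof. exact: ext_bounded_support. Qed.
Let bG i j : bounded_support (Gx i j). Proof. exact: ext_bounded_support. Qed.

(** The kernel y |-> rho (y - x) is smooth on R^d but does not vanish near the
    boundary of A when x is close to it, which is why the hypothesis on z is needed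
    for all smooth functions and not only for test functions. *)
Lemma conv_ext_hess rho i j : csmooth rho ->
  partial i (partial j (conv Z rho)) = conv (Gx i j) rho.
Proof.
move=> cr; rewrite (conv_partial2 i j sZ cr); apply/funext => x.
rewrite /conv !ip_ext -(HG i j (smooth_shift (- x) (proj1 cr))).
by rewrite (partial_shift rho j (- x)) (partial_shift (partial j rho) i (- x)).
Qed.

Lemma csmooth_conv_ext (s : R) rho : mollifier s rho -> csmooth (conv Z rho).
Proof.
move=> [cr _ _ _]; split; first exact: (conv_smooth sZ cr).
exact: (conv_bounded_support bZ (proj2 cr)).
Qed.

Lemma conv_ext_approx (e : R) : 0 < e -> exists2 r : R, 0 < r &
  forall s rho, s < r -> mollifier s rho ->
    nrm mu (fun x => conv Z rho x - Z x) <= e /\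
    forall i j, nrm mu (fun x => partial i (partial j (conv Z rho)) x - Gx i j x) <= e.
Proof.
move=> e0; have [r1 r10 H1] := mollification sZ bZ e0.
pose P (p : 'I_d * 'I_d) (r : R) := forall (s : R) rho, s < r -> mollifier s rho ->
  nrm mu (fun x => conv (Gx p.1 p.2) rho x - Gx p.1 p.2 x) <= e.
have [||r2 r20 H2] := @finite_radius R ('I_d * 'I_d)%type P.
- by move=> p r r' Pr r'r s rho sr; apply: Pr; exact: lt_le_trans r'r.
- by move=> p; exact: (mollification (sG p.1 p.2) (bG p.1 p.2) e0).
exists (Order.min r1 r2); first by rewrite lt_min r10.
move=> s rho; rewrite lt_min => /andP[s1 s2] mr; split; first exact: (H1 s rho s1 mr).
have [cr _ _ _] := mr.
by move=> i j; rewrite (conv_ext_hess i j cr); exact: (H2 (i, j) s rho s2 mr).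
Qed.

Lemma conv_ext_cauchy (e : R) : 0 < e -> exists2 r : R, 0 < r &
  forall s s' rho rho', s < r -> s' < r -> mollifier s rho -> mollifier s' rho' ->
    sobolev2 (fun x => conv Z rho x - conv Z rho' x) <= e.
Proof.
move=> e0; pose c : R := e / (1 + d%:R * d%:R).
have c0 : 0 < c / 2 by rewrite divr_gt0// divr_gt0// dim_gt0.
have [r r0 H] := conv_ext_approx c0; exists r => // s s' rho rho' sr sr' mr mr'.
have [H1 H2] := H s rho sr mr; have [H1' H2'] := H s' rho' sr' mr'.
have cc := csmooth_conv_ext mr; have cc' := csmooth_conv_ext mr'.
have -> : e = c * (1 + d%:R * d%:R) by rewrite divfK// lt0r_neq0// dim_gt0.
apply: sobolev2_le => [|i j].
  apply: le_trans (nrm_dist (csmooth_sqint cc) sZ (csmooth_sqint cc')) _.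
  rewrite [c]splitr; apply: lerD; first exact: H1.
  by rewrite nrmBC; exact: H1'.
rewrite nrm_d2E (partial2B i j (proj1 cc) (proj1 cc')).
apply: le_trans (nrm_dist (sqint_partial2 i j cc) (sG i j) (sqint_partial2 i j cc')) _.
rewrite [c]splitr; apply: lerD; first exact: H2.
by rewrite nrmBC; exact: H2'.
Qed.

(** The mollification that is translated varies with s, while translations are only
    known to be continuous on a fixed function. So it is compared with a mollification
    of fixed radius, which is close to it by [conv_ext_cauchy]. *)
Lemma shifted_piece_approx chi v (e : R) : csmooth chi -> 0 < e ->
  exists2 r : R, 0 < r & forall (s t : R) rho, s < r -> mollifier s rho -> `|t| < r ->
    sobolev2 (fun x => chi (x + t *: v) * conv Z rho (x + t *: v) - chi x * conv Z rho x) <= e.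
Proof.
move=> cc e0; have [K K0 HK] := sobolev2M cc.
have e30 : 0 < e / 3 by rewrite divr_gt0.
have K1 : 0 < K + 1 by rewrite ltr_wpDl.
have [r1 r10 H1] := conv_ext_cauchy (divr_gt0 e30 K1).
have r120 : 0 < r1 / 2 by rewrite divr_gt0.
have [rd mrd] := mollifier_exists (d := d) r120.
have cd := csmooth_conv_ext mrd.
pose u x := chi x * conv Z rd x.
have cu : csmooth u := csmoothMr cc (proj1 cd).
have [r2 r20 H2] := sobolev2_translation_continuous cu e30.
have v1 : 0 < `|v| + 1 by rewrite ltr_wpDl.
exists (Order.min r1 (r2 / (`|v| + 1))); first by rewrite lt_min r10 divr_gt0.
move=> s t rho; rewrite lt_min => /andP[s1 _] mr; rewrite lt_min => /andP[_ t2].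
have cr := csmooth_conv_ext mr.
pose w x := chi x * conv Z rho x.
have cw : csmooth w := csmoothMr cc (proj1 cr).
have Hwu : sobolev2 (fun x => w x - u x) <= e / 3.
  have -> : (fun x => w x - u x) = (fun x => chi x * (conv Z rho x - conv Z rd x)).
    by apply/funext => x; rewrite /w /u mulrBr.
  apply: le_trans (HK _ (csmoothB cr cd)) _.
  have := H1 s (r1 / 2) rho rd s1 (half_lt r10) mr mrd; rewrite ler_pdivlMr// => H.
  apply: le_trans _ H; rewrite mulrC; apply: ler_wpM2l; first exact: sobolev2_ge0.
  by rewrite lerDl.
have tv : `|t *: v| < r2.
  rewrite normrZ; apply: le_lt_trans (_ : `|t| * (`|v| + 1) < r2).
    by apply: ler_wpM2l => //; rewrite lerDl.
  by rewrite -ltr_pdivlMr.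
have cwt := csmooth_shift (t *: v) cw; have cut := csmooth_shift (t *: v) cu.
apply: le_trans (sobolev2_dist cwt cut cw) _.
rewrite [leRHS]split3; apply: lerD.
  by rewrite (sobolev2_shift (t *: v) (csmoothB cw cu)).
apply: le_trans (sobolev2_dist cut cu cw) _; apply: lerD; first exact: (H2 _ tv).
by rewrite (sobolev2BC cu cw).
Qed.

Lemma weak_hessian_of_smooth : weak_hessian A z G.
Proof.
split=> // phi i j tphi.
by rewrite (HG i j (proj1 (test_function_csmooth tphi))).
Qed.

Let norm2_sub_le_entries (e : R) phi : test_function A phi -> 0 <= e ->
  nrm mu (fun x => Z x - phi x) <= e ->
  (forall i j, nrm mu (fun x => Gx i j x - partial i (partial j phi) x) <= e) ->
  norm2 A (z \- phi) ^+ 2 <= e ^+ 2 * (1 + d%:R * d%:R).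
Proof.
move=> tphi e0 H1 H2; have sphi := proj1 (test_function_csmooth tphi).
have wh := weak_hessianB Lz (L2_smooth oA bA sphi) weak_hessian_of_smooth
  (weak_hessian_smooth oA bA sphi).
rewrite (norm2_sqr oA bA wh) mulrDr mulr1; apply: lerD.
  rewrite inner_nrm extB (ext_test tphi).
  by rewrite (ler_pXn2r (isT : (0 < 2)%N)) ?nnegrE ?nrm_ge0.
apply: (@le_trans _ _ (\sum_(i < d) \sum_(j < d) e ^+ 2)); last first.
  by rewrite !sumr_const !card_ord -mulrnA -[_ *+ (d * d)]mulr_natr natrM.
apply: ler_sum => i _; apply: ler_sum => j _; rewrite inner_nrm.
have -> : ext A (fun x => (G x - smooth_hess phi x) i j) =
    fun x => Gx i j x - partial i (partial j phi) x.
  rewrite -(ext_test (test_function_partial i (test_function_partial j tphi))) -extB.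
  by apply: ext_eq => x _; rewrite !mxE.
by rewrite (ler_pXn2r (isT : (0 < 2)%N)) ?nnegrE ?nrm_ge0.
Qed.

(** The radii are a quarter of those of the charts, to leave room for the supports of
    the partition of unity, the mollification and the translation. *)
Let inward_cover : exists s : seq ('rV[R]_d * R),
  [/\ forall p, p \in s -> 0 < p.2,
      forall p, p \in s -> exists (v : 'rV[R]_d) (C : R), 0 < C /\
        forall y b t, A y -> `|y - p.1| < 4 * p.2 -> 0 < t -> C * `|b| < t ->
        `|y + b + t *: v - p.1| < 4 * p.2 -> A (y + b + t *: v) &
      forall y, closure A y -> exists2 p, p \in s & `|y - p.1| < p.2].
Proof.
have [x cx|s [sP sC]] := @compact_ball_cover _ _ (closure A) (fun x r =>
  exists (v : 'rV[R]_d) (C : R), 0 < C /\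
    forall y b t, A y -> `|y - x| < 4 * r -> 0 < t -> C * `|b| < t ->
    `|y + b + t *: v - x| < 4 * r -> A (y + b + t *: v)) (compact_closure_bounded bA).
  have [r r0 H] := lipschitz_inward oA HA cx.
  exists (r / 4); first by rewrite divr_gt0.
  by rewrite mulrC divfK.
by exists s; split => // p /sP[].
Qed.

(** The order of the choices matters: first the length t of the translations, small
    enough for the translated pieces to be close to the original ones, and then the
    mollification radius ep, small with respect to t. *)
Theorem weak_hessian_smooth_H20 : H20 A z.
Proof.
split; [exact: Lz|by exists G; exact: weak_hessian_of_smooth|] => eps eps0.
have [s [s0 sA sC]] := inward_cover.
have [chi [cchi chi0 chi1]] := partition_of_unity s0.
pose n := size s; pose X (k : 'I_n) := (nth (0, 0) s k).1.
pose r_ (k : 'I_n) := (nth (0, 0) s k).2.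
have ins (k : 'I_n) : nth (0, 0) s k \in s by exact: mem_nth.
have r_0 k : 0 < r_ k by exact: (s0 _ (ins k)).
have /choice[v Hv] : forall k : 'I_n, exists v : 'rV[R]_d, exists C : R, 0 < C /\
    forall y b t, A y -> `|y - X k| < 4 * r_ k -> 0 < t -> C * `|b| < t ->
      `|y + b + t *: v - X k| < 4 * r_ k -> A (y + b + t *: v).
  by move=> k; exact: (sA _ (ins k)).
have {}/choice[C HC] := Hv.
pose e : R := eps / (2 * (1 + d%:R * d%:R)).
have e0 : 0 < e by rewrite divr_gt0// mulr_gt0// dim_gt0.
have e20 : 0 < e / 2 by rewrite divr_gt0.
have n10 : 0 < n%:R + 1 :> R by rewrite ltr_wpDl.
pose e' := e / 2 / (n%:R + 1).
have e'0 : 0 < e' by rewrite divr_gt0.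
have [||r1 r10 Hr1] := @finite_radius R 'I_n (fun k r => 
  (forall (s t : R) rho, s < r -> mollifier s rho -> `|t| < r ->
    sobolev2 (fun x => chi k (x + t *: - v k) * conv Z rho (x + t *: - v k) -
      chi k x * conv Z rho x) <= e') /\ r * `|v k| <= r_ k / 2).
- move=> k r r' [H1 H2] r'r; split.
    by move=> s' t rho s'r mr tr; apply: H1 mr _; exact: lt_le_trans r'r.
  by apply: le_trans H2; apply: ler_wpM2r.
- move=> k; have [r r0 Hr] := shifted_piece_approx (- v k) (cchi k) e'0.
  have v1 : 0 < `|v k| + 1 by rewrite ltr_wpDl.
  have rk2 : 0 < r_ k / 2 by rewrite divr_gt0.
  exists (Order.min r (r_ k / 2 / (`|v k| + 1))); first by rewrite lt_min r0 divr_gt0.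
  split.
    move=> s' t rho; rewrite !lt_min => /andP[s'r _] mr /andP[tr _]; exact: Hr mr tr.
  apply: (@le_trans _ _ (r_ k / 2 / (`|v k| + 1) * `|v k|)).
    by apply: ler_wpM2r => //; rewrite ge_min lexx orbT.
  apply: (@le_trans _ _ (r_ k / 2 / (`|v k| + 1) * (`|v k| + 1))).
    by apply: ler_wpM2l; [exact: ltW (divr_gt0 _ _)|rewrite lerDl].
  by rewrite divfK// lt0r_neq0.
pose t := r1 / 2.
have t0 : 0 < t by rewrite divr_gt0.
have tr1 : t < r1 := half_lt r10.
have [||r2 r20 Hr2] := @finite_radius R 'I_n (fun k r => C k * (2 * r) < t /\ 2 * r <= r_ k / 2).
- move=> k r r' [H1 H2] r'r; have [C0 _] := HC k.
  have rr : 2 * r' <= 2 * r by apply: ler_wpM2l.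
  split; last exact: le_trans H2.
  by apply: le_lt_trans H1; apply: ler_wpM2l rr; exact: ltW.
- move=> k; have [C0 _] := HC k.
  exists (Order.min (t / C k / 4) (r_ k / 4)).
    by rewrite lt_min !divr_gt0.
  split.
    rewrite mulrC -ltr_pdivlMr//; apply: (@le_lt_trans _ _ (2 * (t / C k / 4))).
      by apply: ler_wpM2l => //; rewrite ge_min lexx.
    by rewrite twice_quarter; apply: half_lt; rewrite divr_gt0.
  apply: (@le_trans _ _ (2 * (r_ k / 4))).
    by apply: ler_wpM2l => //; rewrite ge_min lexx orbT.
  by rewrite twice_quarter.
have [r3 r30 Hr3] := conv_ext_approx e20.
pose ep := Order.min r1 (Order.min r2 r3) / 2.
have m0 : 0 < Order.min r1 (Order.min r2 r3) by rewrite !lt_min r10 r20.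
have ep0 : 0 < ep by rewrite divr_gt0.
have : ep < Order.min r1 (Order.min r2 r3) := half_lt m0.
rewrite !lt_min => /and3P[ep1 ep2 ep3].
have [rho mrho] := mollifier_exists (d := d) ep0.
have cz := csmooth_conv_ext mrho.
have zsupp x : conv Z rho x != 0 -> exists2 y, A y & `|y - x| <= ep.
  move=> /eqP zx; apply: contrapT => /forall2NP H; apply: zx.
  have [_ _ _ rr] := mrho; apply: (conv_eq0 rr) => y yx.
  by apply: ext_out => Ay; case: (H y).
pose tau (k : 'I_n) (x : 'rV[R]_d) := chi k (x + t *: - v k) * conv Z rho (x + t *: - v k).
have cck (k : 'I_n) : csmooth (fun x => chi k x * conv Z rho x) := csmoothMr (cchi k) (proj1 cz).
have ctau (k : 'I_n) : csmooth (tau k) := csmooth_shift (t *: - v k) (cck k).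
pose phi x := \sum_(k < n) tau k x.
have cphi : csmooth phi := csmooth_sum _ ctau.
have epk k : 2 * ep <= r_ k / 2.
  by apply: le_trans (Hr2 k).2; apply: ler_wpM2l => //; exact: ltW.
have tphi : test_function A phi.
  apply: (test_function_intro cphi) => x clx.
  have [x' [/= px' xx']] := clx _ (nbhsx_ballx x ep ep0).
  rewrite ball_rVE in xx'.
  have [k tk] : exists k : 'I_n, tau k x' != 0.
    apply: contrapT => /forallNP H; move/eqP: px'; apply; apply: big1 => k _.
    by apply/eqP; apply: contrapT => /negP; exact: H.
  move: tk; rewrite mulf_eq0 negb_or => /andP[ck zk].
  set w := x' + _ in ck zk; have [y Ay yw] := zsupp _ zk.
  have wX : `|w - X k| <= 3 * r_ k.
    by rewrite leNgt; apply/negP => /(chi0 k w (ltn_ord k))/eqP; exact/negP.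
  have tv : `|t *: v k| <= r_ k / 2.
    rewrite normrZ (gtr0_norm t0); apply: le_trans (Hr1 k).2.
    by apply: ler_wpM2r => //; exact: ltW.
  have yX : `|y - X k| < 4 * r_ k.
    exact: dist_center_source ep0 (epk k) yw wX.
  (* x is only in the closure of the support, so it is reached from w + t v by a
   further displacement x - x', shorter than ep; in all, b is shorter than 2 ep. *)
have xw : x = y + (w - y + (x - x')) + t *: v k.
    rewrite addrA subrKC /w scalerN -!addrA (addrC (- (t *: v k))) -!addrA subrr addr0.
    by rewrite addrCA subrr addr0.
  have xX : `|x - X k| < 4 * r_ k.
    have -> : x - X k = (x - x') + t *: v k + (w - X k).
      by rewrite /w scalerN [in RHS]addrA [X in _ = X - _]addrACA subrr addr0 subrK.
    exact: dist_center_target (epk k) xx' tv wX.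
  rewrite xw; apply: (HC k).2 Ay yX t0 _ _; last by rewrite -xw.
  apply: le_lt_trans (Hr2 k).1; have [C0 _] := HC k; apply: (ler_wpM2l (ltW C0)).
  apply: le_trans (ler_normD _ _) _; rewrite mulr2n mulrDl mul1r; apply: lerD.
    by rewrite distrC; exact: le_trans yw (ltW ep2).
  exact: ltW (lt_trans xx' ep2).
have zE x : conv Z rho x = \sum_(k < n) chi k x * conv Z rho x.
  have [->|zx] := eqVneq (conv Z rho x) 0; first by rewrite big1// => k _; rewrite mulr0.
  have [y Ay yx] := zsupp x zx; have [p ps yp] := sC y (subset_closure Ay).
  rewrite -mulr_suml chi1 ?mul1r//; exists p => //.
  have := epk (Ordinal (eq_ind_r is_true ps (index_mem p s))).
  rewrite /r_ /= nth_index// => H.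
  exact: dist_center_cover ep0 H yx yp.
have cdiff (k : 'I_n) : csmooth (fun x => chi k x * conv Z rho x - tau k x).
  exact: csmoothB (cck k) (ctau k).
have dist : sobolev2 (fun x => conv Z rho x - phi x) <= e / 2.
  have -> : (fun x => conv Z rho x - phi x) =
      (fun x => \sum_(k < n) (chi k x * conv Z rho x - tau k x)).
    by apply/funext => x; rewrite sumrB -zE.
  apply: le_trans (sobolev2_sum cdiff) _.
  apply: (@le_trans _ _ (\sum_(k < n) e')).
    apply: ler_sum => k _; rewrite (sobolev2BC (cck k) (ctau k)).
    by apply: (Hr1 k).1 ep1 mrho _; rewrite (gtr0_norm t0).
  rewrite sumr_const card_ord -[_ *+ n]mulr_natr /e'.
  apply: (@le_trans _ _ (e / 2 / (n%:R + 1) * (n%:R + 1))).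
    by apply: ler_wpM2l; [exact: ltW|rewrite lerDl].
  by rewrite divfK// lt0r_neq0.
have [Ha Hb] := Hr3 ep rho ep3 mrho.
have sphi := csmooth_sqint cphi.
exists phi => //.
have := norm2_sub_le_entries tphi (ltW e0).
have H1 : nrm mu (fun x => Z x - phi x) <= e.
  apply: le_trans (nrm_dist sZ (csmooth_sqint cz) sphi) _.
  rewrite [leRHS]splitr; apply: lerD; first by rewrite nrmBC.
  exact: le_trans (nrm_le_sobolev2 _) dist.
have H2 i j : nrm mu (fun x => Gx i j x - partial i (partial j phi) x) <= e.
  apply: le_trans (nrm_dist (sG i j) (sqint_partial2 i j cz) (sqint_partial2 i j cphi)) _.
  rewrite [leRHS]splitr; apply: lerD; first by rewrite nrmBC; exact: Hb.
  rewrite -(partial2B i j (proj1 cz) (proj1 cphi)) -nrm_d2E.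
  exact: le_trans (nrm_d2_le_sobolev2 _ i j) dist.
move=> /(_ H1 H2) H.
rewrite -(ltr_pXn2r (isT : (0 < 2)%N)) ?nnegrE ?norm2_ge0 ?(ltW eps0)//.
apply: le_lt_trans H _; exact: normalized_eps_sqr_lt dim_ge1 eps0.
Qed.

End density.

(** * Traces on the skeleton *)

Section locality.
Context {R : realType} {d : nat}.
Implicit Types (A : set 'rV[R]_d) (z w : 'rV[R]_d -> R) (Th : 'rV[R]_d -> 'M[R]_d).

Lemma tr_dDivE A Th z : H2 A z -> tr_dDiv A Th z = bdual A Th z.
Proof. by move=> Hz; rewrite /tr_dDiv patchT// mem_set. Qed.

Lemma tr_GgradE A Th z : Hdivdiv A Th -> tr_Ggrad A z Th = bdual A Th z.
Proof. by move=> HT; rewrite /tr_Ggrad patchT// mem_set. Qed.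

Lemma L2_local A z w : (forall x, A x -> z x = w x) -> L2 A z -> L2 A w.
Proof. by move=> zw; rewrite !L2_sqint (ext_eq zw). Qed.

Lemma weak_hessian_local A z w : (forall x, A x -> z x = w x) ->
  weak_hessian A z = weak_hessian A w.
Proof.
move=> zw; apply/seteqP; split => G [LG HG]; split => // phi i j tphi.
  by rewrite (HG phi i j tphi); exact: inner_eql.
by rewrite (HG phi i j tphi); apply: inner_eql => x Ax; rewrite zw.
Qed.

Lemma hess_local A z w : (forall x, A x -> z x = w x) -> hess A z = hess A w.
Proof. by move=> zw; rewrite /hess (weak_hessian_local zw). Qed.

Lemma norm2_local A z w : (forall x, A x -> z x = w x) -> norm2 A z = norm2 A w.
Proof. by move=> zw; rewrite /norm2 (hess_local zw) (inner_eql _ zw) (inner_eqr _ zw). Qed.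

Lemma bdual_local A Th z w : (forall x, A x -> z x = w x) -> bdual A Th z = bdual A Th w.
Proof. by move=> zw; rewrite /bdual (hess_local zw) (inner_eqr _ zw). Qed.

Lemma H2_local A z w : (forall x, A x -> z x = w x) -> H2 A z -> H2 A w.
Proof.
move=> zw [Lz [G HG] dz]; split; [exact: L2_local zw Lz| |].
  by exists G; rewrite -(weak_hessian_local zw).
move=> eps /dz[phi sphi H]; exists phi; first exact: sphi.
rewrite -(@norm2_local A (z \- phi) (w \- phi)); first exact: H.
by move=> x Ax /=; rewrite zw.
Qed.

End locality.

Section green.
Context {R : realType} {d : nat}.
Local Notation mu := (lebesgue_rV R d).
Implicit Types (A : set 'rV[R]_d) (z w f : 'rV[R]_d -> R) (Th G : 'rV[R]_d -> 'M[R]_d).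

Lemma nrm_ext_le_norm2 A z G : open A -> bounded_set A -> weak_hessian A z G ->
  nrm mu (ext A z) <= norm2 A z /\
  forall i j, nrm mu (ext A (fun x => G x i j)) <= norm2 A z.
Proof.
move=> oA bA HG; have E := norm2_sqr oA bA HG.
have S0 := innermx_ge0 A G; have z0 := inner_ge0 A z.
split=> [|i j]; rewrite -(ler_pXn2r (isT : (0 < 2)%N)) ?nnegrE ?nrm_ge0 ?norm2_ge0// E -inner_nrm.
  by rewrite lerDl.
apply: (@le_trans _ _ (innermx A G G)); last by rewrite lerDr.
apply: (@le_sum2 _ _ (fun i j => inner A (fun x => G x i j) (fun x => G x i j)) i j) => *.
exact: inner_ge0.
Qed.

(** Both sides agree on test functions by the definition of the weak divergence, and
    their difference is bounded by a constant times the norm of z. *)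
Lemma H20_green A Th f z G : open A -> bounded_set A -> L2mx A Th -> weak_divdiv A Th f ->
  weak_hessian A z G -> H20 A z -> inner A f z = innermx A Th G.
Proof.
move=> oA bA LT [Lf Hf] HG [Lz _ dz].
pose C : R := nrm mu (ext A f) + \sum_i \sum_j nrm mu (ext A (fun x => Th x i j)).
have key eps : 0 < eps -> `|inner A f z - innermx A Th G| <= C * eps.
  move=> /dz[phi tphi /ltW H].
  have sphi := proj1 (test_function_csmooth tphi).
  have Lphi := L2_smooth oA bA sphi.
  have whp := weak_hessian_smooth oA bA sphi.
  have wh := weak_hessianB Lz Lphi HG whp.
  have [H1 H2] := nrm_ext_le_norm2 oA bA wh.
  have LD := L2B Lz Lphi; have LGD := wh.1.
  have -> : inner A f z - innermx A Th G =
      inner A f (fun x => z x - phi x) - innermx A Th (fun x => G x - smooth_hess phi x).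
    have E1 : inner A f (fun x => z x - phi x) = inner A f z - inner A f phi.
      rewrite !innerE extB ipBr//; exact/L2_sqint.
    have E2 : innermx A Th (fun x => G x - smooth_hess phi x) =
        innermx A Th G - innermx A Th (smooth_hess phi).
      rewrite /innermx -sumrB; apply: eq_bigr => i _; rewrite -sumrB; apply: eq_bigr => j _.
      have -> : inner A (fun x => Th x i j) (fun x => (G x - smooth_hess phi x) i j) =
          inner A (fun x => Th x i j) (fun x => G x i j - smooth_hess phi x i j).
        by apply: inner_eqr => x _; rewrite !mxE.
      rewrite !innerE extB ipBr//; apply/L2_sqint; [exact: (HG.1 i j)|exact: (whp.1 i j)|exact: LT].
    have E3 : inner A f phi = innermx A Th (smooth_hess phi).
      rewrite (Hf phi tphi) /innermx; apply: eq_bigr => i _; apply: eq_bigr => j _.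
      by rewrite smooth_hessE.
    by rewrite E1 E2 E3 opprB addrA subrK.
  rewrite mulrDl; apply: le_trans (ler_normB _ _) _; apply: lerD.
    rewrite innerE; apply: le_trans (normr_ip_le _ _) _; [exact/L2_sqint|exact/L2_sqint|].
    by apply: ler_wpM2l; [exact: nrm_ge0|exact: le_trans H1 H].
  rewrite mulr_suml; apply: le_trans (ler_norm_sum _ _ _) _; apply: ler_sum => i _.
  rewrite mulr_suml; apply: le_trans (ler_norm_sum _ _ _) _; apply: ler_sum => j _.
  rewrite innerE; apply: le_trans (normr_ip_le _ _) _.
  - by apply/L2_sqint; exact: LT.
  - by apply/L2_sqint; exact: LGD.
  - by apply: ler_wpM2l; [exact: nrm_ge0|exact: le_trans (H2 i j) H].
have C0 : 0 <= C.
  apply: addr_ge0; first exact: nrm_ge0.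
  by apply: sumr_ge0 => i _; apply: sumr_ge0 => j _; exact: nrm_ge0.
apply/eqP; rewrite -subr_eq0 -normr_le0; apply/ler_addgt0Pl => e e0; rewrite addr0.
have C1 : 0 < C + 1 by rewrite ltr_wpDl.
apply: le_trans (key (e / (C + 1)) _) _; first by rewrite divr_gt0.
rewrite mulrA ler_pdivrMr// mulrC; apply: (ler_wpM2l (ltW e0)); rewrite lerDl; exact: ler01.
Qed.

End green.

Lemma ler_sqr2 (R : realType) (a b : R) : 0 <= a -> 0 <= b -> (a ^+ 2 <= b ^+ 2) = (a <= b).
Proof. by move=> a0 b0; rewrite ler_pXn2r. Qed.

(** This lets near-minimizers replace minimizers in the infima of part (ii). *)
Lemma le_sum_sqr_approx (R : realType) n (a : R) (x : 'I_n -> R) : (forall k, 0 <= x k) ->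
  (forall e, 0 < e -> a <= \sum_k (x k + e) ^+ 2) -> a <= \sum_k x k ^+ 2.
Proof.
move=> x0 H; apply/ler_addgt0Pr => e e0.
pose D := \sum_k (2 * x k + 1).
have D0 : 0 <= D by apply: sumr_ge0 => k _; rewrite addr_ge0// mulr_ge0.
have D1 : 0 < D + 1 by rewrite ltr_wpDl.
pose t := Order.min 1 (e / (D + 1)).
have t0 : 0 < t by rewrite lt_min ltr01 divr_gt0.
have t1 : t <= 1 by rewrite ge_min lexx.
have te : t * D <= e.
  apply: (@le_trans _ _ (e / (D + 1) * (D + 1))); last by rewrite divfK// lt0r_neq0.
  apply: ler_pM; [exact: ltW|exact: D0|by rewrite ge_min lexx orbT|by rewrite lerDl].
apply: le_trans (H t t0) _; apply: le_trans (_ : \sum_k x k ^+ 2 + t * D <= _); last by rewrite lerD2l.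
rewrite mulr_sumr -big_split; apply: ler_sum => k _ /=.
have := x0 k; move: (x k) => y y0; clear -t0 t1 y0; nra.
Qed.

Section mesh.
Context {R : realType} {d : nat}.
Local Notation mu := (lebesgue_rV R d).
Variables (N : nat) (Omega : set 'rV[R]_d) (T : 'I_N -> set 'rV[R]_d).
Hypotheses (oO : open Omega) (bO : bounded_set Omega) (lO : lipschitz_boundary Omega)
  (hT : mesh Omega T).
Implicit Types (z w f phi : 'rV[R]_d -> R) (Th G : 'rV[R]_d -> 'M[R]_d).

Lemma mesh_open k : open (T k).
Proof. by case: hT => H _ _; have [] := H k. Qed.
Arguments mesh_open : clear implicits.

Lemma mesh_sub k : T k `<=` Omega.
Proof. by case: hT => H _ _; have [] := H k. Qed.
Arguments mesh_sub : clear implicits.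

Lemma mesh_bounded k : bounded_set (T k).
Proof. exact: (sub_bounded_set (mesh_sub k) bO). Qed.
Arguments mesh_bounded : clear implicits.

Lemma mesh_measurable k : measurable (T k).
Proof. exact: (open_rV_measurable (mesh_open k)). Qed.
Arguments mesh_measurable : clear implicits.

Lemma mesh_disjoint k l : k != l -> T k `&` T l = set0.
Proof. by case: hT => _ H _; exact: H. Qed.

Lemma mesh_cover : {ae mu, forall x, Omega x -> exists k, T k x}.
Proof.
apply: (@negligibleS _ _ _ _ [set y | exists2 k, k \in enum 'I_N & (closure (T k) `\` T k) y]).
  move=> x /= /not_implyP[Ox nT].
  have : closure Omega x by exact: subset_closure.
  case: hT => _ _ -> [k _ ck]; exists k; first by rewrite mem_enum.
  by split => // Tk; apply: nT; exists k.
apply: negligible_seq => k _.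
have lk : lipschitz_boundary (T k) by case: hT => H _ _; have [] := H k.
exact: (lipschitz_boundary_null (mesh_open k) (mesh_bounded k) lk).
Qed.

Let inner_mesh f g := @inner_partition _ _ _ _ _ mesh_measurable mesh_sub mesh_disjoint mesh_cover f g.
Let innermx_mesh G H := @innermx_partition _ _ _ _ _ mesh_measurable mesh_sub mesh_disjoint mesh_cover G H.

Lemma norm2_mesh z G : L2 Omega z -> weak_hessian Omega z G ->
  norm2 Omega z ^+ 2 = \sum_k norm2 (T k) z ^+ 2.
Proof.
move=> Lz HG; rewrite (norm2_sqr oO bO HG) (inner_mesh Lz Lz) (innermx_mesh HG.1 HG.1).
rewrite -big_split; apply: eq_bigr => k _ /=.
have wk := weak_hessian_sub (mesh_measurable k) (mesh_sub k) HG.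
by rewrite (norm2_sqr (mesh_open k) (mesh_bounded k) wk).
Qed.

Definition glue (F : 'I_N -> 'rV[R]_d -> R) x : R := \sum_k ext (T k) (F k) x.

Lemma glueE F k x : T k x -> glue F x = F k x.
Proof.
move=> Tx; rewrite /glue (bigD1 k)//= big1 => [|l lk]; first by rewrite addr0 ext_in.
apply: ext_out => Tl; move: lk; rewrite (disjoint_index mesh_disjoint Tl Tx) eqxx.
by [].
Qed.

Lemma L2_glue F : (forall k, L2 (T k) (F k)) -> L2 Omega (glue F).
Proof.
move=> LF; apply/L2_sqint; rewrite (@ext_id _ _ Omega (glue F)).
  by apply: sqint_sum => k; apply/L2_sqint; exact: LF.
move=> x; apply: contra_neqP => Ox; apply: big1 => k _; apply: ext_out => /mesh_sub.
exact: Ox.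
Qed.

Lemma H20_pairing0 z q : H20 Omega z -> trace_space_dDiv Omega T q -> pairing_S q z = 0.
Proof.
move=> Hz [Th HTh <-]; have [Lz eG _] := Hz; have [LT ef _] := HTh.
have wG := hessP eG; have wf := divdivP ef.
set G := hess Omega z in wG; set f := divdiv Omega Th in wf.
rewrite /pairing_S (eq_bigr (fun k => inner (T k) f z - innermx (T k) Th G)) => [|k _].
  rewrite sumrB -(inner_mesh wf.1 Lz) -(innermx_mesh LT wG.1).
  by rewrite (H20_green oO bO LT wf wG Hz) subrr.
have mk := mesh_measurable k; have sk := mesh_sub k.
rewrite tr_dDivE; last exact: (H20_H2_sub (mesh_open k) oO sk bO Hz).
apply: (bdualE (mesh_open k) (mesh_bounded k) (L2_sub mk sk Lz) _
  (weak_divdiv_sub mk sk wf) (weak_hessian_sub mk sk wG)).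
by move=> i j; exact: L2_sub mk sk (LT i j).
Qed.

Lemma sum_delta_sym (X : 'I_d -> 'I_d -> R) i j :
  \sum_a \sum_b ((delta_mx i j + delta_mx j i : 'M[R]_d) a b * X a b) = X i j + X j i.
Proof.
have H i' j' : \sum_a \sum_b ((delta_mx i' j' : 'M[R]_d) a b * X a b) = X i' j'.
  rewrite (bigD1 i')//= (bigD1 j')//= !mxE !eqxx mul1r !big1 ?addr0// => [a|b] H.
    by rewrite big1// => b _; rewrite mxE (negbTE H) mul0r.
  by rewrite mxE (negbTE H) andbF mul0r.
rewrite -(H i j) -(H j i) -big_split; apply: eq_bigr => a _; rewrite -big_split.
by apply: eq_bigr => b _; rewrite mxE mulrDl.
Qed.

(** Symmetric tensors only give access to the symmetrized entries of the piecewise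
    Hessian; they suffice because d_i d_j phi = d_j d_i phi. *)
Lemma pairing0_H20 z : H2mesh Omega T z ->
  (forall q, trace_space_dDiv Omega T q -> pairing_S q z = 0) -> H20 Omega z.
Proof.
move=> [Lz Hz] Hq.
have wh k : weak_hessian (T k) z (hess (T k) z) by case: (Hz k) => _ /hessP.
pose G x : 'M[R]_d := \matrix_(i, j) glue (fun k x => hess (T k) z x i j) x.
have LG : L2mx Omega G.
  move=> i j; have -> : (fun x => G x i j) = glue (fun k x => hess (T k) z x i j).
    by apply/funext => x; rewrite mxE.
  by apply: L2_glue => k; exact: ((wh k).1 i j).
have key Psi : smooth_sym_tensor Psi ->
    inner Omega (fun x => \sum_i \sum_j partial i (partial j (fun x => Psi x i j)) x) z =
    innermx Omega Psi G.
  move=> sPsi; set f := fun x => _.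
  have HP := Hdivdiv_smooth oO bO sPsi.
  have wf := weak_divdiv_smooth oO bO sPsi.
  have LP := L2mx_smooth oO bO sPsi.
  have := Hq _ (ex_intro2 _ _ Psi HP erefl).
  rewrite /pairing_S (eq_bigr (fun k => inner (T k) f z - innermx (T k) Psi G)) => [|k _].
    by rewrite sumrB -(inner_mesh wf.1 Lz) -(innermx_mesh LP LG) => /eqP; rewrite subr_eq0 => /eqP.
  have mk := mesh_measurable k; have sk := mesh_sub k.
  rewrite (tr_dDivE _ (Hz k)).
  rewrite (bdualE (mesh_open k) (mesh_bounded k) (L2_sub mk sk Lz)
    (fun i j => L2_sub mk sk (LP i j)) (weak_divdiv_sub mk sk wf) (wh k)).
  congr (_ - _); apply: eq_bigr => i _; apply: eq_bigr => j _.
  by apply: inner_eqr => x Tx; rewrite mxE (glueE _ Tx).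
pose Gs x : 'M[R]_d := \matrix_(i, j) (2^-1 * (G x i j + G x j i)).
have LGs : L2mx Omega Gs.
  move=> i j; apply/L2_sqint.
  have -> : ext Omega (fun x => Gs x i j) = fun x => 2^-1 *
      (ext Omega (fun x => G x i j) x + ext Omega (fun x => G x j i) x).
    apply/funext => x; have [Ox|Ox] := pselect (Omega x).
      by rewrite !(ext_in _ Ox) mxE.
    by rewrite !(ext_out _ Ox) addr0 mulr0.
  by apply: sqintZ; apply: sqintD; apply/L2_sqint; exact: LG.
apply: (weak_hessian_smooth_H20 oO bO lO Lz LGs) => phi i j sphi.
pose M : 'M[R]_d := delta_mx i j + delta_mx j i.
(* An admissible tensor must be symmetric, hence the two entries. *)
pose Psi x : 'M[R]_d := \matrix_(a, b) (M a b * phi x).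
have PE a b : (fun x => Psi x a b) = (fun x => M a b * phi x).
  by apply/funext => x; rewrite mxE.
have sPsi : smooth_sym_tensor Psi.
  split=> [a b|x]; first by rewrite PE; exact: smoothZ.
  apply/matrixP => a b; rewrite !mxE addrC; congr ((_ + _) * _).
    by rewrite andbC.
  by rewrite andbC.
have := key Psi sPsi.
have Lphi := L2_smooth oO bO sphi.
have -> : innermx Omega Psi G =
    \sum_a \sum_b (M a b * inner Omega phi (fun x => G x a b)).
  apply: eq_bigr => a _; apply: eq_bigr => b _; rewrite PE !innerE.
  have -> : ext Omega (fun x => M a b * phi x) = fun x => M a b * ext Omega phi x.
    apply/funext => x; have [Ox|Ox] := pselect (Omega x); first by rewrite !(ext_in _ Ox).
    by rewrite !(ext_out _ Ox) mulr0.
  by rewrite ipZl//; apply/L2_sqint => //; exact: LG.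
rewrite sum_delta_sym.
have -> : (fun x => \sum_a \sum_b partial a (partial b (fun x => Psi x a b)) x) =
    (fun x => 2 * partial i (partial j phi) x).
  apply/funext => x; rewrite -[RHS]/((1 + 1) * _) mulrDl mul1r.
  rewrite [X in _ = _ + X](_ : _ = partial j (partial i phi) x); last by rewrite partialC.
  rewrite -(sum_delta_sym (fun a b => partial a (partial b phi) x)).
  apply: eq_bigr => a _; apply: eq_bigr => b _.
  by rewrite PE (partialZ b _ sphi) (partialZ a _ (smooth_partial b sphi)).
move=> E.
have Lij a b := LG a b.
have -> : inner Omega (fun x => Gs x i j) phi =
    2^-1 * (inner Omega phi (fun x => G x i j) + inner Omega phi (fun x => G x j i)).
  rewrite innerC !innerE -ipDr; [|exact/L2_sqint/Lij|exact/L2_sqint/Lij|exact/L2_sqint].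
  rewrite -ipZr; [|by apply: sqintD; apply/L2_sqint; exact: Lij|exact/L2_sqint].
  congr ip; apply/funext => x; have [Ox|Ox] := pselect (Omega x).
    by rewrite !(ext_in _ Ox) mxE.
  by rewrite !(ext_out _ Ox) addr0 mulr0.
rewrite -E innerC; set p := partial i (partial j phi).
have sp : sqint mu (ext Omega p).
  by apply/L2_sqint; apply: L2_smooth oO bO _; do 2 apply: smooth_partial.
have -> : inner Omega (fun x => 2 * p x) z = 2 * inner Omega p z.
  rewrite !innerE -ipZl; [|exact: sp|exact/L2_sqint].
  congr ip; apply/funext => x; have [Ox|Ox] := pselect (Omega x); first by rewrite !(ext_in _ Ox).
  by rewrite !(ext_out _ Ox) mulr0.
by rewrite mulrA mulVf ?mul1r// pnatr_eq0.
Qed.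

(** The pairing of w with the trace of Th is the value of the trace of w at Th. *)
Lemma H20_of_tr_Ggrad z w : H20 Omega z -> L2 Omega w ->
  (forall k, H2 (T k) w) -> (forall k, tr_Ggrad (T k) w = tr_Ggrad (T k) z) ->
  H20 Omega w.
Proof.
move=> Hz Lw Hw Ew; apply: pairing0_H20; first by split.
move=> _ [Th HTh <-].
have Tz : trace_space_dDiv Omega T (fun k => tr_dDiv (T k) Th) by exists Th.
rewrite -(H20_pairing0 Hz Tz) /pairing_S; apply: eq_bigr => k _.
have Hzk := H20_H2_sub (mesh_open k) oO (mesh_sub k) bO Hz.
have HTk := Hdivdiv_sub (mesh_open k) oO (mesh_sub k) bO HTh.
by rewrite (tr_dDivE _ (Hw k)) (tr_dDivE _ Hzk) -!(tr_GgradE _ HTk) Ew.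
Qed.

Lemma tr_Ggrad_local A z w : (forall x, A x -> z x = w x) -> tr_Ggrad A z = tr_Ggrad A w.
Proof.
move=> zw; apply/funext => Th; have [HT|HT] := pselect (Hdivdiv A Th).
  by rewrite (tr_GgradE z HT) (tr_GgradE w HT) (bdual_local Th zw).
by rewrite /tr_Ggrad /patch memNset.
Qed.

(** One inequality restricts a global extension to the elements; the other glues
    near-optimal local extensions. *)
Lemma norm_Ggrad_sum v : trace_space_Ggrad0 Omega T v ->
  \sum_k norm_Ggrad (T k) (v k) ^+ 2 = norm_Ggrad0 Omega T v ^+ 2.
Proof.
move=> [z Hz <-].
pose Sk k := [set norm2 (T k) w | w in
  [set w | H2 (T k) w /\ tr_Ggrad (T k) w = tr_Ggrad (T k) z]].
pose S0 := [set norm2 Omega w | w in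
  [set w | H20 Omega w /\ (fun k => tr_Ggrad (T k) w) = (fun k => tr_Ggrad (T k) z)]].
have Hsub w k : H20 Omega w -> H2 (T k) w.
  exact: (H20_H2_sub (mesh_open k) oO (mesh_sub k) bO).
have lbk k : lbound (Sk k) 0 by move=> _ [w _ <-]; exact: norm2_ge0.
have lb0 : lbound S0 0 by move=> _ [w _ <-]; exact: norm2_ge0.
have nek k : Sk k !=set0.
  by exists (norm2 (T k) z); exists z => //; split => //; exact: Hsub.
have ne0 : S0 !=set0 by exists (norm2 Omega z); exists z.
have ik k : has_inf (Sk k) by split; [exact: nek|exists 0; exact: lbk].
have i0 : has_inf S0 by split; [exact: ne0|exists 0; exact: lb0].
have infk0 k : 0 <= inf (Sk k) by exact: (lb_le_inf (nek k) (lbk k)).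
have inf00 : 0 <= inf S0 by exact: (lb_le_inf ne0 lb0).
rewrite /norm_Ggrad0 -/S0.
rewrite (eq_bigr (fun k => inf (Sk k) ^+ 2)) => [|k _]; last by [].
have sum0 : 0 <= \sum_k inf (Sk k) ^+ 2 by apply: sumr_ge0 => k _; exact: sqr_ge0.
apply/eqP; rewrite eq_le; apply/andP; split.
  rewrite -(sqr_sqrtr sum0) (ler_sqr2 (sqrtr_ge0 _) inf00).
  apply: (lb_le_inf ne0) => _ [w [Hw Ew] <-]; have [Lw [G wG] _] := Hw.
  rewrite -(ler_sqr2 (sqrtr_ge0 _) (norm2_ge0 _ _)).
  rewrite (sqr_sqrtr sum0) (norm2_mesh Lw wG); apply: ler_sum => k _.
  rewrite (ler_sqr2 (infk0 k) (norm2_ge0 _ _)).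
  apply: (ge_inf (ik k).2); exists w; last by [].
  by split; [exact: Hsub|exact: (congr1 (fun q => q k) Ew)].
have key (F : 'I_N -> 'rV[R]_d -> R) :
    (forall k, H2 (T k) (F k) /\ tr_Ggrad (T k) (F k) = tr_Ggrad (T k) z) ->
    inf S0 ^+ 2 <= \sum_k norm2 (T k) (F k) ^+ 2.
  move=> HF; pose w := glue F.
  have wE k x : T k x -> F k x = w x by move=> Tx; rewrite /w (glueE F Tx).
  have Lw : L2 Omega w by apply: L2_glue => k; case: (HF k) => -[].
  have Hw k : H2 (T k) w by apply: (H2_local (wE k)); exact: (HF k).1.
  have Ew k : tr_Ggrad (T k) w = tr_Ggrad (T k) z.
    by rewrite -(tr_Ggrad_local (wE k)); exact: (HF k).2.
  have w0 := H20_of_tr_Ggrad Hz Lw Hw Ew; have [_ [G wG] _] := w0.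
  rewrite (eq_bigr (fun k => norm2 (T k) w ^+ 2)) => [|k _]; last by rewrite (norm2_local (wE k)).
  rewrite -(norm2_mesh Lw wG) (ler_sqr2 inf00 (norm2_ge0 _ _)).
  apply: (ge_inf i0.2); exists w; last by [].
  by split; [exact: w0|exact/funext].
apply: (le_sum_sqr_approx infk0) => e e0.
have /choice[F HF] : forall k, exists w, (H2 (T k) w /\ tr_Ggrad (T k) w = tr_Ggrad (T k) z) /\
    norm2 (T k) w < inf (Sk k) + e.
  by move=> k; have [_ [w Hw <-] He] := inf_adherent e0 (ik k); exists w.
apply: le_trans (key F (fun k => (HF k).1)) _; apply: ler_sum => k _.
rewrite (ler_sqr2 (norm2_ge0 _ _) (addr_ge0 (infk0 k) (ltW e0))).
exact: ltW (HF k).2.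
Qed.

End mesh.

Theorem proposition8 (R : realType) (d : nat) (hd : d = 2%N \/ d = 3%N)
    (Omega : set 'rV[R]_d) (hOmega : bounded_sc_lipschitz_domain Omega)
    (N : nat) (T : 'I_N -> set 'rV[R]_d) (hT : mesh Omega T) :
  (forall z : 'rV[R]_d -> R, H2mesh Omega T z ->
     (H20 Omega z <->
      forall q, trace_space_dDiv Omega T q -> pairing_S q z = 0)) /\
  (forall v, trace_space_Ggrad0 Omega T v ->
     \sum_(i < N) norm_Ggrad (T i) (v i) ^+ 2 = norm_Ggrad0 Omega T v ^+ 2).
Proof.
have [_ oO bO _ lO] := hOmega; split => [z Hz|v Hv].
  split=> [Hz0 q|]; first exact: (H20_pairing0 oO bO hT Hz0).
  exact: (pairing0_H20 oO bO lO hT Hz).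
exact: (norm_Ggrad_sum oO bO lO hT Hv).
Qed.
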